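(* Let $(Y,\lambda)$ be a standard Borel space equipped with a Borel $\sigma$-finite measure $\lambda$ (possibly with atoms). Then the following are equivalent: (i) $\mathrm{Aut}(Y,\lambda)$ has the automatic continuity property; (ii) there are only finitely many positive reals $r$ whose $\lambda$-atomic multiplicity is finite and at least $2$ (i.e. belongs to $[2,+\infty[$).
   Context: $\mathrm{Aut}(Y,\lambda)$ is the group of all Borel bijections $T:Y\to Y$ such that $\lambda(T^{-1}(A))=\lambda(A)$ for all Borel $A\subseteq Y$, two such bijections being identified if they coincide on a conull set. It is a Polish group for the weak topology, in which $T_n\to T$ if and only if $\lambda(T_n(A)\bigtriangleup T(A))\to 0$ for every Borel $A\subseteq Y$ with $\lambda(A)<+\infty$. A Polish group $G$ has the automatic continuity property if every group homomorphism $\pi:G\to H$ into a separable topological group $H$ is continuous. Since $Y$ is standard and $\lambda$ is $\sigma$-finite, $\lambda$ has only countably many atoms, each of which is a singleton of finite measure. The $\lambda$-atomic multiplicity of a real $r>0$ is the (possibly infinite) number of atoms in $Y$ whose measure is equal to $r$. *)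

(* Defs.v *)
From HB Require Import structures.
From mathcomp Require Import all_boot all_order all_algebra finmap.
From mathcomp Require Import all_classical all_reals all_analysis.

Set Implicit Arguments.
Unset Strict Implicit.
Unset Printing Implicit Defensive.

Import Order.TTheory GRing.Theory Num.Theory.
Import numFieldNormedType.Exports.

Local Open Scope classical_set_scope.
Local Open Scope ring_scope.

HB.mixin Record isTopologicalGroup G of Topological G & Group G := {
  mulg_continuous : continuous (fun x : G * G => (x.1 * x.2)%g) ;
  invg_continuous : continuous (fun x : G => (x^-1)%g)
}.

#[short(type="topologicalGroupType")]
HB.structure Definition TopologicalGroup :=
  {G of Topological G & Group G & isTopologicalGroup G}.

Definition separable (T : topologicalType) : Prop :=
  exists2 D : set T, countable D & dense D.

(* H is not assumed to be Hausdorff. *)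
Definition automatic_continuity (G : topologicalGroupType) : Prop :=
  forall H : topologicalGroupType, separable H ->
  forall pi : {multiplicative G -> H}, continuous pi.

#[short(type="completeMetricType")]
HB.structure Definition CompleteMetric (K : numDomainType) :=
  {T of Metric K T & Complete T}.

(* Isomorphic, as a measurable space, to a Polish space with its Borel
   sigma-algebra. *)
Definition standard_borel (R : realType) d (Y : measurableType d) : Prop :=
  exists2 X : completeMetricType R, separable X &
  exists2 f : Y -> X, bijective f &
    forall B : set X, measurable (f @^-1` B) <-> <<s @open X >> B.

Section automorphisms.
Context d (Y : measurableType d) (R : realType).
Variable mu : {measure set Y -> \bar R}.

(* A Borel bijection is required to have a Borel inverse, i.e. to map Borel
   sets to Borel sets; on a standard Borel space this is automatic
   (Lusin-Souslin). *)
Record mpbij := MPBij {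
  mpfun :> Y -> Y ;
  mpfun_bij : bijective mpfun ;
  mpfun_measurable : measurable_fun setT mpfun ;
  mpfun_image : forall A, measurable A -> measurable (mpfun @` A) ;
  mpfun_preserving : forall A, measurable A -> mu (mpfun @^-1` A) = mu A
}.

HB.instance Definition _ := gen_eqMixin mpbij.
HB.instance Definition _ := gen_choiceMixin mpbij.

Lemma mpfun_preimage (S : mpbij) A : measurable A -> measurable (S @^-1` A).
Proof.
by move=> mA; rewrite -[X in measurable X]setTI; exact: mpfun_measurable.
Qed.

Fact mpbij_id_image A : measurable A -> measurable ((@idfun Y) @` A).
Proof. by rewrite image_id. Qed.

Definition mpbij1 : mpbij :=
  @MPBij idfun (Bijective (fun=> erefl) (fun=> erefl)) (@measurable_id _ _ _)
    mpbij_id_image (fun _ _ => erefl).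

Fact mpbijM_measurable (S T : mpbij) : measurable_fun setT (S \o T).
Proof. by apply: measurableT_comp; exact: mpfun_measurable. Qed.

Fact mpbijM_image (S T : mpbij) A :
  measurable A -> measurable ((S \o T) @` A).
Proof. by move=> mA; rewrite -image_comp; do 2!apply: mpfun_image. Qed.

Fact mpbijM_preserving (S T : mpbij) A :
  measurable A -> mu ((S \o T) @^-1` A) = mu A.
Proof.
move=> mA; rewrite comp_preimage mpfun_preserving ?mpfun_preserving//.
exact: mpfun_preimage.
Qed.

Definition mpbijM (S T : mpbij) : mpbij :=
  MPBij (bij_comp (mpfun_bij S) (mpfun_bij T)) (@mpbijM_measurable S T)
    (@mpbijM_image S T) (@mpbijM_preserving S T).

Fact mpfun_inv_ex (S : mpbij) : exists g, cancel S g /\ cancel g S.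
Proof. by have [g] := mpfun_bij S; exists g. Qed.

Definition mpfun_inv (S : mpbij) : Y -> Y := projT1 (cid (mpfun_inv_ex S)).

Lemma mpfunK (S : mpbij) : cancel S (mpfun_inv S).
Proof. by rewrite /mpfun_inv; case: cid => g []. Qed.

Lemma mpfun_invK (S : mpbij) : cancel (mpfun_inv S) S.
Proof. by rewrite /mpfun_inv; case: cid => g []. Qed.

Lemma image_mpfun_inv (S : mpbij) A : mpfun_inv S @` A = S @^-1` A.
Proof.
apply/seteqP; split => [_ [x Ax <-]|x Ax] /=; first by rewrite mpfun_invK.
by exists (S x) => //; exact: mpfunK.
Qed.

Lemma preimage_mpfun_inv (S : mpbij) A : mpfun_inv S @^-1` A = S @` A.
Proof.
apply/seteqP; split => [x Ax|_ [x Ax <-]] /=; last by rewrite mpfunK.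
by exists (mpfun_inv S x) => //; exact: mpfun_invK.
Qed.

Lemma mpfun_image_preserving (S : mpbij) A :
  measurable A -> mu (S @` A) = mu A.
Proof.
move=> mA; rewrite -(mpfun_preserving S); last exact: mpfun_image.
by rewrite -preimage_mpfun_inv -comp_preimage (_ : _ \o _ = id)//;
  apply/funext => x /=; rewrite mpfunK.
Qed.

Fact mpbijV_measurable (S : mpbij) : measurable_fun setT (mpfun_inv S).
Proof.
by move=> _ A mA; rewrite setTI preimage_mpfun_inv; exact: mpfun_image.
Qed.

Fact mpbijV_image (S : mpbij) A :
  measurable A -> measurable (mpfun_inv S @` A).
Proof. by move=> mA; rewrite image_mpfun_inv; exact: mpfun_preimage. Qed.

Fact mpbijV_preserving (S : mpbij) A :
  measurable A -> mu (mpfun_inv S @^-1` A) = mu A.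
Proof.
by move=> mA; rewrite preimage_mpfun_inv; exact: mpfun_image_preserving.
Qed.

Definition mpbijV (S : mpbij) : mpbij :=
  MPBij (Bijective (mpfun_invK S) (mpfunK S)) (mpbijV_measurable S)
    (@mpbijV_image S) (@mpbijV_preserving S).

Definition mpbij_eqae (S T : mpbij) : bool := `[< {ae mu, S =1 T} >].

Fact mpbij_eqae_equiv : equiv_class_of mpbij_eqae.
Proof.
split=> [S|S T|T S U].
- by apply/asboolP; apply: aeW.
- by apply/asbool_equiv_eq; split; apply: filterS => x.
- move=> /asboolP ST /asboolP TU; apply/asboolP.
  by apply: filterS2 ST TU => x -> ->.
Qed.

Canonical mpbij_eqae_rel := EquivRelPack mpbij_eqae_equiv.

Definition Aut := {eq_quot mpbij_eqae}%qT.


Local Notation "\pi S" := (\pi_Aut%qT S : Aut) (at level 10).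

Lemma Aut_eqP (S T : mpbij) : reflect {ae mu, S =1 T} (\pi S == \pi T).
Proof. by rewrite eqquotE; exact: asboolP. Qed.

(* An arbitrary representative of the class. *)
Definition Aut_fun (T : Aut) : mpbij := repr T.
Coercion Aut_fun : Aut >-> mpbij.

Lemma Aut_funK (T : Aut) : \pi (T : mpbij) = T.
Proof. exact: reprK. Qed.

Lemma Aut_funE (S : mpbij) : {ae mu, \pi S =1 S}.
Proof. by apply/Aut_eqP; rewrite Aut_funK. Qed.

Lemma ae_preimage (S : mpbij) (P : set Y) :
  {ae mu, forall x, P x} -> {ae mu, forall x, P (S x)}.
Proof.
move=> [A [mA A0 PA]]; exists (S @^-1` A); split.
- exact: mpfun_preimage.
- by rewrite mpfun_preserving.
- by move=> x /= NPx; apply: PA.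
Qed.

Definition Aut1 : Aut := \pi mpbij1.
Definition AutM (S T : Aut) : Aut := \pi (mpbijM S T).
Definition AutV (T : Aut) : Aut := \pi (mpbijV T).

Lemma AutME (S T : mpbij) : AutM (\pi S) (\pi T) = \pi (mpbijM S T).
Proof.
apply/eqP/Aut_eqP.
have := ae_preimage (\pi T) (Aut_funE S).
by apply: filterS2 (Aut_funE T) => x /= TE ->; rewrite TE.
Qed.

Lemma AutVE (S : mpbij) : AutV (\pi S) = \pi (mpbijV S).
Proof.
apply/eqP/Aut_eqP.
apply: filterS (ae_preimage (mpbijV S) (Aut_funE S)) => x /= SE.
by rewrite -[X in mpfun_inv _ X](mpfun_invK S) -SE mpfunK.
Qed.

Fact AutMA : associative AutM.
Proof.
move=> S T U; rewrite -(Aut_funK S) -(Aut_funK T) -(Aut_funK U) !AutME.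
by apply/eqP/Aut_eqP; exact: aeW.
Qed.

Fact Aut1M : left_id Aut1 AutM.
Proof.
by move=> T; rewrite -(Aut_funK T) AutME; apply/eqP/Aut_eqP; exact: aeW.
Qed.

Fact AutM1 : right_id Aut1 AutM.
Proof.
by move=> T; rewrite -(Aut_funK T) AutME; apply/eqP/Aut_eqP; exact: aeW.
Qed.

Fact AutVM : left_inverse Aut1 AutV AutM.
Proof.
move=> T; rewrite -(Aut_funK T) AutVE AutME; apply/eqP/Aut_eqP.
by apply: aeW => x; exact: mpfunK.
Qed.

Fact AutMV : right_inverse Aut1 AutV AutM.
Proof.
move=> T; rewrite -(Aut_funK T) AutVE AutME; apply/eqP/Aut_eqP.
by apply: aeW => x; exact: mpfun_invK.
Qed.

HB.instance Definition _ := Choice.on Aut.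
HB.instance Definition _ := isGroup.Build Aut AutMA Aut1M AutM1 AutVM AutMV.

Local Open Scope ereal_scope.

Definition weak_subbase : set (set Aut) :=
  [set U | exists (T : Aut) (A : set Y) (e : R),
    [/\ measurable A, mu A < +oo, (0 < e)%R &
        U = [set S : Aut | mu ((S @` A) `+` (T @` A)) < e%:E]]].

HB.instance Definition _ := isSubBaseTopological.Build Aut weak_subbase id.

Lemma measurable_setY (A B : set Y) :
  measurable A -> measurable B -> measurable (A `+` B).
Proof. by move=> mA mB; apply: measurableU; exact: measurableD. Qed.

Lemma le_mu_setY (A B C : set Y) :
  measurable A -> measurable B -> measurable C ->
  mu (A `+` C) <= mu (A `+` B) + mu (B `+` C).
Proof.
move=> mA mB mC.
have mAB := measurable_setY mA mB; have mBC := measurable_setY mB mC.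
apply: le_trans (measureU2 _ mAB mBC); apply: le_measure; rewrite ?inE.
- exact: measurable_setY.
- exact: measurableU.
- move=> x /=; case: (pselect (B x)); tauto.
Qed.

Lemma mpfun_image_setY (S : mpbij) (A B : set Y) :
  measurable A -> measurable B ->
  mu ((S @` A) `+` (S @` B)) = mu (A `+` B).
Proof.
move=> mA mB; rewrite -(mpfun_image_preserving S (measurable_setY mA mB)).
by rewrite -!preimage_mpfun_inv.
Qed.

Lemma eqae_image (S T : mpbij) (A : set Y) : measurable A ->
  {ae mu, S =1 T} -> mu ((S @` A) `+` (T @` A)) = 0.
Proof.
move=> mA [N [mN N0 STN]]; apply: measure_negligible.
  by apply: measurable_setY; exact: mpfun_image.
exists ((S @` N) `|` (T @` N)); split.
- by apply: measurableU; exact: mpfun_image.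
- apply: (@null_set_setU _ _ _ mu) => //; try exact: mpfun_image.
  + by rewrite mpfun_image_preserving.
  + by rewrite mpfun_image_preserving.
- move=> y /= [[[x Ax <-] nT]|[[x Ax <-] nS]]; [left|right];
    exists x => //; apply: STN => /= STx.
  + by apply: nT; exists x.
  + by apply: nS; exists x.
Qed.

Lemma open_weak_subbase (U : set Aut) : weak_subbase U -> open U.
Proof.
move=> WU; exists [set U]; last by rewrite bigcup_set1.
move=> _ ->; exists [fset U]%fset; last by rewrite set_fset1 bigcap_set1.
by move=> V /fset1P ->; exact/mem_set.
Qed.

Lemma weak_cvg_near (F : set_system Aut) (T : Aut) : Filter F ->
  F --> T <->
  forall A (e : R), measurable A -> mu A < +oo -> (0 < e)%R ->
    \forall S \near F, mu ((Aut_fun S @` A) `+` (T @` A)) < e%:E.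
Proof.
move=> FF; split => [FT A e mA Afin e0|FT U].
  apply: FT; apply: open_nbhs_nbhs; split.
    by apply: open_weak_subbase; exists T, A, e.
  by rewrite /= setYK measure0 lte_fin.
rewrite nbhsE => -[_ [[B sB <-] [C BC CT]] sUBA].
rewrite nbhs_filterE; apply: filterS sUBA _; apply: (@filterS _ _ _ C).
  by move=> ? ?; exists C.
have /sB [D sD IDeC] := BC; rewrite -IDeC; apply: filter_bigI => E DE.
have /sD := DE; rewrite inE => - [T0 [A [e [mA Afin e0 EE]]]].
have : E T by move: CT; rewrite -IDeC => /(_ _ DE).
rewrite EE /= => ET.
have Tfin : mu ((T @` A) `+` (T0 @` A)) \is a fin_num.
  by rewrite ge0_fin_numE //; exact: lt_trans ET (ltry _).
have e'0 : (0 < e - fine (mu ((T @` A) `+` (T0 @` A))))%R.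
  by rewrite subr_gt0 -lte_fin fineK.
have := FT _ _ mA Afin e'0; apply: filterS => S /= SE.
have mS (V : mpbij) : measurable (V @` A) by exact: mpfun_image.
apply: le_lt_trans (le_mu_setY (mS S) (mS T) (mS T0)) _.
by move: SE; rewrite EFinB fineK// lteBrDr.
Qed.

Lemma weak_cvgP (F : set_system Aut) (T : Aut) : Filter F ->
  F --> T <->
  forall A, measurable A -> mu A < +oo ->
    mu ((Aut_fun S @` A) `+` (T @` A)) @[S --> F] --> (0 : \bar R).
Proof.
move=> FF; rewrite weak_cvg_near; split => [FT A mA Afin|FT A e mA Afin e0].
  apply/fine_cvgP; split.
    apply: filterS (FT A 1%R mA Afin ltr01) => S /lt_trans /(_ (ltry _)) SA.
    by rewrite ge0_fin_numE.
  apply/cvgrPdist_lt => e e0; apply: filterS (FT A e mA Afin e0) => S /= SA.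
  rewrite sub0r normrN ger0_norm ?fine_ge0//.
  by rewrite -lte_fin fineK// ge0_fin_numE// (lt_trans SA)// ltry.
have /fine_cvgP[FTfin /cvgrPdist_lt /(_ _ e0)] := FT A mA Afin.
apply: filterS2 FTfin => S /= Sfin.
by rewrite sub0r normrN ger0_norm ?fine_ge0// -lte_fin fineK.
Qed.

Fact AutM_cvg (S0 T0 : Aut) :
  AutM z.1 z.2 @[z --> (S0, T0)] --> AutM S0 T0.
Proof.
apply/weak_cvg_near => A e mA Afin e0.
have mS (V : mpbij) B : measurable B -> measurable (V @` B).
  exact: mpfun_image.
have e20 : (0 < e / 2)%R by rewrite divr_gt0.
have mB := mS T0 A mA.
have Bfin : mu (T0 @` A) < +oo by rewrite mpfun_image_preserving.
have /weak_cvg_near /(_ _ _ mB Bfin e20) nS : nbhs S0 --> S0 by [].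
have /weak_cvg_near /(_ _ _ mA Afin e20) nT : nbhs T0 --> T0 by [].
pose B := T0 @` A.
exists ([set S : Aut | mu ((S @` B) `+` (S0 @` B)) < (e / 2)%:E],
        [set T : Aut | mu ((T @` A) `+` (T0 @` A)) < (e / 2)%:E]) => //.
move=> [S T] /= [SE TE].
have MA (U V : Aut) : mu ((AutM U V @` A) `+` (U @` (V @` A))) = 0.
  by rewrite image_comp; apply: eqae_image (mpbijM U V) A mA (Aut_funE _).
have MA' (U V : Aut) : mu ((U @` (V @` A)) `+` (AutM U V @` A)) = 0.
  by rewrite setYC.
have mSS (U V : mpbij) : measurable (U @` (V @` A)) by exact/mS/mS.
apply: le_lt_trans (le_mu_setY (mS _ _ mA) (mSS S T) (mS _ _ mA)) _.
rewrite MA add0e.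
apply: le_lt_trans (le_mu_setY (mSS _ _) (mSS S0 T0) (mS _ _ mA)) _.
rewrite MA' adde0.
apply: le_lt_trans (le_mu_setY (mSS _ _) (mSS S T0) (mSS _ _)) _.
rewrite (mpfun_image_setY S (mS T _ mA) mB).
by rewrite [e in e%:E]splitr EFinD lteD.
Qed.

Fact AutM_continuous : continuous (fun z : Aut * Aut => AutM z.1 z.2).
Proof. by move=> [S T]; exact: AutM_cvg. Qed.

Fact AutV_cvg (T0 : Aut) : AutV T @[T --> T0] --> AutV T0.
Proof.
have FF : Filter (AutV T @[T --> T0])
  by exact: (@fmap_filter _ _ AutV _ (nbhs_filter T0)).
apply/weak_cvg_near => A e mA Afin e0.
have mS (V : mpbij) B : measurable B -> measurable (V @` B).
  exact: mpfun_image.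
have mB := mS (mpbijV T0) A mA.
have Bfin : mu (mpbijV T0 @` A) < +oo by rewrite mpfun_image_preserving.
have /weak_cvg_near /(_ _ _ mB Bfin e0) : nbhs T0 --> T0 by [].
apply: filterS => T /= TE.
have VA (U : Aut) : mu ((AutV U @` A) `+` (mpbijV U @` A)) = 0.
  exact: eqae_image (mpbijV U) A mA (Aut_funE _).
apply: le_lt_trans
  (le_mu_setY (mS _ _ mA) (mS (mpbijV T) _ mA) (mS _ _ mA)) _.
rewrite VA add0e.
apply: le_lt_trans
  (le_mu_setY (mS _ _ mA) (mS (mpbijV T0) _ mA) (mS _ _ mA)) _.
rewrite [X in _ + X](_ : _ = 0) ?adde0; last by rewrite setYC.
rewrite -(mpfun_image_setY T (mS _ _ mA) (mS _ _ mA)) setYC.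
have VK (U : mpbij) : U @` (mpbijV U @` A) = A.
  by rewrite image_mpfun_inv image_preimage//; apply/seteqP; split=> // y _;
    exists (mpfun_inv U y) => //; exact: mpfun_invK.
by rewrite (VK T) -[X in _ `+` X](VK T0).
Qed.

Fact AutV_continuous : continuous AutV.
Proof. exact: AutV_cvg. Qed.

HB.instance Definition _ :=
  isTopologicalGroup.Build Aut AutM_continuous AutV_continuous.
End automorphisms.

(* As Y is standard Borel and mu is sigma-finite, every atom is, up to a null
   set, a singleton. *)
Definition atomic_multiplicity d (Y : measurableType d) (R : realType)
    (mu : set Y -> \bar R) (r : R) : \bar R :=
  counting [set y | mu [set y] = r%:E].

(* Main.v *)
(* (ii) => (i). Let pi : Aut(Y, lambda) -> H be a morphism and V a neighbourhood of 1 in H. Choose V0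
   with (V0^-1 V0)^14 inside V and cover H by countably many translates of V0; this covers Aut(Y, lambda)
   by countably many sets A_n, and pi maps W^14 into V, where W is the union of the A_n^-1 A_n.
   If pi^-1(V) were not a neighbourhood of 1, there would be elements T of Aut(Y, lambda) outside
   pi^-1(V), arbitrarily close to 1, which by (ii) fix all atoms of finite multiplicity. A closing-off
   argument gives a countable ring B of sets of finite measure and a countable field of reals containing
   their measures, such that B is invariant under one such bad T for every finite subset of B and every
   precision. Measure preserving automorphisms of B with finite partitions form a Fraisse class with
   amalgamation, so the automorphism group of B has ample generics, and the Steinhaus argument for
   ample generics shows that W^4 contains the pointwise stabilizer of a finite partition P. An automorphism
   close to 1 on P is a product p q p' with p, p' fixing P and q supported in a small set C, and a second
   diagonal argument on disjoint copies of C writes q as w r w^-1 with w in W and r fixing P. Hence a bad T lies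
   in W^14, a contradiction. Every automorphism of B is induced by an element of Aut(Y, lambda), because
   (Y, lambda) is standard.
   (i) => (ii). If infinitely many multiplicities are in [2, +oo[, the limit along a nonprincipal
   ultrafilter of the signs of the permutations induced on the corresponding finite sets of atoms is a
   morphism to {1, -1} which is not continuous, since swapping two atoms of every large index tends to 1. *)
From HB Require Import structures.
Require Import Defs.
From mathcomp Require Import finmap fingroup perm.
From mathcomp Require Import all_boot all_order all_algebra.
From mathcomp Require Import all_classical all_reals all_analysis.
From mathcomp Require Import ring lra.
Set Implicit Arguments.
Unset Strict Implicit.
Unset Printing Implicit Defensive.
Import Order.TTheory GRing.Theory Num.Theory.
Import numFieldNormedType.Exports.
Local Open Scope classical_set_scope.
Local Open Scope ring_scope.

(** The automorphism group of a countable ring [B] has a finer topology, in which stabilizers of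
    finite partitions are open, and there they are. The price is that such a stabilizer is no weak
    neighbourhood of 1, since a map close to 1 may still exchange a little mass between the cells;
    this is what the set C and the second diagonal argument repair. That argument glues infinitely
    many automorphisms of [B] with disjoint supports. The result need not preserve [B], so it has to
    live in Aut(Y, lambda), and the abstract part works with a homomorphism [io] into a group and a
    gluing hypothesis. The masses form a field because the relatively independent joining has cells
    of mass mu c * mu e / mu a. The exponent 4 comes from y = w x w^-1 t^-1 with w, x, t in W. Atoms
    of finite multiplicity stay out of [B], where every atom must have infinitely many disjoint
    copies; hence the bad T have to fix them. *)

(** * Finite lists of disjoint sets *)

Section lists_of_sets.
Variable Y : Type.
Implicit Types (a b : set Y) (s t : seq (set Y)).

Definition dj a b := forall y, a y -> b y -> False.

Lemma djC a b : dj a b -> dj b a.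
Proof. by move=> h y hb ha; exact: (h y). Qed.

Lemma dj_self a : dj a a -> a = set0.
Proof. by move=> h; rewrite -subset0 => y ay; exact: (h y). Qed.

Lemma djS a b c d : dj a b -> c `<=` a -> d `<=` b -> dj c d.
Proof. by move=> h ca db y /ca ay /db; exact: h. Qed.

Lemma setD_eq0P a b : a `\` b = set0 <-> a `<=` b.
Proof. by rewrite setD_eq0. Qed.

Definition uns s : set Y := [set y | exists2 a, a \in s & a y].

Lemma uns_nil : uns [::] = set0.
Proof. by apply/seteqP; split => y // [a]. Qed.

Lemma uns_cons a s : uns (a :: s) = a `|` uns s.
Proof.
apply/seteqP; split => y.
  by move=> [b]; rewrite inE => /orP[/eqP->|bs by_]; [left|right; exists b].
move=> [ay|[b bs b_y]]; first by exists a; rewrite ?mem_head.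
by exists b; rewrite // inE bs orbT.
Qed.

Lemma uns_cat s t : uns (s ++ t) = uns s `|` uns t.
Proof.
apply/seteqP; split => y.
  by move=> [b]; rewrite mem_cat => /orP[bs by_|bs by_]; [left|right]; exists b.
by move=> [[b bs b_y]|[b bs b_y]]; exists b; rewrite // mem_cat bs ?orbT.
Qed.

Lemma sub_uns a s : a \in s -> a `<=` uns s.
Proof. by move=> ? y ?; exists a. Qed.

Definition djs s := {in s &, forall a b, a <> b -> dj a b}.

Lemma djs_cons a s : a \notin s -> djs (a :: s) -> dj a (uns s) /\ djs s.
Proof.
move=> ans h; split=> [y ay [b bs b_y]|b c bs cs].
  apply: (h a b _ _ _ y) => //; rewrite ?mem_head// ?inE ?bs ?orbT//.
  by move=> ab; move: ans; rewrite ab bs.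
by apply: h; rewrite inE ?bs ?cs orbT.
Qed.
End lists_of_sets.

(** * Countable rings of sets with a strictly positive measure *)

Section Core.
Variables (R : realFieldType) (Y : Type).
Variables (B : set (set Y)) (mu : set Y -> R) (At Xf : set Y) (V : set R).

Definition atm (a : set Y) := exists2 p, At p & a = [set p].
Definition dff (a : set Y) := dj a At.
Definition piece (a : set Y) := [/\ B a, a <> set0 & atm a \/ dff a].
Definition sim (a b : set Y) := mu a = mu b /\ (atm a <-> atm b).

(* At stands for the atoms of infinite multiplicity (those of finite multiplicity meet no member
   of B), Xf for the diffuse part when it has finite measure and set0 otherwise. *)
Record mring : Prop := MRing {
  r_B0 : B set0;
  r_BU : forall a b, B a -> B b -> B (a `|` b);
  r_BD : forall a b, B a -> B b -> B (a `\` b);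
  r_muU : forall a b, B a -> B b -> dj a b -> mu (a `|` b) = mu a + mu b;
  r_mu_gt0 : forall a, B a -> a <> set0 -> 0 < mu a;
  r_Vmu : forall a, B a -> V (mu a);
  r_VB : forall u v, V u -> V v -> V (u - v);
  r_VM : forall u v, V u -> V v -> V (u * v);
  r_VI : forall u, V u -> V u^-1;
  r_SP : forall a v, B a -> dff a -> V v -> 0 < v < mu a ->
  exists b, [/\ B b, b `<=` a & mu b = v];
  r_PD : forall b, B b -> exists s,
  [/\ uniq s, {in s, forall a, piece a}, djs s & uns s = b];
  r_BXf : B Xf;
  r_dXf : dff Xf;
  r_XfT : Xf <> set0 -> forall a, B a -> dff a -> a `<=` Xf;
  r_E : exists E : nat -> set Y,
    (forall n, B (E n)) /\ forall b, B b -> exists n, E n = b;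
  r_INF : forall a b, piece a -> dj a Xf -> B b ->
  exists c, [/\ piece c, sim a c & dj c b] }.

Hypothesis H : mring.
Let B0 := r_B0 H.
Let BU := r_BU H.
Let BD := r_BD H.
Let muU := r_muU H.
Let mu_gt0 := r_mu_gt0 H.
Let Vmu := r_Vmu H.
Let VB := r_VB H.
Let VM := r_VM H.
Let VI := r_VI H.
Let SP := r_SP H.
Let PD := r_PD H.
Let BXf := r_BXf H.
Let dXf := r_dXf H.
Let INF := r_INF H.
Let XfT := r_XfT H.

Lemma BI a b : B a -> B b -> B (a `&` b).
Proof.
by move=> Ba Bb; rewrite -(setDD a b); apply: BD => //; exact: BD.
Qed.

Lemma Buns s : {in s, forall a, B a} -> B (uns s).
Proof.
elim: s => [|a s IH] h; rewrite ?uns_nil// uns_cons.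
apply: BU; first by apply: h; rewrite mem_head.
by apply: IH => b bs; apply: h; rewrite inE bs orbT.
Qed.

Lemma mu0 : mu set0 = 0.
Proof.
have := muU B0 B0 (fun y (h : set0 y) _ => h).
by rewrite setU0; move/eqP; rewrite addrC -subr_eq subrr eq_sym => /eqP.
Qed.

Lemma mu_ge0 a : B a -> 0 <= mu a.
Proof.
move=> Ba; have [->|a0] := pselect (a = set0); first by rewrite mu0.
by rewrite ltW// mu_gt0.
Qed.

Lemma muDI a b : B a -> B b -> mu a = mu (a `&` b) + mu (a `\` b).
Proof.
move=> Ba Bb; rewrite -muU ?setUIDK//; [exact: BI|exact: BD|].
by move=> y [_ ?] [_].
Qed.

Lemma muD a b : B a -> B b -> b `<=` a -> mu (a `\` b) = mu a - mu b.
Proof.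
move=> Ba Bb ba; rewrite (muDI Ba Bb) (_ : a `&` b = b); first by lra.
by apply/seteqP; split=> [y []//|y b_y]; split => //; exact: ba.
Qed.

Lemma mu_eq_sub a b : B a -> B b -> a `<=` b -> mu a = mu b -> a = b.
Proof.
move=> Ba Bb ab E; apply/seteqP; split => //.
apply/setD_eq0P; apply: contrapT => /(mu_gt0 (BD Bb Ba)).
by rewrite muD// E subrr ltxx.
Qed.

Lemma mu_uns s : uniq s -> {in s, forall a, B a} -> djs s ->
  mu (uns s) = \sum_(a <- s) mu a.
Proof.
elim: s => [|a s IH]; first by rewrite uns_nil mu0 big_nil.
rewrite cons_uniq => /andP[as_ us] h /(djs_cons as_)[da ds].
have hs : {in s, forall b, B b} by move=> b bs; apply: h; rewrite inE bs orbT.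
rewrite uns_cons big_cons muU ?IH//; first by apply: h; rewrite mem_head.
exact: Buns.
Qed.

Lemma atm_dff a : atm a -> dff a -> False.
Proof. by move=> [p Ap ->] /(_ p); exact. Qed.

Lemma pieceB a : piece a -> B a. Proof. by case. Qed.
Lemma piece_mu a : piece a -> 0 < mu a.
Proof. by case=> Ba a0 _; exact: mu_gt0. Qed.

Lemma dff_piece a : B a -> a <> set0 -> dff a -> piece a.
Proof. by split => //; right. Qed.

Lemma atm_sub a b : atm a -> b `<=` a -> b = set0 \/ b = a.
Proof.
move=> [p _ ->] ba; have [bp|nbp] := pselect (b p); [right|left].
  by apply/seteqP; split => // y ->.
by rewrite -subset0 => y b_y; apply: nbp; rewrite -(ba _ b_y).
Qed.

Lemma dffS a b : dff a -> b `<=` a -> dff b.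
Proof. by move=> h ba; exact: (djS h ba). Qed.

(** [V] is closed under differences, products and inverses but may be reduced to 0, so 1/2 need not
    belong to it; hence the detour through v * v / (v + v). *)
Lemma half_V v : V v -> V (v / 2).
Proof.
move=> Vv; have V0 : V 0 by rewrite -(subrr v); exact: VB.
have V2 : V (v + v) by rewrite (_ : v + v = v - (0 - v)); [apply: VB => //; exact: VB|ring].
have [->|v0] := eqVneq v 0; first by rewrite mul0r.
suff -> : v / 2 = v * v * (v + v)^-1 by apply: VM; [exact: VM|exact: VI].
rewrite -mulrA (_ : v + v = v * 2); last by ring.
by congr (_ * _); rewrite invfM mulrA divff// mul1r.
Qed.

(** Atoms are the minimal nonempty members of [B], because a diffuse piece splits into halves. This
    order-theoretic description is what makes automorphisms of the ring respect atoms. *)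
Lemma atm_min a : B a -> a <> set0 ->
  (forall b, B b -> b `<=` a -> b = set0 \/ b = a) -> atm a.
Proof.
move=> Ba a0 h; have [s [us ps ds sa]] := PD Ba.
have [y ay] : a !=set0 by apply/set0P/eqP.
have [b bs b_y] : uns s y by rewrite sa.
have [Bb b0 pb] := ps _ bs.
have ba' : b `<=` a by rewrite -sa; exact: sub_uns.
have [/b0//|ba] := h b Bb ba'; rewrite -ba; case: pb => // db.
have m := mu_gt0 Bb b0.
have [c [Bc cb mc]] : exists c, [/\ B c, c `<=` b & mu c = mu b / 2].
  by apply: SP => //; [exact/half_V/Vmu|lra].
have [c0|c0] := h c Bc (subset_trans cb ba'); move: mc; rewrite c0 ?mu0 -?ba; lra.
Qed.

(** * Automorphisms of the ring *)

(** Only values on [B] matter: elsewhere [af] and [ag] are arbitrary, and automorphisms are compared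
    by their values on [B]. Compatibility with unions and intersections follows from that with
    differences. *)
Record aut := RingAut { af :> set Y -> set Y; ag : set Y -> set Y;
  afB : forall b, B b -> B (af b); agB : forall b, B b -> B (ag b);
  afK : forall b, B b -> ag (af b) = b; agK : forall b, B b -> af (ag b) = b;
  afD : forall a b, B a -> B b -> af (a `\` b) = af a `\` af b;
  amu : forall b, B b -> mu (af b) = mu b }.

Lemma agD (x : aut) a b : B a -> B b -> ag x (a `\` b) = ag x a `\` ag x b.
Proof.
move=> Ba Bb; have Bga := agB x Ba; have Bgb := agB x Bb.
have -> : a `\` b = x (ag x a `\` ag x b) by rewrite afD// !agK.
by rewrite afK//; exact: BD.
Qed.

Lemma agmu (x : aut) b : B b -> mu (ag x b) = mu b.
Proof. by move=> Bb; rewrite -[in RHS](agK x Bb) amu//; exact: agB. Qed.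

Definition ainv (x : aut) : aut :=
  RingAut (agB x) (afB x) (agK x) (afK x) (@agD x) (@agmu x).

Definition aone : aut := @RingAut id id (fun _ h => h) (fun _ h => h)
  (fun _ _ => erefl) (fun _ _ => erefl) (fun _ _ _ _ => erefl) (fun _ _ => erefl).

Definition amul (x y : aut) : aut.
apply: (@RingAut (fun b => x (y b)) (fun b => ag y (ag x b))).
- by move=> b /(afB y) /(afB x).
- by move=> b /(agB x) /(agB y).
- by move=> b Bb; rewrite afK ?afK//; exact: afB.
- by move=> b Bb; rewrite agK ?agK//; exact: agB.
- by move=> a b Ba Bb; rewrite afD// afD//; exact: afB.
- by move=> b Bb; rewrite amu ?amu//; exact: afB.
Defined.

Lemma af0 (x : aut) : x set0 = set0.
Proof. by have := afD x B0 B0; rewrite !setDv. Qed.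

Lemma afS (x : aut) a b : B a -> B b -> a `<=` b -> x a `<=` x b.
Proof.
move=> Ba Bb ab; have E : x (a `\` b) = set0.
  by rewrite (_ : a `\` b = set0) ?af0//; apply/seteqP; split => y // [/ab].
by move: E; rewrite afD// => /setD_eq0P.
Qed.

Lemma afSE (x : aut) a b : B a -> B b -> x a `<=` x b -> a `<=` b.
Proof.
by move=> Ba Bb h; rewrite -(afK x Ba) -(afK x Bb); apply: (@afS (ainv x)) => //; exact: afB.
Qed.

Lemma af_inj (x : aut) a b : B a -> B b -> x a = x b -> a = b.
Proof. by move=> Ba Bb E; rewrite -(afK x Ba) E afK. Qed.

Lemma afI (x : aut) a b : B a -> B b -> x (a `&` b) = x a `&` x b.
Proof. by move=> Ba Bb; rewrite -!setDD !afD//; exact: BD. Qed.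

Lemma af_dj (x : aut) a b : B a -> B b -> dj a b -> dj (x a) (x b).
Proof.
move=> Ba Bb ab y xa xb; have : x (a `&` b) y by rewrite afI.
by rewrite (_ : a `&` b = set0) ?af0//; apply/seteqP; split => z // [az]; exact: ab.
Qed.

(** The ring has no largest member in which to take complements. Instead, the union is a least upper
    bound, and the automorphism and its inverse both preserve inclusion. *)
Lemma afU (x : aut) a b : B a -> B b -> x (a `|` b) = x a `|` x b.
Proof.
move=> Ba Bb; have BaUb := BU Ba Bb.
have BxU : B (x a `|` x b) by apply: BU; exact: afB.
have key c : B c -> x c `<=` x a `|` x b -> c `<=` ag x (x a `|` x b).
  move=> Bc /(@afS (ainv x) _ _ (afB x Bc) BxU).
  by rewrite /= afK.
apply/seteqP; split; last first.
  by rewrite subUset; split; exact: afS.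
rewrite -[X in _ `<=` X](agK x)//; apply: afS => //; first exact: agB.
by rewrite subUset; split; exact: key.
Qed.

Lemma af_uns (x : aut) s : {in s, forall a, B a} -> x (uns s) = uns (map x s).
Proof.
elim: s => [|a s IH] h; first by rewrite !uns_nil af0.
have hs : {in s, forall b, B b} by move=> b bs; apply: h; rewrite inE bs orbT.
rewrite /= !uns_cons afU ?IH//; first by apply: h; rewrite mem_head.
exact: Buns.
Qed.

Lemma af_neq0 (x : aut) a : B a -> a <> set0 -> x a <> set0.
Proof. by move=> Ba a0 E; apply: a0; apply: (af_inj (x := x)) => //; rewrite af0. Qed.

Lemma aut_atm (x : aut) a : B a -> atm a -> atm (x a).
Proof.
move=> Ba aa; apply: atm_min; first exact: afB.
  by apply: af_neq0 => //; case: aa => p _ -> /seteqP[/(_ p)]; case.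
move=> b Bb bxa; have : ag x b `<=` a.
  by rewrite -(afK x Ba); apply: (@afS (ainv x)) => //; exact: afB.
by case/(atm_sub aa) => E; [left|right]; rewrite -(agK x Bb) E ?af0.
Qed.

Lemma aut_atmE (x : aut) a : B a -> atm a <-> atm (x a).
Proof.
move=> Ba; split; first exact: aut_atm.
by move/(@aut_atm (ainv x) _ (afB x Ba)); rewrite /= afK.
Qed.

Lemma aut_sim (x : aut) a : B a -> sim a (x a).
Proof. by move=> Ba; split; [rewrite amu|exact: aut_atmE]. Qed.

Lemma at_B b y : B b -> At y -> b y -> exists a, [/\ B a, atm a, a `<=` b & a y].
Proof.
move=> Bb Ay b_y; have [s [us ps ds sb]] := PD Bb.
move: b_y; rewrite -sb => -[c cs cy]; have [Bc c0 [ac|dc]] := ps _ cs.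
  by exists c; split => //; exact: sub_uns.
by case: (dc _ cy Ay).
Qed.

Lemma aut_dff (x : aut) a : B a -> dff a -> dff (x a).
Proof.
move=> Ba da y xay Ay.
have [c [Bc ac ca cy]] := at_B (afB x Ba) Ay xay.
apply: (@atm_dff (ag x c)); first exact: (@aut_atm (ainv x)).
apply: (dffS da); rewrite -(afK x Ba); apply: (@afS (ainv x)) => //; exact: afB.
Qed.

Lemma aut_piece (x : aut) a : piece a -> piece (x a).
Proof.
move=> [Ba a0 h]; split; [exact: afB|exact: af_neq0|].
by case: h => h; [left; exact: aut_atm|right; exact: aut_dff].
Qed.

(** * Finite partial isomorphisms and back-and-forth *)

Local Notation pr := (set Y * set Y)%type.
Implicit Types (r : seq pr) (p q : pr).

Definition u1 r := uns (unzip1 r).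
Definition u2 r := uns (unzip2 r).

Lemma u1P r y : u1 r y <-> exists2 p, p \in r & p.1 y.
Proof.
split=> [[a /mapP[p pr_ ->] py]|[p pr_ py]]; first by exists p.
by exists p.1 => //; apply: map_f.
Qed.

Lemma u2P r y : u2 r y <-> exists2 p, p \in r & p.2 y.
Proof.
split=> [[a /mapP[p pr_ ->] py]|[p pr_ py]]; first by exists p.
by exists p.2 => //; apply: map_f.
Qed.

Definition swp r : seq pr := [seq (p.2, p.1) | p <- r].

(** A finite partial isomorphism between pieces of the same type. Both sides cover [Xf], so that
    whatever remains to be matched is disjoint from [Xf] and [r_INF] supplies a partner for it. *)
Definition pii r := [/\
  {in r, forall p, [/\ piece p.1, piece p.2 & sim p.1 p.2]},
  {in r &, forall p q, p <> q -> dj p.1 q.1 /\ dj p.2 q.2},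
  Xf `<=` u1 r & Xf `<=` u2 r].

(** The graph of the map that [r] induces on unions of its left-hand pieces: it sends b to b'. *)
Definition dec2 r b b' := [/\
  {in r, forall p, (p.1 `<=` b /\ p.2 `<=` b') \/ (dj p.1 b /\ dj p.2 b')},
  b `<=` u1 r & b' `<=` u2 r].

Definition refR r2 r := {in r, forall p, dec2 r2 p.1 p.2}.

Lemma sim_sym a b : sim a b -> sim b a.
Proof. by move=> [E [h1 h2]]. Qed.

Lemma sim_trans a b c : sim a b -> sim b c -> sim a c.
Proof. by move=> [E h] [F k]; split; [rewrite E F|tauto]. Qed.

Lemma swpP r p : p \in swp r <-> (p.2, p.1) \in r.
Proof.
split=> [/mapP[q qr ->]|h]; first by case: q qr.
by apply/mapP; exists (p.2, p.1) => //; case: p h.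
Qed.

Lemma u1_swp r : u1 (swp r) = u2 r.
Proof. by rewrite /u1 /u2 /unzip1 -map_comp. Qed.

Lemma u2_swp r : u2 (swp r) = u1 r.
Proof. by rewrite /u1 /u2 /unzip2 -map_comp. Qed.

Lemma pii_swp r : pii r -> pii (swp r).
Proof.
move=> [h d x1 x2]; split; rewrite ?u1_swp ?u2_swp//.
  by move=> p /swpP /h [? ? /sim_sym].
move=> p q /swpP pr_ /swpP qr pq; have [] := d _ _ pr_ qr; last by [].
by case=> e1 e2; apply: pq; case: p q e1 e2 {pr_ qr} => ? ? [? ?] /= -> ->.
Qed.

Lemma dec2_swp r b b' : dec2 r b b' -> dec2 (swp r) b' b.
Proof.
move=> [h x1 x2]; split; rewrite ?u1_swp ?u2_swp//.
by move=> p /swpP /h /= [[]|[]]; [left|right].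
Qed.

Lemma refR_swp r2 r : refR r2 r -> refR (swp r2) (swp r).
Proof. by move=> h p /swpP /h /dec2_swp. Qed.

Lemma piece_ne a : piece a -> exists y, a y.
Proof. by move=> [_ /eqP/set0P]. Qed.

Lemma piece_dj a b : piece a -> a `<=` b -> dj a b -> False.
Proof. by move=> /piece_ne[y ay] ab h; apply: (h y) => //; exact: ab. Qed.

Definition fil r b := [seq p <- r | `[< p.1 `<=` b >]].

Lemma filP r b p : p \in fil r b <-> p \in r /\ p.1 `<=` b.
Proof.
rewrite mem_filter; split=> [/andP[/asboolP]|[? ?]] //.
by apply/andP; split => //; exact/asboolP.
Qed.

Lemma dec2_E r b b' : pii r -> dec2 r b b' -> b = u1 (fil r b) /\ b' = u2 (fil r b).
Proof.
move=> [h d _ _] [hb s1 s2]; split; apply/seteqP; split=> y.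
- move=> b_y; have /u1P[p pr_ py] := s1 _ b_y; apply/u1P; exists p => //.
  apply/filP; split => //.
  by have [[]//|[k _]] := hb _ pr_; case: (k y).
- by move=> /u1P[p /filP[_]]; exact.
- move=> b_y; have /u2P[p pr_ py] := s2 _ b_y; apply/u2P; exists p => //.
  apply/filP; split => //.
  by have [[]//|[_ k]] := hb _ pr_; case: (k y).
- move=> /u2P[p /filP[pr_ pb] py]; have [[_ k]|[hp _]] := hb _ pr_; first exact: k.
  by have [pp _ _] := h _ pr_; case: (piece_dj pp pb hp).
Qed.

Lemma pii_sub r t : pii r -> {subset t <= r} ->
  [/\ djs (unzip1 (undup t)), uniq (unzip1 (undup t)) &
      {in unzip1 (undup t), forall a, B a}].
Proof.
move=> [h d _ _] tr; split.
- move=> _ _ /mapP[p pt ->] /mapP[q qt ->] pq.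
  move: pt qt; rewrite !mem_undup => /tr pt /tr qt.
  by have [|] := d _ _ pt qt; [move=> E; apply: pq; rewrite E|].
- rewrite map_inj_in_uniq ?undup_uniq// => p q; rewrite !mem_undup => /tr pt /tr qt E.
  apply: contrapT => pq; have [dpq _] := d _ _ pt qt pq.
  have [pp _ _] := h _ pt; apply: (piece_dj pp _ dpq).
  by rewrite E.
- by move=> _ /mapP[p + ->]; rewrite mem_undup => /tr /h [[]].
Qed.

Lemma u1_undup r : u1 (undup r) = u1 r.
Proof. by apply/seteqP; split=> y /u1P[p + py]; [rewrite mem_undup|] => pr_; apply/u1P; exists p; rewrite ?mem_undup. Qed.
Lemma u2_undup r : u2 (undup r) = u2 r.
Proof. by apply/seteqP; split=> y /u2P[p + py]; [rewrite mem_undup|] => pr_; apply/u2P; exists p; rewrite ?mem_undup. Qed.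

Lemma fil_sub r b : {subset fil r b <= r}.
Proof. by move=> p /filP[]. Qed.

Lemma Bu1 r t : pii r -> {subset t <= r} -> B (u1 t).
Proof.
move=> pr_ tr; have [_ _ h] := pii_sub pr_ tr.
by rewrite -u1_undup; exact: Buns.
Qed.

Lemma Bu2 r t : pii r -> {subset t <= r} -> B (u2 t).
Proof.
move=> /pii_swp pr_ tr; rewrite -u1_swp; apply: (Bu1 pr_).
by move=> p /swpP /tr pr'; exact/swpP.
Qed.

Lemma dec2_B r b b' : pii r -> dec2 r b b' -> B b /\ B b'.
Proof.
move=> pr_ h; have [E1 E2] := dec2_E pr_ h.
by split; [rewrite E1; exact: (Bu1 pr_ (@fil_sub r b))|rewrite E2; exact: (Bu2 pr_ (@fil_sub r b))].
Qed.

Lemma dec2_mu r b b' : pii r -> dec2 r b b' -> mu b = mu b'.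
Proof.
move=> pr_ h; have [E1 E2] := dec2_E pr_ h; rewrite {1}E1 E2.
have st := @fil_sub r b.
rewrite -u1_undup -u2_undup /u1 /u2.
have [d1 q1 B1] := pii_sub pr_ st.
have st' : {subset swp (fil r b) <= swp r} by move=> p /swpP /st ?; exact/swpP.
have [d2 q2 B2] := pii_sub (pii_swp pr_) st'.
have E : unzip1 (undup (swp (fil r b))) = unzip2 (undup (fil r b)).
  rewrite /swp undup_map_inj; last by move=> [? ?] [? ?] [-> ->].
  by rewrite /unzip1 -map_comp.
rewrite E in d2 q2 B2.
rewrite !mu_uns// !big_map !big_seq; apply: eq_bigr => p.
by rewrite mem_undup => /st; case: pr_ => hp _ _ _ /hp [_ _ []].
Qed.

Lemma dec2_fun r b b' c' : pii r -> dec2 r b b' -> dec2 r b c' -> b' = c'.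
Proof. by move=> pr_ h k; have [_ ->] := dec2_E pr_ h; have [_ ->] := dec2_E pr_ k. Qed.

Lemma dec2_D r a a' b b' : dec2 r a a' -> dec2 r b b' -> dec2 r (a `\` b) (a' `\` b').
Proof.
move=> [ha s1 s2] [hb _ _]; split; last 2 first.
- by move=> y [/s1].
- by move=> y [/s2].
move=> p pr_; have [[p1 p2]|[p1 p2]] := ha _ pr_; last first.
  by right; split; [apply: (djS p1)|apply: (djS p2)] => // y [].
have [[q1 q2]|[q1 q2]] := hb _ pr_.
  by right; split => y py [_]; apply; [exact: q1|exact: q2].
by left; split => y py; split; [exact: p1|exact: (q1 y)|exact: p2|exact: (q2 y)].
Qed.

Lemma dec2_ex r b : pii r -> {in r, forall p, p.1 `<=` b \/ dj p.1 b} ->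
  b `<=` u1 r -> dec2 r b (u2 (fil r b)).
Proof.
move=> pr_ h s; case: (pr_) => hp d _ _; split => //; last first.
  by move=> y /u2P[p /filP[? _] ?]; apply/u2P; exists p.
move=> p p_r; have [pb|pb] := h _ p_r.
  by left; split => // y py; apply/u2P; exists p => //; exact/filP.
right; split => // y py /u2P[q /filP[qr qb] qy].
have [E|npq] := pselect (p = q).
  by have [pp _ _] := hp _ p_r; apply: (piece_dj pp _ pb); rewrite E.
by have [_ /(_ y)] := d _ _ p_r qr npq; apply.
Qed.

Lemma dec2_trans r2 r b b' : refR r2 r -> dec2 r b b' -> dec2 r2 b b'.
Proof.
move=> rr [hb s1 s2]; split; last 2 first.
- by move=> y /s1/u1P[p /rr[_ + _] py]; exact.
- by move=> y /s2/u2P[p /rr[_ _ +] py]; exact.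
move=> q qr.
have [[p pr_ [q1 q2]]|no] := pselect (exists2 p, p \in r & q.1 `<=` p.1 /\ q.2 `<=` p.2).
  have [[p1 p2]|[p1 p2]] := hb _ pr_; [left|right]; split.
  - exact: subset_trans p1.
  - exact: subset_trans p2.
  - by apply: (djS p1 q1).
  - by apply: (djS p2 q2).
have no' p : p \in r -> dj q.1 p.1 /\ dj q.2 p.2.
  by move=> pr_; have [/(_ _ qr)[h|//] _ _] := rr _ pr_; case: no; exists p.
right; split => y qy.
- by move=> /s1/u1P[p /no'[k _] py]; exact: (k y).
- by move=> /s2/u2P[p /no'[_ k] py]; exact: (k y).
Qed.

Lemma refR_refl r : pii r -> refR r r.
Proof.
move=> [h d _ _] p pr_; split; last 2 first.
- by move=> y py; apply/u1P; exists p.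
- by move=> y py; apply/u2P; exists p.
move=> q qr; have [->|] := pselect (q = p); first by left; split.
by move=> /(d _ _ qr pr_)[? ?]; right.
Qed.

Lemma refR_trans r3 r2 r : refR r3 r2 -> refR r2 r -> refR r3 r.
Proof. by move=> h k p /k; exact: dec2_trans. Qed.

Lemma fwd_add r a : pii r -> piece a -> dj a (u1 r) -> exists a', pii ((a, a') :: r).
Proof.
move=> pr_ pa da; case: (pr_) => hp d x1 x2.
have [c [pc sc dc]] := INF pa (djS da (@subset_refl _ _) x1) (Bu2 pr_ (fun _ h => h)).
exists c; split.
- by move=> p; rewrite inE => /orP[/eqP-> //|/hp].
- move=> p q; rewrite !inE => /orP[/eqP->|p_r] /orP[/eqP->|q_r]//= pq.
  + split; first by apply: (djS da) => // y ?; apply/u1P; exists q.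
    by apply: (djS dc) => // y ?; apply/u2P; exists q.
  + split; apply: djC.
      by apply: (djS da) => // y ?; apply/u1P; exists p.
    by apply: (djS dc) => // y ?; apply/u2P; exists p.
  + exact: d.
- by rewrite /u1 /= uns_cons => y /x1; right.
- by rewrite /u2 /= uns_cons => y /x2; right.
Qed.

Lemma fwd_adds s r : pii r -> uniq s -> {in s, forall a, piece a} -> djs s ->
  dj (uns s) (u1 r) -> exists r', pii (r' ++ r) /\ unzip1 r' = s.
Proof.
move=> pr_; elim: s => [|a s IH] /=; first by exists [::].
move=> /andP[as_ us] hp /(djs_cons as_)[da ds]; rewrite uns_cons => dd.
have [|r' [pr' E]] := IH us _ ds (djS dd (@subsetUr _ _ _) (@subset_refl _ _)).
  by move=> b bs; apply: hp; rewrite inE bs orbT.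
have [||c pc] := @fwd_add _ a pr'.
- by apply: hp; rewrite mem_head.
- rewrite /u1 /unzip1 map_cat uns_cat -/(unzip1 r') E => y ay [/(da y ay)//|].
  by move=> /(dd y); apply; left.
by exists ((a, c) :: r'); split => //=; rewrite E.
Qed.

(** An atom is never cut by b. A diffuse piece may be, and then [r_SP] cuts its partner into the
    same masses, which lie in [V] because they are measures of members of [B]. *)
Lemma spl p b : piece p.1 -> piece p.2 -> sim p.1 p.2 -> B b ->
  exists s, [/\ {in s, forall q, [/\ piece q.1, piece q.2 & sim q.1 q.2]},
    {in s &, forall q q', q <> q' -> dj q.1 q'.1 /\ dj q.2 q'.2},
    u1 s = p.1, u2 s = p.2 & {in s, forall q, q.1 `<=` b \/ dj q.1 b}].
Proof.
move=> p1 p2 sp Bb; have [B1 _ k1] := p1; have [B2 _ k2] := p2.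
have triv : p.1 `<=` b \/ dj p.1 b -> exists s,
   [/\ {in s, forall q, [/\ piece q.1, piece q.2 & sim q.1 q.2]},
    {in s &, forall q q', q <> q' -> dj q.1 q'.1 /\ dj q.2 q'.2},
    u1 s = p.1, u2 s = p.2 & {in s, forall q, q.1 `<=` b \/ dj q.1 b}].
  move=> h; exists [:: p]; split.
  - by move=> q; rewrite inE => /eqP->.
  - by move=> q q'; rewrite !inE => /eqP-> /eqP->.
  - by rewrite /u1 /= uns_cons uns_nil setU0.
  - by rewrite /u2 /= uns_cons uns_nil setU0.
  - by move=> q; rewrite inE => /eqP->.
have [h|n1] := pselect (p.1 `<=` b); first by apply: triv; left.
have [h|n2] := pselect (dj p.1 b); first by apply: triv; right.
have d1 : dff p.1.
  case: k1 => // a1; case: (atm_sub a1 (@subIsetl _ p.1 b)) => E.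
    case: n2 => y py b_y; have : (p.1 `&` b) y by [].
    by rewrite E.
  by case: n1; rewrite -E; exact: subIsetr.
have d2 : dff p.2 by case: k2 => // /sp.2 a1; case: (atm_dff a1 d1).
have BI1 := BI B1 Bb; have BD1 := BD B1 Bb.
have nI : p.1 `&` b <> set0.
  by move=> E; apply: n2 => y py b_y; have : (p.1 `&` b) y by []; rewrite E.
have nD : p.1 `\` b <> set0 by move/setD_eq0P.
have E1 := muDI B1 Bb; have m1 := mu_gt0 BI1 nI; have m2 := mu_gt0 BD1 nD.
have [c [Bc cp mc]] : exists c, [/\ B c, c `<=` p.2 & mu c = mu (p.1 `&` b)].
  apply: SP => //; first exact: Vmu.
  by rewrite m1 -(sp.1) E1 ltrDl.
have mD : mu (p.2 `\` c) = mu (p.1 `\` b) by rewrite muD// -sp.1 E1 mc; lra.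
have nc : c <> set0 by move=> E; move: m1; rewrite -mc E mu0 ltxx.
have nDc : p.2 `\` c <> set0 by move=> E; move: m2; rewrite -mD E mu0 ltxx.
have dI : dff (p.1 `&` b) by apply: (dffS d1); exact: subIsetl.
have dD : dff (p.1 `\` b) by apply: (dffS d1); exact: subDsetl.
have dc : dff c by apply: (dffS d2).
have dDc : dff (p.2 `\` c) by apply: (dffS d2); exact: subDsetl.
have dsim a a' : dff a -> dff a' -> mu a = mu a' -> sim a a'.
  by move=> da da' E; split => //; split => h; [case: (atm_dff h da)|case: (atm_dff h da')].
exists [:: (p.1 `&` b, c); (p.1 `\` b, p.2 `\` c)]; split.
- move=> q; rewrite !inE => /orP[/eqP->|/eqP->] /=; split; try exact: dff_piece.
  + exact: dsim.
  + by apply: dff_piece => //; exact: BD.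
  + exact: dsim.
- have h1 : dj (p.1 `&` b) (p.1 `\` b) by move=> y [_ ?] [].
  have h2 : dj c (p.2 `\` c) by move=> y ? [].
  move=> q q'; rewrite !inE => /orP[/eqP->|/eqP->] /orP[/eqP->|/eqP->] //= _; split => //; exact: djC.
- by rewrite /u1 /= !uns_cons uns_nil setU0 setUIDK.
- rewrite /u2 /= !uns_cons uns_nil setU0; apply/seteqP; split => y.
    by move=> [/cp//|[]].
  by move=> py; have [|] := pselect (c y); [left|right].
- move=> q; rewrite !inE => /orP[/eqP->|/eqP->] /=; [left|right].
    exact: subIsetr.
  by move=> y [].
Qed.

Lemma fwd_split r b : pii r -> B b -> exists r1,
  [/\ pii r1, refR r1 r, u1 r1 = u1 r & {in r1, forall q, q.1 `<=` b \/ dj q.1 b}].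
Proof.
move=> pr_ Bb; case: (pr_) => hp d x1 x2.
have /choice[sp hsp] : forall p, exists s, p \in r ->
  [/\ {in s, forall q, [/\ piece q.1, piece q.2 & sim q.1 q.2]},
    {in s &, forall q q', q <> q' -> dj q.1 q'.1 /\ dj q.2 q'.2},
    u1 s = p.1, u2 s = p.2 & {in s, forall q, q.1 `<=` b \/ dj q.1 b}].
  move=> p; have [p_r|] := boolP (p \in r); last by exists [::].
  by have [p1 p2 sp] := hp _ p_r; have [s] := spl p1 p2 sp Bb; exists s.
pose r1 := flatten (map sp r).
have r1P q : q \in r1 -> exists2 p, p \in r & q \in sp p.
  by move=> /flattenP[s /mapP[p p_r ->]] ?; exists p.
have r1I p q : p \in r -> q \in sp p -> q \in r1.
  by move=> p_r ?; apply/flattenP; exists (sp p) => //; exact: map_f.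
have sub1 p q : p \in r -> q \in sp p -> q.1 `<=` p.1 /\ q.2 `<=` p.2.
  move=> p_r qs; have [_ _ <- <- _] := hsp _ p_r.
  by split=> y qy; [apply/u1P|apply/u2P]; exists q.
have U1 : u1 r1 = u1 r.
  apply/seteqP; split=> y /u1P[q].
    move=> /r1P[p p_r /(sub1 _ _ p_r)[s _]] /s py; apply/u1P; by exists p.
  move=> q_r; have [_ _ <- _ _] := hsp _ q_r.
  by move=> /u1P[t ts ty]; apply/u1P; exists t => //; exact: r1I ts.
have U2 : u2 r1 = u2 r.
  apply/seteqP; split=> y /u2P[q].
    move=> /r1P[p p_r /(sub1 _ _ p_r)[_ s]] /s py; apply/u2P; by exists p.
  move=> q_r; have [_ _ _ <- _] := hsp _ q_r.
  by move=> /u2P[t ts ty]; apply/u2P; exists t => //; exact: r1I ts.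
exists r1; split => //.
- split; rewrite ?U1 ?U2//.
    by move=> q /r1P[p p_r]; have [+ _ _ _ _] := hsp _ p_r; exact.
  move=> q q' /r1P[p p_r qs] /r1P[p' p_r' qs'] qq.
  have [E|pp] := pselect (p = p').
    by move: E qs' => <- qs'; have [_ + _ _ _] := hsp _ p_r; exact.
  have [D1 D2] := d _ _ p_r p_r' pp.
  have [a1 a2] := sub1 _ _ p_r qs; have [b1 b2] := sub1 _ _ p_r' qs'.
  by split; [apply: (djS D1)|apply: (djS D2)].
- move=> p p_r; split; last 2 first.
  + by rewrite U1 => y py; apply/u1P; exists p.
  + by rewrite U2 => y py; apply/u2P; exists p.
  move=> q /r1P[p' p_r' qs]; have [E|pp] := pselect (p' = p).
    by left; rewrite -E; exact: sub1.
  have [D1 D2] := d _ _ p_r' p_r pp; have [a1 a2] := sub1 _ _ p_r' qs.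
  by right; split; [apply: (djS D1)|apply: (djS D2)].
- by move=> q /r1P[p p_r]; have [_ _ _ _ +] := hsp _ p_r; exact.
Qed.

Lemma fwd r b : pii r -> B b ->
  exists r2 b', [/\ pii r2, refR r2 r & dec2 r2 b b'].
Proof.
move=> pr_ Bb; have [r1 [p1 R1 U1 h1]] := fwd_split pr_ Bb.
have Bc : B (b `\` u1 r1) by apply: BD => //; exact: (Bu1 p1 (fun _ h => h)).
have [s [us hs ds Es]] := PD Bc.
have dd : dj (uns s) (u1 r1) by rewrite Es => y [].
have [r' [p2 E]] := fwd_adds p1 us hs ds dd.
have sub : {subset r1 <= r' ++ r1} by move=> p; rewrite mem_cat orbC => ->.
have R2 : refR (r' ++ r1) r1 by move=> p /sub; exact: refR_refl.
exists (r' ++ r1), (u2 (fil (r' ++ r1) b)); split => //; first exact: refR_trans R1.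
apply: dec2_ex => //.
- move=> p; rewrite mem_cat => /orP[pr'|/h1//]; left.
  have : p.1 \in s by rewrite -E map_f.
  by move=> /sub_uns; rewrite Es => h y /h [].
- rewrite /u1 /unzip1 map_cat uns_cat -/(unzip1 r') E Es -/(unzip1 r1) -/(u1 r1) => y b_y.
  by have [|] := pselect (u1 r1 y); [right|left].
Qed.

Lemma bwd r b : pii r -> B b ->
  exists r2 b', [/\ pii r2, refR r2 r & dec2 r2 b' b].
Proof.
move=> /pii_swp pr_ Bb; have [r2 [b' [p2 R2 h2]]] := fwd pr_ Bb.
exists (swp r2), b'; split; [exact: pii_swp| |exact: dec2_swp].
have E : swp (swp r) = r by rewrite /swp -map_comp /= map_id_in// => -[].
by rewrite -E; exact: refR_swp.
Qed.

Lemma aut_of_chain (rk : nat -> seq pr) : (forall k, pii (rk k)) ->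
  (forall k, refR (rk k.+1) (rk k)) ->
  (forall b, B b -> exists k b', dec2 (rk k) b b') ->
  (forall b, B b -> exists k b', dec2 (rk k) b' b) ->
  exists x : aut, forall k b b', B b -> dec2 (rk k) b b' -> x b = b'.
Proof.
move=> hp hr t1 t2.
have mono k l : (k <= l)%N -> refR (rk l) (rk k).
  move=> /subnK <-; elim: (l - k)%N => [|n IH]; first exact: refR_refl.
  by rewrite addSn; exact: refR_trans IH.
have up k l b b' : (k <= l)%N -> dec2 (rk k) b b' -> dec2 (rk l) b b'.
  by move=> /mono; exact: dec2_trans.
have uq k l b b' c' : dec2 (rk k) b b' -> dec2 (rk l) b c' -> b' = c'.
  move=> /(up _ (maxn k l) _ _ (leq_maxl _ _)) h1 /(up _ (maxn k l) _ _ (leq_maxr _ _)).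
  exact: dec2_fun h1.
have uq' k l b b' c : dec2 (rk k) b b' -> dec2 (rk l) c b' -> b = c.
  move=> /(up _ (maxn k l) _ _ (leq_maxl _ _)) h1 /(up _ (maxn k l) _ _ (leq_maxr _ _)) h2.
  exact: (dec2_fun (pii_swp (hp _)) (dec2_swp h1) (dec2_swp h2)).
have /choice[f hf] : forall b, exists b', B b -> exists k, dec2 (rk k) b b'.
  move=> b; have [Bb|] := pselect (B b); last by exists set0.
  by have [k [b' ?]] := t1 _ Bb; exists b' => _; exists k.
have /choice[g hg] : forall b, exists b', B b -> exists k, dec2 (rk k) b' b.
  move=> b; have [Bb|] := pselect (B b); last by exists set0.
  by have [k [b' ?]] := t2 _ Bb; exists b' => _; exists k.
have fB b : B b -> B (f b) by move=> /hf[k /(dec2_B (hp k))[]].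
have gB b : B b -> B (g b) by move=> /hg[k /(dec2_B (hp k))[]].
have fK b : B b -> g (f b) = b.
  by move=> Bb; have [k h] := hf _ Bb; have [l h'] := hg _ (fB _ Bb); exact: uq' h' h.
have gK b : B b -> f (g b) = b.
  by move=> Bb; have [k h] := hg _ Bb; have [l h'] := hf _ (gB _ Bb); exact: uq h' h.
have fD a b : B a -> B b -> f (a `\` b) = f a `\` f b.
  move=> Ba Bb; have [k h] := hf _ Ba; have [l h'] := hf _ Bb.
  have [m h''] := hf _ (BD Ba Bb).
  apply: (uq m (maxn k l)) h'' _; apply: dec2_D.
    exact: up (leq_maxl _ _) h.
  exact: up (leq_maxr _ _) h'.
have fm b : B b -> mu (f b) = mu b.
  by move=> Bb; have [k h] := hf _ Bb; rewrite -(dec2_mu (hp k) h).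
exists (RingAut fB gB fK gK fD fm) => k b b' Bb h /=.
by have [l h'] := hf _ Bb; exact: uq h' h.
Qed.

(** Homogeneity of the ring. Stage k of the back-and-forth puts the k-th set of the enumeration into
    the domain by [fwd] and into the range by [bwd]. *)
Lemma extend_pii r : pii r -> exists x : aut, {in r, forall p, x p.1 = p.2}.
Proof.
move=> pr_; have [E [BE EB]] := r_E H.
pose T := {r | pii r}.
have /choice[nx hnx] : forall tk : T * nat, exists t' : T,
    [/\ refR (sval t') (sval tk.1), exists b', dec2 (sval t') (E tk.2) b' &
        exists b', dec2 (sval t') b' (E tk.2)].
  move=> [[t pt] k] /=.
  have [r1 [b1 [p1 R1 d1]]] := fwd pt (BE k).
  have [r2 [b2 [p2 R2 d2]]] := bwd p1 (BE k).
  exists (exist _ r2 p2) => /=; split; first exact: refR_trans R1.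
    by exists b1; exact: dec2_trans d1.
  by exists b2.
pose rk := fix rk k : T := if k is k'.+1 then nx (rk k', k') else exist _ r pr_.
have [x hx] : exists x : aut, forall k b b', B b -> dec2 (sval (rk k)) b b' -> x b = b'.
  apply: (@aut_of_chain (fun k => sval (rk k))).
  - by move=> k; case: (rk k).
  - by move=> k; have [] := hnx (rk k, k).
  - by move=> b /EB[n <-]; exists n.+1; have [] := hnx (rk n, n).
  - by move=> b /EB[n <-]; exists n.+1; have [] := hnx (rk n, n).
exists x => p p_r; apply: (hx 0%N); first by case: (pr_) => hp _ _ _; have [[]] := hp _ p_r.
exact: (refR_refl pr_).
Qed.

(** * Finite partitions *)

Implicit Types (s t : seq (set Y)) (x f : aut).

(** The cells must cover [Xf], so that a type-preserving map of the cells is a partial isomorphism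
    in the sense of [pii]; what else they cover is left open. *)
Definition part s := [/\ uniq s, {in s, forall a, piece a}, djs s & Xf `<=` uns s].
Definition dec s b := b `<=` uns s /\ {in s, forall a, a `<=` b \/ dj a b}.
Definition ref t s := {in s, forall a, dec t a}.
(** Automorphisms are injective and s is finite, so this says that x permutes s. *)
Definition inv x s := {in s, forall a, x a \in s}.
Definition eqon x (z : aut) s := {in s, forall a, x a = z a}.
Definition below s b := [seq a <- s | `[< a `<=` b >]].

Lemma belowP s b a : a \in below s b <-> a \in s /\ a `<=` b.
Proof.
rewrite mem_filter; split=> [/andP[/asboolP]|[? ?]] //.
by apply/andP; split => //; exact/asboolP.
Qed.

Lemma dec_E s b : part s -> dec s b -> uns (below s b) = b.
Proof.
move=> ps [sb h]; apply/seteqP; split=> y.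
  by move=> [a /belowP[_]]; exact.
move=> b_y; have [a as_ ay] := sb _ b_y; exists a => //; apply/belowP; split => //.
by have [//|k] := h _ as_; case: (k y).
Qed.

Lemma below_B s b : part s -> {in below s b, forall a, B a}.
Proof. by move=> [_ h _ _] a /belowP[/h[]]. Qed.

Lemma dec_B s b : part s -> dec s b -> B b.
Proof. by move=> ps /(dec_E ps) <-; apply: Buns; exact: below_B. Qed.

Lemma part_B s : part s -> {in s, forall a, B a}.
Proof. by move=> [_ h _ _] a /h[]. Qed.

Lemma eqon_dec x z s b : part s -> eqon x z s -> dec s b -> x b = z b.
Proof.
move=> ps e /(dec_E ps) <-; rewrite !af_uns; try exact: below_B.
by congr uns; apply/eq_in_map => a /belowP[/e].
Qed.

Lemma below_uniq s b : part s -> uniq (below s b) /\ djs (below s b).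
Proof.
move=> [us _ d _]; split; first exact: filter_uniq.
by move=> a c /belowP[? _] /belowP[? _]; exact: d.
Qed.

Lemma mu_dec s b : part s -> dec s b -> mu b = \sum_(a <- below s b) mu a.
Proof.
move=> ps db; have [u d] := below_uniq b ps.
by rewrite -mu_uns ?dec_E//; exact: below_B.
Qed.

Lemma dec_trans t s b : ref t s -> dec s b -> dec t b.
Proof.
move=> rt [sb h]; split.
  by move=> y /sb[a /rt[+ _] ay]; exact.
move=> c ct; have [[a as_ ca]|no] := pselect (exists2 a, a \in s & c `<=` a).
  have [ab|ab] := h _ as_; [left; exact: subset_trans ab|right; exact: djS ab ca _].
right=> y cy /sb[a as_ ay]; have [_ /(_ _ ct)[ca|k]] := rt _ as_.
  by apply: no; exists a.
exact: (k y).
Qed.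

Lemma ref_trans t2 t s : ref t2 t -> ref t s -> ref t2 s.
Proof. by move=> h k a /k; exact: dec_trans. Qed.

Lemma dec_mem s a : part s -> a \in s -> dec s a.
Proof.
move=> [_ _ d _] as_; split; first exact: sub_uns.
move=> c cs; have [->|] := pselect (c = a); first by left.
by move/(d _ _ cs as_); right.
Qed.

Lemma ref_refl s : part s -> ref s s.
Proof. by move=> ps a; exact: dec_mem. Qed.

Lemma piece_sub a c : piece a -> B c -> c <> set0 -> c `<=` a ->
  piece c /\ (atm c <-> atm a).
Proof.
move=> [Ba a0 k] Bc c0 ca; case: k => [aa|da].
  by case: (atm_sub aa ca) => [/c0//|->]; split => //; split => //; left.
have dc := dffS da ca; split; first exact: dff_piece.
by split=> h; [case: (atm_dff h dc)|case: (atm_dff h da)].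
Qed.

Lemma piece_neq0 a : piece a -> a <> set0. Proof. by case. Qed.

Lemma af_Xf x : x Xf = Xf.
Proof.
have [E|n0] := pselect (Xf = set0); first by rewrite E af0.
apply: mu_eq_sub; [exact: afB|by []| |exact: amu].
by apply: XfT => //; [exact: afB|exact: aut_dff].
Qed.

Lemma pii_part s (g : set Y -> set Y) : part s ->
  {in s, forall a, piece (g a) /\ sim a (g a)} ->
  {in s &, forall a b, a <> b -> dj (g a) (g b)} ->
  pii [seq (a, g a) | a <- s].
Proof.
move=> ps hg dg; case: (ps) => us hp d xs.
have U1 : u1 [seq (a, g a) | a <- s] = uns s.
  by rewrite /u1 /unzip1 -map_comp map_id.
have U2 : u2 [seq (a, g a) | a <- s] = uns (map g s).
  by rewrite /u2 /unzip2 -map_comp.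
split; rewrite ?U1 ?U2//.
- by move=> _ /mapP[a as_ ->] /=; have [? ?] := hg _ as_; split => //; exact: hp.
- move=> _ _ /mapP[a as_ ->] /mapP[b bs ->] /= n.
  have nab : a <> b by move=> E; apply: n; rewrite E.
  by split; [exact: d|exact: dg].
(* The images cover [Xf]: the cells inside [Xf] have diffuse images, which lie in [Xf] again and
   whose total mass is that of [Xf]. *)
have [->//|n0] := pselect (Xf = set0).
have dX : dec s Xf.
  split => // a as_; have [Ba _ [[p Ap ->]|da]] := hp _ as_.
    by right=> y -> Xp; exact: (dXf Xp).
  by left; exact: XfT.
have [u1_ d1_] := below_uniq Xf ps.
have gin : {in below s Xf &, injective g}.
  move=> a b /belowP[as_ _] /belowP[bs _] E; apply: contrapT => /(dg _ _ as_ bs).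
  rewrite E => /dj_self; exact: (piece_neq0 (proj1 (hg _ bs))).
have Bg : {in map g (below s Xf), forall a, B a}.
  by move=> _ /mapP[a /belowP[as_ _] ->]; have [[]] := hg _ as_.
have sg : uns (map g (below s Xf)) `<=` uns (map g s).
  move=> y [_ /mapP[a /belowP[as_ _] ->] ?]; exists (g a) => //; exact: map_f.
suff -> : Xf = uns (map g (below s Xf)) by [].
apply/esym; apply: mu_eq_sub => //; first exact: Buns.
  move=> y [_ /mapP[a /belowP[as_ aX] ->]]; have [pg [_ sg']] := hg _ as_.
  apply: XfT => //; first by case: pg.
  case: (pg) => _ _ [/sg' aa|//]; case: (atm_dff aa); exact: dffS dXf aX.
have djg : djs (map g (below s Xf)).
  move=> _ _ /mapP[a /belowP[as_ _] ->] /mapP[b /belowP[bs _] ->] n; apply: dg => //.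
  by move=> E; apply: n; rewrite E.
have ug : uniq (map g (below s Xf)) by rewrite map_inj_in_uniq.
rewrite (mu_uns ug Bg djg) (mu_dec ps dX) big_map.
rewrite [LHS]big_seq [RHS]big_seq; apply: eq_bigr => a /belowP[as_ _].
by have [_ []] := hg _ as_.
Qed.

Lemma extend_part s (g : set Y -> set Y) : part s ->
  {in s, forall a, piece (g a) /\ sim a (g a)} ->
  {in s &, forall a b, a <> b -> dj (g a) (g b)} ->
  exists x, {in s, forall a, x a = g a}.
Proof.
move=> ps h d; have [x hx] := extend_pii (pii_part ps h d).
by exists x => a as_; apply: (hx (a, g a)); apply/mapP; exists a.
Qed.

Lemma part_map x s : part s -> part (map x s).
Proof.
move=> ps; case: (ps) => us hp d xs; have hB := part_B ps; split.
- by rewrite map_inj_in_uniq// => a b /hB ? /hB ?; exact: af_inj.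
- by move=> _ /mapP[a /hp ? ->]; exact: aut_piece.
- move=> _ _ /mapP[a as_ ->] /mapP[b bs ->] n; apply: af_dj; [exact: hB|exact: hB|].
  by apply: d => // E; apply: n; rewrite E.
- by rewrite -af_uns// -(af_Xf x); apply: afS => //; exact: Buns.
Qed.

Lemma dec_map x s b : part s -> dec s b -> dec (map x s) (x b).
Proof.
move=> ps db; have Bb := dec_B ps db; case: db => sb h; have hB := part_B ps; split.
  by rewrite -af_uns//; apply: afS => //; exact: Buns.
move=> _ /mapP[a as_ ->]; have Ba := hB _ as_.
by have [ab|ab] := h _ as_; [left; exact: afS|right; exact: af_dj].
Qed.

Lemma inv_surj x s : part s -> inv x s -> {in s, forall a, exists2 b, b \in s & x b = a}.
Proof.
move=> ps ix a as_; have hB := part_B ps; have [us _ _ _] := ps.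
have u : uniq (map x s) by case: (part_map x ps).
have sub : {subset map x s <= s} by move=> _ /mapP[b bs ->]; exact: ix.
have := uniq_min_size u sub; rewrite size_map leqnn => /(_ isT)[_ /(_ a)].
by rewrite as_ => /mapP[b bs ->]; exists b.
Qed.

Lemma inv_uns x s : part s -> inv x s -> x (uns s) = uns s.
Proof.
move=> ps ix; rewrite af_uns; last exact: part_B.
apply/seteqP; split=> y [a].
  by move=> /mapP[b bs ->] ?; exists (x b) => //; exact: ix.
by move=> as_ ay; have [b bs E] := inv_surj ps ix as_; exists a => //; rewrite -E map_f.
Qed.

Definition ne (a : set Y) := `[< a <> set0 >].

(** The coarsest common refinement. The two partitions may cover different sets, hence two kinds of
    leftover cells besides the intersections. *)
Definition join s t := undup (
  [seq c <- [seq a `&` b | a <- s, b <- t] | ne c] ++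
  [seq c <- [seq a `\` uns t | a <- s] | ne c] ++
  [seq c <- [seq b `\` uns s | b <- t] | ne c]).

Lemma joinP s t c : c \in join s t <-> c <> set0 /\
  [\/ exists a b, [/\ a \in s, b \in t & c = a `&` b],
      exists2 a, a \in s & c = a `\` uns t |
      exists2 b, b \in t & c = b `\` uns s].
Proof.
rewrite mem_undup !mem_cat !mem_filter -!andb_orr; split.
  case/andP=> /asboolP n /or3P[/allpairsP[[a b] [? ? E]]|/mapP[a ? E]|/mapP[a ? E]]; split => //.
  - by constructor 1; exists a, b.
  - by constructor 2; exists a.
  - by constructor 3; exists a.
move=> [/asboolP n h]; apply/andP; split => //; apply/or3P; case: h.
- by move=> [a [b [? ? ->]]]; constructor 1; apply/allpairsP; exists (a, b).
- by move=> [a ? ->]; constructor 2; apply/mapP; exists a.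
- by move=> [a ? ->]; constructor 3; apply/mapP; exists a.
Qed.

Lemma join_sub s t c : c \in join s t ->
  ((exists2 a, a \in s & c `<=` a) \/ dj c (uns s)) /\
  ((exists2 b, b \in t & c `<=` b) \/ dj c (uns t)).
Proof.
move=> /joinP[_ [[a [b [as_ bt ->]]]|[a as_ ->]|[b bt ->]]]; split.
- by left; exists a => // y [].
- by left; exists b => // y [].
- by left; exists a => // y [].
- by right=> y [].
- by right=> y [].
- by left; exists b => // y [].
Qed.

Lemma join_cov s t y : (uns s `|` uns t) y -> uns (join s t) y.
Proof.
have key c : [\/ exists a b, [/\ a \in s, b \in t & c = a `&` b],
      exists2 a, a \in s & c = a `\` uns t |
      exists2 b, b \in t & c = b `\` uns s] -> c y -> uns (join s t) y.
  move=> h cy; exists c => //; apply/joinP; split => // E.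
  by move: cy; rewrite E.
move=> h; have [[a as_ ay]|ns] := pselect (uns s y).
  have [[b bt b_y]|nt] := pselect (uns t y).
    by apply: (key (a `&` b)) => //; constructor 1; exists a, b.
  by apply: (key (a `\` uns t)) => //; constructor 2; exists a.
case: h => [//|[b bt b_y]].
by apply: (key (b `\` uns s)) => //; constructor 3; exists b.
Qed.

Lemma join_dec s t : djs s -> djs t -> ref (join s t) s /\ ref (join s t) t.
Proof.
move=> ds dt; split=> a ast; split.
- by move=> y ay; apply: join_cov; left; exists a.
- move=> c /join_sub[[[a' a's ca]|h] _]; last first.
    by right=> y cy ay; apply: (h y) => //; exists a.
  have [<-|n] := pselect (a' = a); first by left.
  by right; apply: (djS (ds _ _ a's ast n)).
- by move=> y ay; apply: join_cov; right; exists a.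
- move=> c /join_sub[_ [[a' a's ca]|h]]; last first.
    by right=> y cy ay; apply: (h y) => //; exists a.
  have [<-|n] := pselect (a' = a); first by left.
  by right; apply: (djS (dt _ _ a's ast n)).
Qed.

Lemma join_part s t : part s -> part t -> part (join s t).
Proof.
move=> ps pt; have [us hs ds xs] := ps; have [ut ht dt xt] := pt.
have Bs := Buns (part_B ps); have Bt := Buns (part_B pt).
split; first exact: undup_uniq.
- move=> c /joinP[c0 h]; have [a pa [Bc ca]] : exists2 a, piece a & B c /\ c `<=` a.
    case: h => [[a [b [as_ bt ->]]]|[a as_ ->]|[b bt ->]].
    + exists a; first exact: hs.
      by split; [apply: BI; [exact: (part_B ps)|exact: (part_B pt)]|exact: subIsetl].
    + exists a; first exact: hs.
      by split; [apply: BD => //; exact: (part_B ps)|exact: subDsetl].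
    + exists b; first exact: ht.
      by split; [apply: BD => //; exact: (part_B pt)|exact: subDsetl].
  by have [] := piece_sub pa Bc c0 ca.
- move=> c c' cj cj' n y cy cy'; apply: n.
  have [hs1 ht1] := join_sub cj; have [hs2 ht2] := join_sub cj'.
  have Es : uns s y -> exists a, [/\ a \in s, c `<=` a & c' `<=` a].
    move=> uy; case: hs1 => [[a as_ ca]|h]; last by case: (h y).
    case: hs2 => [[a' a's ca']|h]; last by case: (h y).
    have E : a = a' by apply: contrapT => /(ds _ _ as_ a's) /(_ y); apply; [exact: ca|exact: ca'].
    by exists a; split => //; rewrite E.
  have Et : uns t y -> exists a, [/\ a \in t, c `<=` a & c' `<=` a].
    move=> uy; case: ht1 => [[a as_ ca]|h]; last by case: (h y).
    case: ht2 => [[a' a's ca']|h]; last by case: (h y).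
    have E : a = a' by apply: contrapT => /(dt _ _ as_ a's) /(_ y); apply; [exact: ca|exact: ca'].
    by exists a; split => //; rewrite E.
  have uq (d : seq (set Y)) a a' z : a \in d -> a' \in d -> djs d -> a z -> a' z -> a = a'.
    by move=> ad a'd dd az a'z; apply: contrapT => /(dd _ _ ad a'd) /(_ z); exact.
  move: cj cj' => /joinP[_ h] /joinP[_ h']; case: h cy => [[a [b [as_ bt E]]]|[a as_ E]|[b bt E]];
    case: h' cy' => [[a' [b' [as' bt' E']]]|[a' as' E']|[b' bt' E']]; rewrite E E' => -[] z1 z2 [] z3 z4.
  + by rewrite (uq _ _ _ _ as_ as' ds z3 z1) (uq _ _ _ _ bt bt' dt z4 z2).
  + by case: z2; exists b.
  + by case: z2; exists a.
  + by case: z4; exists b'.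
  + by rewrite (uq _ _ _ _ as_ as' ds z3 z1).
  + by case: z2; exists a.
  + by case: z4; exists a'.
  + by case: z4; exists a'.
  + by rewrite (uq _ _ _ _ bt bt' dt z3 z1).
- by move=> y /xs h; apply: join_cov; left.
Qed.

Lemma join_inv x s t : part s -> part t -> inv x s -> inv x t -> inv x (join s t).
Proof.
move=> ps pt is_ it_ c /joinP[c0 h]; have hs := part_B ps; have ht := part_B pt.
have Bs := Buns hs; have Bt := Buns ht.
have xne d : B d -> d <> set0 -> x d <> set0 by exact: af_neq0.
case: h c0 => [[a [b [as_ bt ->]]]|[a as_ ->]|[b bt ->]] c0.
- apply/joinP; split; first by apply: xne => //; apply: BI; [exact: hs|exact: ht].
  constructor 1; exists (x a), (x b); split; [exact: is_|exact: it_|].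
  by rewrite afI//; [exact: hs|exact: ht].
- apply/joinP; split; first by apply: xne => //; apply: BD => //; exact: hs.
  constructor 2; exists (x a); first exact: is_.
  by rewrite afD ?inv_uns//; exact: hs.
- apply/joinP; split; first by apply: xne => //; apply: BD => //; exact: ht.
  constructor 3; exists (x b); first exact: it_.
  by rewrite afD ?inv_uns//; exact: ht.
Qed.

Lemma part_dec b : B b -> exists s, part s /\ dec s b.
Proof.
move=> Bb; have [s1 [us1 h1 d1 E1]] := PD Bb; have [s2 [us2 h2 d2 E2]] := PD (BD BXf Bb).
have dd a c : a \in s1 -> c \in s2 -> dj a c.
  move=> /sub_uns + /sub_uns; rewrite E1 E2 => ab cb y /ab b_y /cb[_]; exact.
have hp : {in s1 ++ s2, forall a, piece a}.
  by move=> a; rewrite mem_cat => /orP[/h1|/h2].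
exists (s1 ++ s2); split.
  split => //.
  - rewrite cat_uniq us1 us2 andbT /=; apply/hasPn => c c2; apply/negP => c1.
    by move: (dd _ _ c1 c2) => /dj_self; exact: (piece_neq0 (h2 _ c2)).
  - move=> a c; rewrite !mem_cat => /orP[as_|as_] /orP[cs|cs] n; [exact: d1| |  |exact: d2].
      exact: dd.
    by apply: djC; exact: dd.
  - rewrite uns_cat E1 E2 => y Xy; have [|] := pselect (b y); [by left|by right].
split; first by rewrite uns_cat E1 => y; left.
move=> a; rewrite mem_cat => /orP[/sub_uns|/sub_uns]; rewrite ?E1 ?E2; first by left.
by move=> k; right=> y /k[].
Qed.

Lemma part_decs (l : seq (set Y)) : {in l, forall b, B b} ->
  exists s, part s /\ {in l, forall b, dec s b}.
Proof.
elim: l => [|b l IH] h; first by have [s [ps _]] := part_dec B0; exists s.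
have [|s [ps hs]] := IH; first by move=> c cl; apply: h; rewrite inE cl orbT.
have [t [pt ht]] := part_dec (h _ (mem_head _ _)).
have [_ _ ds _] := ps; have [_ _ dt _] := pt; have [r1 r2] := join_dec ds dt.
exists (join s t); split; first exact: join_part.
move=> c; rewrite inE => /orP[/eqP->|/hs]; [exact: dec_trans r2 ht|exact: dec_trans].
Qed.

Lemma split_piece a (ws : seq R) : piece a -> {in ws, forall w, V w /\ 0 < w} ->
  \sum_(w <- ws) w = mu a -> (atm a -> ws = [:: mu a]) ->
  exists ds, [/\ uniq ds, {in ds, forall c, piece c}, djs ds, uns ds = a & map mu ds = ws].
Proof.
elim: ws a => [|w ws IH] a pa hw.
  by rewrite big_nil => E; have := piece_mu pa; rewrite -E ltxx.
rewrite big_cons => E ha.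
have [/eqP ws0|wsn] := boolP (ws == [::]).
  exists [:: a]; split => //.
  - by move=> c; rewrite mem_seq1 => /eqP->.
  - by move=> c d; rewrite !mem_seq1 => /eqP-> /eqP->.
  - by rewrite uns_cons uns_nil setU0.
  - by move: E; rewrite ws0 big_nil addr0 /= => ->.
have da : dff a by case: (pa) => _ _ [/ha [_ E']|//]; rewrite E' in wsn.
have [Ba a0 _] := pa.
have [Vw w0] := hw _ (mem_head _ _).
have hws : {in ws, forall w, V w /\ 0 < w} by move=> v vs; apply: hw; rewrite inE vs orbT.
have s0 : 0 < \sum_(w <- ws) w.
  case: ws wsn hws {IH hw E ha} => // v ws _ hws; rewrite big_cons.
  apply: ltr_pwDl; first by have [] := hws _ (mem_head _ _).
  rewrite big_seq; apply: sumr_ge0 => u us; apply: ltW.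
  by have [] := hws u; rewrite // inE us orbT.
have [b [Bb ba mb]] : exists b, [/\ B b, b `<=` a & mu b = w].
  by apply: SP => //; rewrite w0 -E ltrDl.
have b0 : b <> set0 by move=> e; move: w0; rewrite -mb e mu0 ltxx.
have Bc := BD Ba Bb.
have mc : mu (a `\` b) = \sum_(w <- ws) w by rewrite muD// mb -E; lra.
have c0 : a `\` b <> set0 by move=> e; move: s0; rewrite -mc e mu0 ltxx.
have [pb _] := piece_sub pa Bb b0 ba.
have [pc _] := piece_sub pa Bc c0 (@subDsetl _ a b).
have [||ds [u h d Eu Em]] := IH _ pc hws; first by rewrite mc.
  by move=> /atm_dff /(_ (dffS da (@subDsetl _ a b))).
have dbc c : c \in ds -> dj b c by move=> /sub_uns; rewrite Eu => k y b_y /k[].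
exists (b :: ds); split.
- rewrite cons_uniq u andbT; apply/negP => /dbc /dj_self; exact: b0.
- by move=> c; rewrite inE => /orP[/eqP->|/h].
- move=> c c'; rewrite !inE => /orP[/eqP->|cs] /orP[/eqP->|cs'] // n; [exact: dbc| |exact: d].
  by apply: djC; exact: dbc.
- by rewrite uns_cons Eu setDUK.
- by rewrite /= mb Em.
Qed.

Lemma room (l : seq (set Y)) b : {in l, forall a, piece a /\ dj a Xf} -> B b ->
  exists g : set Y -> set Y, {in l, forall a, [/\ piece (g a), sim a (g a) & dj (g a) b]} /\
    {in l &, forall a c, a <> c -> dj (g a) (g c)}.
Proof.
move=> + Bb; elim: l => [|a l IH] h; first by exists id.
have [|g [hg dg]] := IH; first by move=> c cl; apply: h; rewrite inE cl orbT.
have [pa dX] := h _ (mem_head _ _).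
have Bg : B (uns (map g l)).
  by apply: Buns => _ /mapP[c /hg[[Bc _ _] _ _] ->].
have [c [pc sc dc]] := INF pa dX (BU Bb Bg).
exists (fun d => if d == a then c else g d); split.
  move=> d; rewrite inE; have [->|] := eqVneq d a => [_|_ /= /hg//].
  by split => //; apply: (djS dc) => //; left.
have key d : d \in l -> dj c (g d).
  by move=> dl; apply: (djS dc) => // y gy; right; exists (g d) => //; exact: map_f.
move=> d e; rewrite !inE; have [->|_] := eqVneq d a => [_|/= dl];
  have [->|_] := eqVneq e a => [_|/= el] n //; [exact: key| |exact: dg].
by apply: djC; exact: key.
Qed.

Lemma sub_eq x b c : B b -> B c -> x b `<=` c -> mu b = mu c -> x b = c.
Proof. by move=> Bb Bc s E; apply: mu_eq_sub => //; [exact: afB|rewrite amu]. Qed.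

(** * Amalgamation and extension of partial automorphisms *)

Section amalgamation.
Variables (I : Type) (u v : I -> aut) (s s1 s2 : seq (set Y)).
Hypotheses (ps : part s) (ps1 : part s1) (ps2 : part s2).
Hypotheses (rs1 : ref s1 s) (rs2 : ref s2 s).
Hypothesis huv : forall i,
  [/\ inv (u i) s, inv (u i) s1, inv (v i) s2 & eqon (u i) (v i) s].

(** As [s1] and [s2] refine [s], each of their members is either inner or disjoint from the union of
    [s]. *)
Let inner c := exists2 a, a \in s & c `<=` a.

Let par_ex : exists par, forall c, inner c -> par c \in s /\ c `<=` par c.
Proof.
suff /choice[par hp] : forall c, exists a, inner c -> a \in s /\ c `<=` a by exists par.
move=> c; have [[a as_ ca]|n] := pselect (inner c); first by exists a.
by exists set0 => /n.
Qed.
Let par := sval (cid par_ex).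
Let par_s c : inner c -> par c \in s.
Proof. by move=> /(svalP (cid par_ex) c)[]. Qed.
Let sub_par c : inner c -> c `<=` par c.
Proof. by move=> /(svalP (cid par_ex) c)[]. Qed.

Let par_uq c a : c <> set0 -> a \in s -> c `<=` a -> par c = a.
Proof.
move=> c0 as_ ca; have ic : inner c by exists a.
have [_ _ ds _] := ps; apply: contrapT => /(ds _ _ (par_s ic) as_) h.
by apply: c0; rewrite -subset0 => y cy; apply: (h y); [exact: sub_par|exact: ca].
Qed.

Let ne1 c : c \in s1 -> c <> set0.
Proof. by case: ps1 => _ h _ _ /h[]. Qed.
Let ne2 e : e \in s2 -> e <> set0.
Proof. by case: ps2 => _ h _ _ /h[]. Qed.

Let cel c e := [/\ c \in s1, e \in s2, inner c, inner e & par c = par e].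

Let cel_below1 c e : e \in s2 -> inner e -> c \in below s1 (par e) <-> cel c e.
Proof.
move=> e2 ie; split=> [/belowP[c1 ce]|[c1 _ ic _ <-]].
  by split => //; [exists (par e) => //; exact: par_s|exact: par_uq (ne1 c1) (par_s ie) ce].
by apply/belowP; split => //; exact: sub_par.
Qed.

Let cel_below2 c e : c \in s1 -> inner c -> e \in below s2 (par c) <-> cel c e.
Proof.
move=> c1 ic; split=> [/belowP[e2 ec]|[_ e2 _ ie ->]].
  split => //; first by exists (par c) => //; exact: par_s.
  by apply/esym; exact: par_uq (ne2 e2) (par_s ic) ec.
by apply/belowP; split => //; exact: sub_par.
Qed.

Let ppar c : inner c -> piece (par c).
Proof. by move=> /par_s; case: ps => _ h _ _ /h. Qed.

Let ds_ex : exists ds : set Y -> seq (set Y), forall c, c \in s1 -> inner c ->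
  [/\ uniq (ds c), {in ds c, forall d, piece d}, djs (ds c), uns (ds c) = c &
      map mu (ds c) = [seq mu c * mu e / mu (par c) | e <- below s2 (par c)]].
Proof.
suff /choice[ds hds] : forall c, exists ds, c \in s1 -> inner c ->
  [/\ uniq ds, {in ds, forall d, piece d}, djs ds, uns ds = c &
      map mu ds = [seq mu c * mu e / mu (par c) | e <- below s2 (par c)]] by exists ds.
move=> c; have [[c1 ic]|n] := pselect (c \in s1 /\ inner c); last first.
  by exists [::] => c1 ic; case: n.
have pc : piece c by case: ps1 => _ h _ _; exact: h.
have pp := ppar ic; have m0 := piece_mu pp; have mc0 := piece_mu pc.
have E := mu_dec ps2 (rs2 (par_s ic)).
have hs e : e \in below s2 (par c) -> piece e.
  by case: ps2 => _ h _ _ /belowP[/h].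
have [||//|ds [h1 h2 h3 h4 h5]] := @split_piece c
    [seq mu c * mu e / mu (par c) | e <- below s2 (par c)] pc.
- move=> _ /mapP[e /hs pe ->]; split.
    by apply: VM; [apply: VM; apply/Vmu/pieceB|apply/VI/Vmu/pieceB].
  by rewrite divr_gt0// mulr_gt0// piece_mu.
- rewrite big_map -mulr_suml -mulr_sumr -E mulfK//.
  by rewrite gt_eqF.
(* An inner atom equals its parent, and the parent is the only member of [s2] below itself, so a
   single mass is asked for. *)
- move=> ac; have [_ _ [ap|dp]] := pp; last first.
    by case: (atm_dff ac); apply: dffS dp _; exact: sub_par.
  have cp : c = par c.
    by have [/(ne1 c1)|] := atm_sub ap (sub_par ic).
  have bE : below s2 (par c) = [:: par c].
    have hin e : e \in below s2 (par c) -> e = par c.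
      move=> eb; have := hs _ eb; move/belowP: (eb) => [_ ep].
      by have [->[]|] := atm_sub ap ep.
    have [ub _] := below_uniq (par c) ps2.
    move: E hin ub; case: (below s2 (par c)) => [|e [|e' l]].
    + by rewrite big_nil => m; move: m0; rewrite m ltxx.
    + by move=> _ /(_ e); rewrite mem_seq1 eqxx => /(_ isT) ->.
    + move=> _ h; rewrite (h e) ?mem_head// (h e') ?inE ?eqxx ?orbT//=.
      by rewrite inE eqxx.
  by rewrite bE /= -cp mulfK// gt_eqF.
by exists ds.
Qed.
Let ds := sval (cid ds_ex).
Let dsP c (c1 : c \in s1) (ic : inner c) := svalP (cid ds_ex) c c1 ic.

(** This will be the intersection of c with the image of e, once the embedding f of [s2] exists. *)
Let d c e := nth set0 (ds c) (index e (below s2 (par c))).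

Let size_ds c : c \in s1 -> inner c -> size (ds c) = size (below s2 (par c)).
Proof.
by move=> c1 ic; have [_ _ _ _ E] := dsP c1 ic; rewrite -(size_map mu) -/ds E size_map.
Qed.

Let idx_ds c e : cel c e -> (index e (below s2 (par c)) < size (ds c))%N.
Proof.
by move=> h; case: (h) => c1 e2 ic ie E; rewrite size_ds// index_mem; exact/cel_below2.
Qed.

Let d_in c e : cel c e -> d c e \in ds c.
Proof. by move=> h; apply: mem_nth; exact: idx_ds. Qed.

Let d_mu c e : cel c e -> mu (d c e) = mu c * mu e / mu (par c).
Proof.
move=> h; case: (h) => c1 e2 ic ie E; have [_ _ _ _ Em] := dsP c1 ic.
have := congr1 (fun l => nth 0 l (index e (below s2 (par c)))) Em.
rewrite (nth_map set0) ?idx_ds// (nth_map set0) ?nth_index ?index_mem//.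
  exact/cel_below2.
exact/cel_below2.
Qed.

Let d_piece c e : cel c e -> piece (d c e).
Proof.
move=> h; case: (h) => c1 e2 ic ie E; have [_ k _ _ _] := dsP c1 ic.
exact/k/d_in.
Qed.

Let d_sub c e : cel c e -> d c e `<=` c.
Proof.
move=> h; case: (h) => c1 e2 ic ie E; have [_ _ _ Eu _] := dsP c1 ic.
by rewrite -[X in _ `<=` X]Eu; exact/sub_uns/d_in.
Qed.

Let d_dj c e c' e' : cel c e -> cel c' e' -> (c, e) <> (c', e') -> dj (d c e) (d c' e').
Proof.
move=> h h'; case: (h) => c1 e2 ic ie E; case: (h') => c1' e2' ic' ie' E' n.
have [cc|cc] := pselect (c = c'); last first.
  have [_ _ d1 _] := ps1; apply: (djS (d1 _ _ c1 c1' cc)); exact: d_sub.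
rewrite -cc in h' n *; have [ud _ dd _ _] := dsP c1 ic.
apply: dd; [exact: d_in|exact: d_in|] => /eqP.
rewrite nth_uniq ?idx_ds// => /eqP Ei; apply: n; congr pair.
have m1 : e \in below s2 (par c) by exact/cel_below2.
have m2 : e' \in below s2 (par c) by exact/cel_below2.
by rewrite -(nth_index set0 m1) Ei nth_index.
Qed.

Let d_cov c y : c \in s1 -> inner c -> c y -> exists2 e, cel c e & d c e y.
Proof.
move=> c1 ic cy; have [ud _ dd Eu _] := dsP c1 ic.
move: cy; rewrite -{1}Eu => -[D Dd Dy].
have k : (index D (ds c) < size (below s2 (par c)))%N by rewrite -size_ds// index_mem.
have [ub _] := below_uniq (par c) ps2.
exists (nth set0 (below s2 (par c)) (index D (ds c))).
  by apply/cel_below2 => //; exact: mem_nth.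
by rewrite /d index_uniq// nth_index.
Qed.

(** The future image of e: its cells over all c with the same parent a. The masses mu c * mu e / mu
    a add up to mu e, because those c fill a. *)
Let G e := uns [seq d c e | c <- below s1 (par e)].

Let GP e y : e \in s2 -> inner e -> G e y <-> exists2 c, cel c e & d c e y.
Proof.
move=> e2 ie; split.
  by move=> [_ /mapP[c /(cel_below1 _ e2 ie) h ->] ?]; exists c.
by move=> [c /(cel_below1 _ e2 ie) h ?]; exists (d c e) => //; exact: map_f.
Qed.

Let G_B e : e \in s2 -> inner e -> B (G e).
Proof.
move=> e2 ie; apply: Buns => _ /mapP[c /(cel_below1 _ e2 ie) h ->].
exact/pieceB/d_piece.
Qed.

Let G_sub e : e \in s2 -> inner e -> G e `<=` par e.
Proof.
move=> e2 ie y /(GP _ e2 ie)[c h /(d_sub h) cy]; case: h => _ _ ic _ <-.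
exact: sub_par cy.
Qed.

Let G_mu e : e \in s2 -> inner e -> mu (G e) = mu e.
Proof.
move=> e2 ie; have [ub db] := below_uniq (par e) ps1.
have pp := ppar ie; have m0 := piece_mu pp.
have inj : {in below s1 (par e) &, injective (d^~ e)}.
  move=> c c' /(cel_below1 _ e2 ie) h /(cel_below1 _ e2 ie) h' E.
  apply: contrapT => n; have : dj (d c e) (d c' e) by apply: d_dj => // -[].
  by rewrite E => /dj_self; exact: (piece_neq0 (d_piece h')).
rewrite mu_uns ?map_inj_in_uniq//.
- rewrite big_map big_seq (eq_bigr (fun c => mu c * (mu e / mu (par e)))); last first.
    by move=> c /(cel_below1 _ e2 ie) h; rewrite d_mu//; case: h => _ _ _ _ ->; rewrite mulrA.
  by rewrite -big_seq -mulr_suml -(mu_dec ps1 (rs1 (par_s ie))) mulrC divfK// gt_eqF.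
- by move=> _ /mapP[c /(cel_below1 _ e2 ie) h ->]; exact/pieceB/d_piece.
- move=> _ _ /mapP[c /(cel_below1 _ e2 ie) h ->] /mapP[c' /(cel_below1 _ e2 ie) h' ->] n.
  by apply: d_dj => // -[E]; apply: n; rewrite E.
Qed.

Let out_dj t e : ref t s -> e \in t -> ~ inner e -> dj e (uns s).
Proof.
move=> rt et ne y ey [a as_ ay]; have [_ /(_ _ et)[ea|k]] := rt _ as_.
  by apply: ne; exists a.
exact: (k y).
Qed.

Let Xs : Xf `<=` uns s. Proof. by case: ps. Qed.

(** Outside the union of [s] the joining is free: outer members of [s2] are copied away from [s1].
    They are disjoint from [Xf], which [s] covers, so [room] applies. *)
Let o_ex : exists o : set Y -> set Y,
  (forall e, e \in s2 -> ~ inner e ->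
     [/\ piece (o e), sim e (o e) & dj (o e) (uns s1 `|` uns s)]) /\
  (forall e e', e \in s2 -> e' \in s2 -> ~ inner e -> ~ inner e' -> e <> e' ->
     dj (o e) (o e')).
Proof.
have [||o [h k]] := @room [seq e <- s2 | `[< ~ inner e >]] (uns s1 `|` uns s).
- move=> e; rewrite mem_filter => /andP[/asboolP n e2]; split.
    by case: ps2 => _ + _ _; exact.
  by apply: (djS (out_dj rs2 e2 n)).
- by apply: BU; apply: Buns; exact: part_B.
exists o; split.
  by move=> e e2 n; apply: h; rewrite mem_filter e2 andbT; exact/asboolP.
move=> e e' e2 e2' n n' ee; apply: k => //; rewrite mem_filter.
  by rewrite e2 andbT; exact/asboolP.
by rewrite e2' andbT; exact/asboolP.
Qed.
Let o := sval (cid o_ex).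
Let oP e : e \in s2 -> ~ inner e -> [/\ piece (o e), sim e (o e) & dj (o e) (uns s1 `|` uns s)].
Proof. by case: (svalP (cid o_ex)) => h _; exact: h. Qed.
Let o_dj e e' : e \in s2 -> e' \in s2 -> ~ inner e -> ~ inner e' -> e <> e' -> dj (o e) (o e').
Proof. by case: (svalP (cid o_ex)) => _; exact. Qed.

Let g e := if pselect (inner e) then G e else o e.
Let g_in e : inner e -> g e = G e. Proof. by rewrite /g; case: pselect. Qed.
Let g_out e : ~ inner e -> g e = o e. Proof. by rewrite /g; case: pselect. Qed.

Let f_ex : exists f, {in s2, forall e, f e = g e}.
Proof.
have h2 : {in s2, forall e, piece e} by case: ps2.
apply: extend_part => //.
  move=> e e2; have [ie|ne] := pselect (inner e); last by rewrite g_out//; have [] := oP e2 ne.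
  rewrite g_in//; have pe := h2 _ e2; have pp := ppar ie.
  have G0 : G e <> set0 by move=> E; have := piece_mu pe; rewrite -G_mu// E mu0 ltxx.
  have [pG kG] := piece_sub pp (G_B e2 ie) G0 (G_sub e2 ie).
  have [_ ke] := piece_sub pp (pieceB pe) (ne2 e2) (sub_par ie).
  by split => //; split; [rewrite G_mu|tauto].
move=> e e' e2 e2' n; have [ie|ne] := pselect (inner e); have [ie'|ne'] := pselect (inner e').
- rewrite !g_in// => y /(GP _ e2 ie)[c h cy] /(GP _ e2' ie')[c' h' cy'].
  by apply: (d_dj h h') cy cy' => -[].
- rewrite g_in// g_out//; have [_ _ k] := oP e2' ne'.
  move=> y /(G_sub e2 ie) py oy; apply: (k y) => //; right; exists (par e) => //; exact: par_s.
- rewrite g_out// g_in//; have [_ _ k] := oP e2 ne.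
  move=> y oy /(G_sub e2' ie') py; apply: (k y) => //; right; exists (par e') => //; exact: par_s.
- by rewrite !g_out//; exact: o_dj.
Qed.
Let f := sval (cid f_ex).
Let fP e : e \in s2 -> f e = g e. Proof. exact: (svalP (cid f_ex)). Qed.

(** Names for the cells of the amalgam: pairs of inner members with a common parent, outer members
    of [s1], outer members of [s2]. Each i acts on names, where it is a permutation by construction,
    and [val] carries the action over to sets. *)
Let idx := (set Y * set Y + (set Y + set Y))%type.
Let val (k : idx) := match k with inl p => d p.1 p.2 | inr (inl c) => c | inr (inr e) => o e end.
Let ok (k : idx) := match k with inl p => cel p.1 p.2
  | inr (inl c) => c \in s1 /\ ~ inner c | inr (inr e) => e \in s2 /\ ~ inner e end.
Let act i (k : idx) : idx := match k with inl p => inl (u i p.1, v i p.2)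
  | inr (inl c) => inr (inl (u i c)) | inr (inr e) => inr (inr (v i e)) end.

Let inner_u i c : c \in s1 -> inner c <-> inner (u i c).
Proof.
move=> c1; have [iu _ _ _] := huv i; have B1 := part_B ps1; have Bs := part_B ps; split.
  move=> [a as_ ca]; exists (u i a); first exact: iu.
  by apply: afS => //; [exact: B1|exact: Bs].
move=> [a as_ ca]; have [a0 a0s E] := inv_surj ps iu as_; exists a0 => //.
by apply: (@afSE (u i)); [exact: B1|exact: Bs|rewrite E].
Qed.

Let inner_v i e : e \in s2 -> inner e <-> inner (v i e).
Proof.
move=> c1; have [iu _ _ e_] := huv i; have B2 := part_B ps2; have Bs := part_B ps; split.
  move=> [a as_ ca]; exists (v i a); first by rewrite -e_//; exact: iu.
  by apply: afS => //; [exact: B2|exact: Bs].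
move=> [a as_ ca]; have [a0 a0s E] := inv_surj ps iu as_; exists a0 => //.
by apply: (@afSE (v i)); [exact: B2|exact: Bs|rewrite -(e_ a0)// E].
Qed.

Let par_u i c : c \in s1 -> inner c -> par (u i c) = u i (par c).
Proof.
move=> c1 ic; have [iu _ _ _] := huv i; have B1 := part_B ps1; have Bs := part_B ps.
apply: par_uq; first by apply: af_neq0; [exact: B1|exact: ne1].
  exact/iu/par_s.
by apply: afS; [exact: B1|exact/Bs/par_s|exact: sub_par].
Qed.

Let par_v i e : e \in s2 -> inner e -> par (v i e) = u i (par e).
Proof.
move=> e2 ic; have [iu _ _ e_] := huv i; have B2 := part_B ps2; have Bs := part_B ps.
apply: par_uq; first by apply: af_neq0; [exact: B2|exact: ne2].
  exact/iu/par_s.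
rewrite e_; last exact: par_s.
by apply: afS; [exact: B2|exact/Bs/par_s|exact: sub_par].
Qed.

Let ok_act i k : ok k -> ok (act i k).
Proof.
have [iu iu1 iv2 e_] := huv i.
case: k => [[c e] /= [c1 e2 ic ie E]|[c /= [c1 n]|e /= [e2 n]]].
- split; [exact: iu1|exact: iv2|by apply/(inner_u i c1)|by apply/(inner_v i e2)|].
  by rewrite par_u// par_v// E.
- by split; [exact: iu1|move/(inner_u i c1)].
- by split; [exact: iv2|move/(inner_v i e2)].
Qed.

Let act_surj i k : ok k -> exists2 k0, ok k0 & act i k0 = k.
Proof.
have [iu iu1 iv2 e_] := huv i; have B1 := part_B ps1; have Bs := part_B ps.
case: k => [[c e] /= [c1 e2 ic ie E]|[c /= [c1 n]|e /= [e2 n]]].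
- have [c0 c01 Ec] := inv_surj ps1 iu1 c1; have [e0 e02 Ee] := inv_surj ps2 iv2 e2.
  have ic0 : inner c0 by apply/(inner_u i c01); rewrite Ec.
  have ie0 : inner e0 by apply/(inner_v i e02); rewrite Ee.
  exists (inl (c0, e0)); last by rewrite /= Ec Ee.
  split => //; apply: (af_inj (x := u i)); [exact/Bs/par_s|exact/Bs/par_s|].
  by rewrite -par_u// -par_v// Ec Ee.
- have [c0 c01 Ec] := inv_surj ps1 iu1 c1; exists (inr (inl c0)); last by rewrite /= Ec.
  by split => // ic0; apply: n; rewrite -Ec; apply/(inner_u i c01).
- have [e0 e02 Ee] := inv_surj ps2 iv2 e2; exists (inr (inr e0)); last by rewrite /= Ee.
  by split => // ic0; apply: n; rewrite -Ee; apply/(inner_v i e02).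
Qed.

Let act_inj i k k' : ok k -> ok k' -> act i k = act i k' -> k = k'.
Proof.
have B1 := part_B ps1; have B2 := part_B ps2.
have i1 c c' : c \in s1 -> c' \in s1 -> u i c = u i c' -> c = c'.
  by move=> /B1 ? /B1 ?; exact: af_inj.
have i2 c c' : c \in s2 -> c' \in s2 -> v i c = v i c' -> c = c'.
  by move=> /B2 ? /B2 ?; exact: af_inj.
case: k => [[c e] /= [c1 e2 _ _ _]|[c /= [c1 _]|e /= [e2 _]]];
  case: k' => [[c' e'] /= [c1' e2' _ _ _]|[c' /= [c1' _]|e' /= [e2' _]]] //.
- by case=> /i1 -> // /i2 ->.
- by case=> /i1 ->.
- by case=> /i2 ->.
Qed.

Let val_piece k : ok k -> piece (val k).
Proof.
case: k => [[c e] /= h|[c /= [c1 n]|e /= [e2 n]]]; first exact: d_piece.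
  by case: ps1 => _ + _ _; exact.
by have [] := oP e2 n.
Qed.

Let val_dj k k' : ok k -> ok k' -> k <> k' -> dj (val k) (val k').
Proof.
have dout c e c' : cel c e -> c' \in s1 -> ~ inner c' -> dj (d c e) c'.
  move=> h c1' n'; apply: djC; apply: (djS (out_dj rs1 c1' n')) => // y /(d_sub h).
  by case: h => _ _ ic _ _ /(sub_par ic) ?; exists (par c) => //; exact: par_s.
have oout c e e' : cel c e -> e' \in s2 -> ~ inner e' -> dj (d c e) (o e').
  move=> h e2 n'; have [_ _ k0] := oP e2 n'; apply: djC; apply: (djS k0) => // y /(d_sub h) cy.
  by left; exists c => //; case: h.
have co c e : c \in s1 -> e \in s2 -> ~ inner e -> dj c (o e).
  move=> c1 e2 n; have [_ _ k0] := oP e2 n; apply: djC; apply: (djS k0) => // y cy.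
  by left; exists c.
case: k => [[c e] /= h|[c /= [c1 n]|e /= [e2 n]]];
  case: k' => [[c' e'] /= h'|[c' /= [c1' n']|e' /= [e2' n']]] nk.
- by apply: d_dj => // E; apply: nk; rewrite E.
- exact: dout.
- exact: oout.
- by apply: djC; exact: dout.
- by have [_ _ d1 _] := ps1; apply: d1 => // E; apply: nk; rewrite E.
- exact: co.
- by apply: djC; exact: oout.
- by apply: djC; exact: co.
- by apply: o_dj => // E; apply: nk; rewrite E.
Qed.

Let val_sim i k : ok k -> sim (val k) (val (act i k)).
Proof.
move=> h; have h' := ok_act i h; move: h h'.
case: k => [[c e] /= h h'|[c /= [c1 n] _|e /= [e2 n] [ve2 vn]]].
- have kin c' e' : cel c' e' -> atm (d c' e') <-> atm (par c').
    move=> k; case: (k) => ? ? ic' ? ?; have [] := piece_sub (ppar ic') (pieceB (d_piece k)) _ _ => //.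
      exact: (piece_neq0 (d_piece k)).
    exact: subset_trans (d_sub k) (sub_par ic').
  have B1 := part_B ps1; have B2 := part_B ps2; have Bs := part_B ps.
  case: (h) => c1 e2 ic ie E; split.
    rewrite !d_mu// par_u// !amu//; [exact/Bs/par_s|exact: B2|exact: B1].
  rewrite (kin _ _ h) (kin _ _ h') par_u//; apply: aut_atmE; exact/Bs/par_s.
- by apply: aut_sim; exact: (part_B ps1).
- have [_ s_ _] := oP e2 n; have [_ s_' _] := oP ve2 vn.
  apply: sim_trans (sim_sym s_) _; apply: sim_trans s_'.
  by apply: aut_sim; exact: (part_B ps2).
Qed.

Let okl : seq idx := [seq k <- [seq inl (c, e) | c <- s1, e <- s2] ++
   [seq inr (inl c) | c <- s1] ++ [seq inr (inr e) | e <- s2] | `[< ok k >]].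

Let oklP k : k \in okl <-> ok k.
Proof.
rewrite mem_filter; split=> [/andP[/asboolP]//|h]; apply/andP; split; first exact/asboolP.
rewrite !mem_cat; case: k h => [[c e] /= [c1 e2 _ _ _]|[c /= [c1 n]|e /= [e2 n]]].
- by apply/or3P; constructor 1; apply/allpairsP; exists (c, e).
- by apply/or3P; constructor 2; apply/mapP; exists c.
- by apply/or3P; constructor 3; apply/mapP; exists e.
Qed.

Let z_ex i : exists z : aut, forall k, ok k -> z (val k) = val (act i k).
Proof.
have cov y : Xf y -> exists2 k, ok k & val k y.
  move=> /Xs[a as_ ay]; have [/(_ _ ay)[c c1 cy] /(_ _ c1)] := rs1 as_.
  case=> [ca|/(_ y)]; last by case.
  have ic : inner c by exists a.
  by have [e h dy] := d_cov c1 ic cy; exists (inl (c, e)).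
have [|z hz] := @extend_pii [seq (val k, val (act i k)) | k <- okl].
  split.
  - move=> _ /mapP[k /oklP h ->] /=; split; [exact: val_piece| |exact: val_sim].
    by apply: val_piece; exact: ok_act.
  - move=> _ _ /mapP[k /oklP h ->] /mapP[k' /oklP h' ->] /= n.
    have nk : k <> k' by move=> E; apply: n; rewrite E.
    by split; apply: val_dj => //; [exact: ok_act|exact: ok_act|move/act_inj => /(_ h h')].
  - move=> y /cov[k h ky]; apply/u1P; exists (val k, val (act i k)) => //.
    by apply/mapP; exists k => //; exact/oklP.
  - move=> y /cov[k h ky]; have [k0 h0 E] := act_surj i h.
    apply/u2P; exists (val k0, val (act i k0)); last by rewrite /= E.
    by apply/mapP; exists k0 => //; exact/oklP.
exists z => k h; apply: (hz (val k, val (act i k))).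
by apply/mapP; exists k => //; exact/oklP.
Qed.

(* Relatively independent joining over s: the cell of c and e has measure mu c * mu e / mu a. *)
Lemma amalg : exists (f : aut) (z : I -> aut), [/\ {in s, forall a, f a = a},
  forall i, {in s1, forall c, z i c = u i c} &
  forall i, {in s2, forall e, z i (f e) = f (v i e)}].
Proof.
have /choice[z hz] := z_ex; exists f, z; have B1 := part_B ps1; have B2 := part_B ps2.
have Bs := part_B ps.
split.
- move=> a as_; apply: sub_eq; [exact: Bs|exact: Bs| |by []].
  rewrite -{1}(dec_E ps2 (rs2 as_)) af_uns; last exact: below_B.
  move=> y [_ /mapP[e /belowP[e2 ea] ->]].
  have ie : inner e by exists a.
  by rewrite fP// g_in// => /(G_sub e2 ie); rewrite (par_uq (ne2 e2) as_ ea).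
- move=> i c c1; have [iu iu1 iv2 e_] := huv i.
  have [ic|n] := pselect (inner c); last by apply: (hz i (inr (inl c))).
  apply: sub_eq; [exact: B1|exact/afB/B1| |by rewrite amu//; exact: B1].
  have Ec : c = uns [seq d c e | e <- below s2 (par c)].
    apply/seteqP; split=> y.
      move=> /(d_cov c1 ic)[e h dy]; exists (d c e) => //; apply: map_f.
      exact/cel_below2.
    by move=> [_ /mapP[e /(cel_below2 _ c1 ic) h ->]]; exact: d_sub.
  rewrite [X in z i X]Ec af_uns; last first.
    by move=> _ /mapP[e /(cel_below2 _ c1 ic) h ->]; exact/pieceB/d_piece.
  move=> y [_ /mapP[_ /mapP[e /(cel_below2 _ c1 ic) h ->] ->]].
  have -> := hz i (inl (c, e)) h.
  have h' := @ok_act i (inl (c, e)) h.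
  exact: d_sub h' _.
- move=> i e e2; have [iu iu1 iv2 e_] := huv i.
  have ve2 : v i e \in s2 by exact: iv2.
  rewrite !fP//; have [ie|n] := pselect (inner e); last first.
    rewrite !g_out//; last by move/(inner_v i e2).
    exact: (hz i (inr (inr e))).
  have iv : inner (v i e) by apply/(inner_v i e2).
  rewrite !g_in//; apply: sub_eq; [exact: G_B|exact: G_B| |].
    rewrite af_uns; last first.
      by move=> _ /mapP[c /(cel_below1 _ e2 ie) h ->]; exact/pieceB/d_piece.
    move=> y [_ /mapP[_ /mapP[c /(cel_below1 _ e2 ie) h ->] ->]].
    have -> := hz i (inl (c, e)) h; have h' := @ok_act i (inl (c, e)) h.
    by move=> dy; apply/GP => //; exists (u i c).
  by rewrite !G_mu// amu//; exact: B2.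
Qed.

End amalgamation.

(** * Rationally independent masses *)

Definition gen (es : seq R) v := exists ws, {subset ws <= es} /\ \sum_(w <- ws) w = v.

Lemma gen_mem es v : v \in es -> gen es v.
Proof.
by move=> h; exists [:: v]; split; [move=> w; rewrite mem_seq1 => /eqP->|rewrite big_seq1].
Qed.

Lemma gen_add es v w : gen es v -> gen es w -> gen es (v + w).
Proof.
move=> [s [hs <-]] [t [ht <-]]; exists (s ++ t); rewrite big_cat; split => // x.
by rewrite mem_cat => /orP[/hs|/ht].
Qed.

Lemma gen_muln es v n : gen es v -> gen es (v *+ n).
Proof.
move=> h; elim: n => [|n IH]; last by rewrite mulrS; exact: gen_add.
by exists [::]; rewrite big_nil.
Qed.

Lemma gen_trans es fs v : {in es, forall e, gen fs e} -> gen es v -> gen fs v.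
Proof.
move=> h [ws [hw <-]]; elim: ws hw => [|w ws IH] hw; first by exists [::].
rewrite big_cons; apply: gen_add; first by apply: h; apply: hw; rewrite mem_head.
by apply: IH => x xs; apply: hw; rewrite inE xs orbT.
Qed.

(** A nonzero v puts 1 = v / v, and with it every natural number, into [V]. *)
Lemma V_divn v n : V v -> V (v / n%:R).
Proof.
move=> Vv; have V0 : V 0 by rewrite -(subrr v); exact: VB.
have [->|v0] := eqVneq v 0; first by rewrite mul0r.
have V1 : V 1 by rewrite -(divff v0); apply: VM => //; exact: VI.
suff Vn : V n%:R by apply: VM => //; exact: VI.
elim: n => // n IH; rewrite (_ : n.+1%:R = n%:R - (0 - 1)); last by rewrite -natr1; ring.
by apply: VB => //; exact: VB.
Qed.

(* If k a < l b, then a and b are natural combinations of a / l and b - k a / l, and the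
   relation loses its coefficient at a. *)
Lemma elim_relation n N (L : seq (R * int)) : size L = n.+1 ->
  {in L, forall p : R * int, V p.1 /\ 0 < p.1} -> \sum_(p <- L) p.2%:~R * p.1 = 0 ->
  (count (fun p : R * int => p.2 != 0%R) L <= N)%N -> has (fun p : R * int => p.2 != 0%R) L ->
  exists es, [/\ size es = n, {in es, forall e, V e /\ 0 < e} & {in L, forall p : R * int, gen es p.1}].
Proof.
elim: N L => [|N IH] L sL hL sum0 cN hN; first by move: hN; rewrite has_count ltnNge cN.
(* All values are positive, so a nontrivial relation has coefficients of both signs. *)
have has_sign (sg : R) : sg != 0 -> (forall p : R * int, p \in L -> 0 <= sg * p.2%:~R) -> False.
  move=> sg0 hp; have /hasP[p pL /negP] := hN; apply.
  have := sum0; rewrite big_seq => /(congr1 (fun u => sg * u)); rewrite mulr0 mulr_sumr => /eqP.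
  rewrite psumr_eq0; last first.
    by move=> q qL; rewrite mulrA mulr_ge0 ?hp// ltW//; case: (hL _ qL).
  move=> /allP /(_ _ pL) /implyP /(_ pL); have [_ p0] := hL _ pL.
  by rewrite !mulf_eq0 (negbTE sg0) (gt_eqF p0) orbF /= intr_eq0.
have [a aL a0] : exists2 a, a \in L & 0 < a.2.
  apply: contrapT => h; apply: (has_sign (-1)); first by rewrite oppr_eq0 oner_eq0.
  move=> p pL; rewrite mulN1r oppr_ge0 -(mulr0z 1) ler_int leNgt.
  by apply/negP => p0; apply: h; exists p.
have [b bL b0] : exists2 b, b \in L & b.2 < 0.
  apply: contrapT => h; apply: (has_sign 1); first by rewrite oner_eq0.
  move=> p pL; rewrite mul1r -(mulr0z 1) ler_int leNgt.
  by apply/negP => p0; apply: h; exists p.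
have ab : b \in rem a L.
  have := perm_to_rem aL; move/perm_mem/(_ b); rewrite bL inE.
  by have [ba|//] := eqVneq b a; move: a0 b0; rewrite ba => /lt_trans h /h; rewrite ltxx.
set L0 := rem b (rem a L).
have pL : perm_eq L (a :: b :: L0).
  by apply: perm_trans (perm_to_rem aL) _; rewrite perm_cons perm_to_rem.
have L0L (p : R * int) : p \in L0 -> p \in L.
  by move=> h; rewrite (perm_mem pL) !inE h !orbT.
have sL0 : size L0 = n.-1 /\ (0 < n)%N.
  have := perm_size pL; rewrite sL /= => -[->]; by [].
have n0 : n = (size L0).+1 by case: sL0 => -> ; case: (n).
rewrite (perm_big _ pL) !big_cons /= in sum0.
have cE : count (fun p : R * int => p.2 != 0%R) L = (count (fun p : R * int => p.2 != 0%R) L0).+2.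
  by have /permP -> := pL; rewrite /= gt_eqF// lt_eqF.
have [Va a1] := hL _ aL; have [Vb b1] := hL _ bL.
pose k := `|a.2|%N; pose l := `|b.2|%N.
have Ek : a.2%:~R = k%:R :> R by rewrite /k -{1}(gtz0_abs a0).
have El : b.2%:~R = - l%:R :> R by rewrite /l -{1}(opprK b.2) -(ltz0_abs b0) mulrNz.
have k0 : (0 : R) < k%:R by rewrite ltr0n /k absz_gt0 gt_eqF.
have l0 : (0 : R) < l%:R by rewrite ltr0n /l absz_gt0 lt_eqF.
rewrite Ek El in sum0.
have genL es : gen es a.1 -> gen es b.1 -> {in L0, forall p : R * int, gen es p.1} -> {in L, forall p : R * int, gen es p.1}.
  by move=> ga gb g0 p; rewrite (perm_mem pL) !inE => /or3P[/eqP->|/eqP->|/g0].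
have eqmul (x y : R) m : x = y *+ m -> forall es, gen es y -> gen es x.
  by move=> -> es; exact: gen_muln.
case: (ltgtP (k%:R * a.1) (l%:R * b.1)) => cmp.
- pose y := a.1 / l%:R; pose b' := b.1 - k%:R * y.
  have y0 : 0 < y by rewrite divr_gt0.
  have Ea : a.1 = y *+ l by rewrite -mulr_natr divfK// gt_eqF.
  have b'0 : 0 < b'.
    rewrite /b' subr_gt0 /y mulrA ltr_pdivrMr// [ltRHS]mulrC//.
  have Vb' : V b'.
    apply: VB => //; rewrite -[X in V X]opprK -[X in V (- X)]sub0r.
    have Vy := V_divn l Va.
    have V0 : V 0 by rewrite -(subrr a.1); exact: VB.
    suff Vky : V (k%:R * y) by rewrite sub0r opprK.
    elim: (k) => [|m IHm]; first by rewrite mul0r.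
    by rewrite -natr1 mulrDl mul1r -[X in _ + X]opprK -[- y]sub0r; apply: VB => //; exact: VB.
  have [||||| es [h1 h2 h3]] := IH ((y, 0%R) :: (b', b.2) :: L0).
  + by rewrite /= n0.
  + move=> p; rewrite !inE => /or3P[/eqP->|/eqP->|/L0L/hL//] //=.
    by split => //; exact: V_divn.
  + rewrite !big_cons /= mul0r add0r El -[RHS]sum0 addrA; congr (_ + _).
    by rewrite /b' Ea; field.
  + by move: cN; rewrite cE ltnS; apply: leq_trans; rewrite /=; case: (_ != 0).
  + by rewrite /= lt_eqF.
  exists es; split => //; apply: genL.
  + apply: (eqmul _ y l) => //; by apply: (h3 (y, 0%R)); rewrite mem_head.
  + rewrite (_ : b.1 = b' + y *+ k); last by rewrite /b' -mulr_natl; ring.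
    apply: gen_add; first by apply: (h3 (b', b.2)); rewrite !inE eqxx orbT.
    by apply: gen_muln; apply: (h3 (y, 0%R)); rewrite mem_head.
  + by move=> p pL0; apply: h3; rewrite !inE pL0 !orbT.
- pose y := b.1 / k%:R; pose a' := a.1 - l%:R * y.
  have y0 : 0 < y by rewrite divr_gt0.
  have Eb : b.1 = y *+ k by rewrite -mulr_natr divfK// gt_eqF.
  have a'0 : 0 < a'.
    rewrite /a' subr_gt0 /y mulrA ltr_pdivrMr// [ltRHS]mulrC//.
  have Va' : V a'.
    apply: VB => //; rewrite -[X in V X]opprK -[X in V (- X)]sub0r.
    have Vy := V_divn k Vb.
    have V0 : V 0 by rewrite -(subrr a.1); exact: VB.
    suff Vky : V (l%:R * y) by rewrite sub0r opprK.
    elim: (l) => [|m IHm]; first by rewrite mul0r.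
    by rewrite -natr1 mulrDl mul1r -[X in _ + X]opprK -[- y]sub0r; apply: VB => //; exact: VB.
  have [||||| es [h1 h2 h3]] := IH ((y, 0%R) :: (a', a.2) :: L0).
  + by rewrite /= n0.
  + move=> p; rewrite !inE => /or3P[/eqP->|/eqP->|/L0L/hL//] //=.
    by split => //; exact: V_divn.
  + rewrite !big_cons /= mul0r add0r Ek -[RHS]sum0 addrA; congr (_ + _).
    by rewrite /a' Eb; field.
  + by move: cN; rewrite cE ltnS; apply: leq_trans; rewrite /=; case: (_ != 0).
  + by rewrite /= gt_eqF.
  exists es; split => //; apply: genL.
  + rewrite (_ : a.1 = a' + y *+ l); last by rewrite /a' -mulr_natl; ring.
    apply: gen_add; first by apply: (h3 (a', a.2)); rewrite !inE eqxx orbT.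
    by apply: gen_muln; apply: (h3 (y, 0%R)); rewrite mem_head.
  + apply: (eqmul _ y k) => //; by apply: (h3 (y, 0%R)); rewrite mem_head.
  + by move=> p pL0; apply: h3; rewrite !inE pL0 !orbT.
(* In case of equality a / l generates both a and b, and the number of values drops at once. *)
- pose y := a.1 / l%:R.
  have y0 : 0 < y by rewrite divr_gt0.
  have Ea : a.1 = y *+ l by rewrite -mulr_natr divfK// gt_eqF.
  have Eb : b.1 = y *+ k.
    rewrite -mulr_natl /y mulrA cmp mulrC mulKf// gt_eqF//.
  exists (y :: map fst L0); split.
  + by rewrite /= size_map n0.
  + move=> e; rewrite inE => /orP[/eqP->|/mapP[p /L0L/hL + ->//]].
    by split => //; exact: V_divn.
  + apply: genL.
    * by apply: (eqmul _ y l) => //; apply: gen_mem; rewrite mem_head.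
    * by apply: (eqmul _ y k) => //; apply: gen_mem; rewrite mem_head.
    * by move=> p pL0; apply: gen_mem; rewrite inE map_f ?orbT.
Qed.

(** Linear independence over the rationals, in terms of natural coefficients: an integral relation
    is a difference of two such sums. *)
Definition indep (es : seq R) := forall c c' : R -> nat,
  \sum_(e <- es) (c e)%:R * e = \sum_(e <- es) (c' e)%:R * e -> {in es, c =1 c'}.

(** As long as there is a relation, [elim_relation] passes to a family with one value less that
    still generates everything. *)
Lemma basis (s : seq R) : {in s, forall v, V v /\ 0 < v} -> exists es,
  [/\ uniq es, {in es, forall e, V e /\ 0 < e}, indep es & {in s, forall v, gen es v}].
Proof.
have [n] := ubnP (size s); elim: n s => // n IH s sn hs.
have [i|] := pselect (indep (undup s)).
  exists (undup s); split => //; first exact: undup_uniq.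
    by move=> v; rewrite mem_undup; exact: hs.
  by move=> v vs; apply: gen_mem; rewrite mem_undup.
move=> /existsNP[c /existsNP[c' /not_implyP[E /existsNP[e0 /not_implyP[e0s /eqP ne]]]]].
pose L := [seq (e, (c e)%:Z - (c' e)%:Z) | e <- undup s].
case: (posnP (size (undup s))) => [/size0nil s0|sz]; first by rewrite s0 in e0s.
have [|||||es [h1 h2 h3]] := @elim_relation (size (undup s)).-1 (size L) L.
- by rewrite size_map prednK.
- by move=> _ /mapP[e + ->]; rewrite mem_undup => /hs.
- rewrite big_map /= (eq_bigr (fun e => (c e)%:R * e - (c' e)%:R * e)); last first.
    by move=> e _; rewrite intrB mulrBl.
  by rewrite sumrB E subrr.
- exact: count_size.
- apply/hasP; exists (e0, (c e0)%:Z - (c' e0)%:Z); first exact: map_f.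
  by rewrite /= subr_eq0 eqz_nat.
have [|//|fs [f1 f2 f3 f4]] := IH es.
  by rewrite h1 -ltnS prednK//; apply: leq_ltn_trans sn; exact: size_undup.
exists fs; split => // v vs; apply: gen_trans f4 _.
by apply: (h3 (v, (c v)%:Z - (c' v)%:Z)); apply: map_f; rewrite mem_undup.
Qed.

(** * Matching cells by counting their types *)

(** Turns an equality of counts into a permutation of q; the automorphism x' of [ext_perm_units]
    arises in this way. *)
Lemma label_bij (T L : eqType) (q : seq T) (l1 l2 : T -> L) : uniq q ->
  perm_eq (map l1 q) (map l2 q) -> exists g : T -> T,
  [/\ {in q, forall a, g a \in q}, {in q, forall a, l2 (g a) = l1 a} & {in q &, injective g}].
Proof.
case: q => [|x0 q0] uq; first by exists id.
set q := x0 :: q0 in uq *; move=> /(perm_iotaP (l1 x0))[Is pI E].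
have sI : size Is = size q by rewrite (perm_size pI) size_iota size_map.
have uI : uniq Is by rewrite (perm_uniq pI) iota_uniq.
pose g a := nth x0 q (nth 0%N Is (index a q)).
have hI a : a \in q -> (nth 0%N Is (index a q) < size q)%N.
  move=> aq; have : nth 0%N Is (index a q) \in Is by rewrite mem_nth// sI index_mem.
  by rewrite (perm_mem pI) mem_iota size_map add0n => /andP[].
exists g; split.
- by move=> a /hI; exact: mem_nth.
- move=> a aq; have := congr1 (fun l => nth (l1 x0) l (index a q)) E.
  rewrite (nth_map x0) ?index_mem// nth_index// => ->.
  rewrite (nth_map 0%N) ?sI ?index_mem// (nth_map x0)//; exact: hI.
- move=> a b aq bq /eqP; rewrite nth_uniq ?hI// nth_uniq ?sI ?index_mem// => /eqP h.
  by rewrite -(nth_index x0 aq) h nth_index.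
Qed.


Lemma count_fibers (T : Type) (o : seq T) (f : T -> nat) (P : pred T) m :
  (forall z : T, (f z <= m)%N) ->
  count P o = (\sum_(j < m.+1) count (fun z : T => (f z == j) && P z) o)%N.
Proof.
move=> hf; elim: o => [|z o IH] /=; first by rewrite big1.
rewrite big_split /= IH; congr (_ + _)%N.
have [Px|_] := boolP (P z); last by rewrite big1// => j _; rewrite andbF.
rewrite (bigD1 (Ordinal (hf z : (f z < m.+1)%N)))//= eqxx big1 ?addn0// => j n.
by rewrite andbT; case: eqP => // E; case/eqP: n; apply: val_inj.
Qed.

(** Equality at the last label m follows from equality at the others, because for each type the
    totals agree. *)
Lemma perm_labels (T L : eqType) (o : seq T) (f1 f2 : T -> nat) (ty : T -> L) m :
  (forall z : T, (f1 z <= m)%N) -> (forall z : T, (f2 z <= m)%N) ->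
  (forall j (t : L), (j < m)%N -> count (fun z : T => (f1 z == j) && (ty z == t)) o =
    count (fun z : T => (f2 z == j) && (ty z == t)) o) ->
  perm_eq [seq (f1 z, ty z) | z <- o] [seq (f2 z, ty z) | z <- o].
Proof.
move=> h1 h2 hc; apply/allP => -[j t] _ /=; apply/eqP; rewrite !count_map.
have E (g : T -> nat) : count (preim (fun z : T => (g z, ty z)) (pred1 (j, t))) o =
    count (fun z : T => (g z == j) && (ty z == t)) o by apply: eq_count.
rewrite !E; case: (ltngtP j m) => jm; first exact: hc.
  have zz (g : T -> nat) : (forall z : T, (g z <= m)%N) -> count (fun z : T => (g z == j) && (ty z == t)) o = 0%N.
    move=> hg; rewrite (eq_count (a2 := pred0)) ?count_pred0// => z /=.
    by rewrite ltn_eqF// (leq_ltn_trans (hg z)).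
  by rewrite !zz.
have := count_fibers o (fun z : T => ty z == t) h1.
rewrite (count_fibers o (fun z : T => ty z == t) h2) !big_ord_recr /= jm.
rewrite (eq_bigr (fun j : 'I_m => count (fun z : T => (f1 z == j) && (ty z == t)) o)).
  by move/addnI.
by move=> i _; rewrite hc.
Qed.

Lemma sum_counts (es : seq R) (l : seq (set Y)) : uniq es -> {in l, forall o, mu o \in es} ->
  \sum_(o <- l) mu o = \sum_(e <- es) (count (fun o => mu o == e) l)%:R * e.
Proof.
move=> ue; elim: l => [|o l IH] h.
  by rewrite big_nil big1_seq// => e _; rewrite mul0r.
rewrite big_cons IH; last by move=> p pl; apply: h; rewrite inE pl orbT.
rewrite [RHS](eq_bigr (fun e => (mu o == e)%:R * e + (count (fun o => mu o == e) l)%:R * e)).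
  rewrite big_split /=; congr (_ + _).
  rewrite (bigD1_seq (mu o)) ?h ?mem_head//= eqxx mul1r.
  by rewrite big1 ?addr0// => e ne; rewrite eq_sym (negbTE ne) mul0r.
by move=> e _; rewrite /= natrD mulrDl.
Qed.

(** [sim] as an equality of values in a type with decidable equality, so that cells of a given type
    can be counted. *)
Definition ty (o : set Y) := (`[< atm o >], mu o).

Lemma ty_sim a b : ty a = ty b -> sim a b.
Proof.
by case=> E m; split => //; split=> /asboolP h; apply/asboolP; rewrite ?E // -E.
Qed.

Lemma sim_ty a b : sim a b -> ty a = ty b.
Proof. by move=> [E h]; rewrite /ty E; congr pair; exact/asbool_equiv_eq. Qed.

Lemma below_atm s a : part s -> atm a -> dec s a -> below s a = [:: a].
Proof.
move=> ps aa da; have [ub _] := below_uniq a ps; have E := dec_E ps da.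
have hin e : e \in below s a -> e = a.
  move=> eb; have [es ea] := (belowP s a e).1 eb; have [_ hp _ _] := ps.
  by have [e0|//] := atm_sub aa ea; have [_ []] := hp _ es.
move: E hin ub; case: (below s a) => [|e [|e' l]].
- rewrite uns_nil => E; case: aa => y _ Ey; have : a y by rewrite Ey.
  by rewrite -E.
- by move=> _ /(_ e); rewrite mem_seq1 eqxx => /(_ isT) ->.
- move=> _ h; rewrite (h e) ?mem_head// (h e') ?inE ?eqxx ?orbT//=.
  by rewrite inE eqxx.
Qed.

(* The masses of the diffuse pieces of s are natural combinations of the rationally
   independent masses es; the units have masses in es. *)
Lemma units_ex s : part s -> exists (es : seq R) (un : set Y -> seq (set Y)),
  [/\ uniq es, indep es,
    {in s, forall a, [/\ uniq (un a), {in un a, forall c, piece c}, djs (un a) & uns (un a) = a]},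
    {in s &, forall a b, sim a b -> map mu (un a) = map mu (un b)} &
    {in s, forall a, (atm a -> un a = [:: a]) /\ (dff a -> {in un a, forall o, mu o \in es})}].
Proof.
move=> ps; have hp : {in s, forall a, piece a} by case: ps.
have [|es [ue he ie ge]] := @basis (map mu s).
  by move=> _ /mapP[a as_ ->]; have pa := hp _ as_; split; [exact/Vmu/pieceB|exact: piece_mu].
have /choice[ws hw] : forall v, exists ws, v \in map mu s -> {subset ws <= es} /\ \sum_(w <- ws) w = v.
  move=> v; have [|] := boolP (v \in map mu s); last by exists [::].
  by move=> /ge[ws h]; exists ws.
pose W a := if pselect (atm a) then [:: mu a] else ws (mu a).
have Wa a : atm a -> W a = [:: mu a] by rewrite /W; case: pselect.
have Wd a : ~ atm a -> W a = ws (mu a) by rewrite /W; case: pselect.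
have /choice[un hun] : forall a, exists ds, a \in s ->
    [/\ uniq ds, {in ds, forall c, piece c}, djs ds, uns ds = a & map mu ds = W a].
  move=> a; have [as_|] := boolP (a \in s); last by exists [::].
  have pa := hp _ as_; have [aa|na] := pselect (atm a).
    have [|||ds h] := @split_piece a (W a) pa; rewrite ?Wa//; last by exists ds; rewrite -Wa.
      by move=> w; rewrite mem_seq1 => /eqP->; split; [exact/Vmu/pieceB|exact: piece_mu].
    by rewrite big_seq1.
  have [hs hsum] := hw _ (map_f mu as_).
  have [|||ds h] := @split_piece a (W a) pa; rewrite ?Wd//; last by exists ds; rewrite -Wd.
  by move=> w /hs /he.
exists es, un; split => //.
- by move=> a as_; have [] := hun _ as_.
- move=> a b as_ bs sab; have [_ _ _ _ ->] := hun _ as_; have [_ _ _ _ ->] := hun _ bs.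
  have [E h] := sab; rewrite /W E; case: pselect => x1; case: pselect => x2 //.
    by case: x2; apply/h.
  by case: x1; apply/h.
- move=> a as_; have [_ _ _ Eu Em] := hun _ as_; split.
    move=> aa; move: Em Eu; rewrite Wa//; case: (un a) => [|d [|]]//= _.
    by rewrite uns_cons uns_nil setU0 => ->.
  move=> da o qu; have [hs _] := hw _ (map_f mu as_); apply: hs.
  by rewrite -Wd -?Em ?map_f// => /atm_dff.
Qed.

(** * Permutations of units *)

Section units.
Variables (I : Type) (u : I -> aut) (s : seq (set Y)).
Hypotheses (ps : part s) (hu : forall i, inv (u i) s).
Variables (es : seq R) (un : set Y -> seq (set Y)).
Hypotheses (ues : uniq es) (ies : indep es).
Hypothesis unitP : {in s, forall a,
  [/\ uniq (un a), {in un a, forall c, piece c}, djs (un a) & uns (un a) = a]}.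
Hypothesis unit_sim : {in s &, forall a b, sim a b -> map mu (un a) = map mu (un b)}.
Hypothesis unit_val :
  {in s, forall a, (atm a -> un a = [:: a]) /\ (dff a -> {in un a, forall e, mu e \in es})}.

Let unit_un a : a \in s -> uniq (un a). Proof. by move=> /unitP[]. Qed.
Let unit_pc a o : a \in s -> o \in un a -> piece o.
Proof. by move=> /unitP[_ + _ _]; exact. Qed.
Let unit_dj a : a \in s -> djs (un a). Proof. by move=> /unitP[]. Qed.
Let unit_cov a : a \in s -> uns (un a) = a. Proof. by move=> /unitP[]. Qed.
Let unit_atm a : a \in s -> atm a -> un a = [:: a]. Proof. by move=> /unit_val[]. Qed.
Let unit_es a o : a \in s -> dff a -> o \in un a -> mu o \in es.
Proof. by move=> /unit_val[_ k] /k; exact. Qed.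
Let unit_sub a o : a \in s -> o \in un a -> o `<=` a.
Proof. by move=> as_ /sub_uns; rewrite unit_cov. Qed.

Let s2 := undup (flatten (map un s)).
Let s2P o : o \in s2 <-> exists2 a, a \in s & o \in un a.
Proof.
rewrite mem_undup; split=> [/flattenP[_ /mapP[a as_ ->]] ?|[a as_ h]]; first by exists a.
by apply/flattenP; exists (un a) => //; exact: map_f.
Qed.

Let uq a b o : a \in s -> b \in s -> o \in un a -> o `<=` b -> a = b.
Proof.
move=> as_ bs qa qb; apply: contrapT; have [_ _ ds _] := ps.
move=> /(ds _ _ as_ bs) h; apply: (piece_dj (unit_pc as_ qa) _ (djS h (unit_sub as_ qa) (@subset_refl _ b))).
exact: qb.
Qed.

Let part_s2 : part s2.
Proof.
have [_ _ ds xs] := ps; split; first exact: undup_uniq.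
- by move=> o /s2P[a as_]; exact: unit_pc.
- move=> o o' /s2P[a as_ qa] /s2P[b bs qb] n.
  have [E|nab] := pselect (a = b); first by rewrite -E in qb; exact: (unit_dj as_ qa qb n).
  by apply: (djS (ds _ _ as_ bs nab)); exact: unit_sub.
- move=> y /xs[a as_]; rewrite -{1}(unit_cov as_) => -[ o qa qy]; exists o => //.
  by apply/s2P; exists a.
Qed.

Let ref_s2 : ref s2 s.
Proof.
move=> a as_; split.
  move=> y; rewrite -{1}(unit_cov as_) => -[ o qa qy]; exists o => //.
  by apply/s2P; exists a.
move=> o /s2P[b bs qb]; have [E|n] := pselect (b = a); first by left; rewrite -E; exact: unit_sub.
by right; have [_ _ ds _] := ps; apply: (djS (ds _ _ bs as_ n)); first exact: unit_sub.
Qed.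

(** Similar cells have units with the same list of masses, so the k-th unit of a can be sent to the
    k-th unit of [u i a]. *)
Let v_ex i : exists v : aut, inv v s2 /\ eqon (u i) v s.
Proof.
have Bs := part_B ps.
have /choice[par hpar] : forall o, exists a, o \in s2 -> a \in s /\ o \in un a.
  move=> o; have [|] := boolP (o \in s2); last by exists set0.
  by move=> /s2P[a ? ?]; exists a.
pose g o := nth set0 (un (u i (par o))) (index o (un (par o))).
have par_sim o : o \in s2 -> map mu (un (par o)) = map mu (un (u i (par o))).
  by move=> /hpar[as_ _]; apply: unit_sim => //; [exact: hu|exact/aut_sim/Bs].
have hidx o : o \in s2 -> (index o (un (par o)) < size (un (u i (par o))))%N.
  move=> q2; rewrite -(size_map mu) -par_sim// size_map index_mem.
  by have [] := hpar _ q2.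
have g_in o : o \in s2 -> g o \in un (u i (par o)) by move=> /hidx; exact: mem_nth.
have g2 o : o \in s2 -> g o \in s2.
  move=> q2; apply/s2P; exists (u i (par o)); last exact: g_in.
  by apply: hu; have [] := hpar _ q2.
have [||v hv] := @extend_part s2 g part_s2.
- move=> o q2; have [as_ qa] := hpar _ q2; have us_ := hu i as_.
  split; first exact: unit_pc us_ (g_in _ q2).
  have pp := unit_pc as_ qa; have pg := unit_pc us_ (g_in _ q2).
  split.
    have := congr1 (fun l => nth 0 l (index o (un (par o)))) (par_sim _ q2).
    by rewrite (nth_map set0) ?index_mem// (nth_map set0) ?hidx// nth_index.
  have pS : {in s, forall a, piece a} by case: ps.
  have [_ k1] := @piece_sub (par o) o (pS _ as_) (pieceB pp) (piece_neq0 pp) (unit_sub as_ qa).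
  have [_ k2] := @piece_sub (u i (par o)) (g o) (pS _ us_) (pieceB pg) (piece_neq0 pg) (unit_sub us_ (g_in _ q2)).
  by rewrite k1 k2; exact/aut_atmE/Bs.
- move=> o o' q2 q2' n; have [as_ qa] := hpar _ q2; have [as_' qa'] := hpar _ q2'.
  have [E|npar] := pselect (par o = par o'); last first.
    have nu : u i (par o) <> u i (par o') by move/af_inj => h; apply: npar; apply: h; exact: Bs.
    have [_ _ ds _] := ps; apply: (djS (ds _ _ (hu i as_) (hu i as_') nu)).
      exact: unit_sub (hu i as_) (g_in _ q2).
    exact: unit_sub (hu i as_') (g_in _ q2').
  apply: (unit_dj (hu i as_)); [exact: g_in|by rewrite E; exact: g_in|].
  move/eqP; rewrite /g E nth_uniq ?unit_un ?hu//; [|by rewrite -E; exact: hidx|exact: hidx].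
  rewrite -E => /eqP h; apply: n; rewrite -(nth_index set0 qa) h nth_index// E.
  by rewrite -E in qa' *.
exists v; split; first by move=> o q2; rewrite hv//; exact: g2.
move=> a as_; apply/esym; apply: sub_eq; [exact: Bs|exact/afB/Bs| |by rewrite amu//; exact: Bs].
rewrite -{1}(unit_cov as_) af_uns; last by move=> o /(unit_pc as_)[].
move=> y [_ /mapP[ o qa ->]]; have q2 : o \in s2 by apply/s2P; exists a.
rewrite hv//; have [ps_ qp] := hpar _ q2.
rewrite -(uq ps_ as_ qp (unit_sub as_ qa)); exact: (unit_sub (hu i ps_) (g_in _ q2)).
Qed.

(** Independence enters here: the units below a and those below b have the same total mass, so each
    mass of [es] occurs equally often in both. *)
Let count_types a b (t : bool * R) : piece a -> piece b -> dec s2 a -> dec s2 b -> sim a b ->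
  count (fun o => ty o == t) (below s2 a) = count (fun o => ty o == t) (below s2 b).
Proof.
have h2 : {in s2, forall o, piece o} by case: part_s2.
move=> pa pb da db sab; case: (pa) => _ _ [aa|dfa].
  have ab : atm b by case: sab => _ [+ _]; exact.
  by rewrite !below_atm//= (sim_ty sab).
have dfb : dff b by case: (pb) => _ _ [ab|//]; case: sab => _ [_ /(_ ab) /atm_dff]; case.
have inE_ c o : dff c -> o \in below s2 c -> ~ atm o /\ mu o \in es.
  move=> dc /belowP[q2 qc]; have dq := dffS dc qc; split; first by move/atm_dff; exact.
  have [a' as_ qa] := (s2P o).1 q2; apply: unit_es (as_) _ (qa).
  case: ps => _ /(_ _ as_) pa' _ _; case: (pa') => _ _ [aa'|//].
  move: (qa); rewrite (unit_atm as_ aa') mem_seq1 => /eqP E; rewrite E in dq; exact: dq.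
have cE c : dff c -> count (fun o => ty o == t) (below s2 c) =
    if t.1 then 0%N else count (fun o => mu o == t.2) (below s2 c).
  move=> dc; case: t => -[] w /=.
    rewrite (eq_in_count (a2 := pred0)) ?count_pred0// => o /(inE_ _ _ dc)[na _] /=.
    by apply/negP => /eqP[/asboolP].
  apply: eq_in_count => o /(inE_ _ _ dc)[na _]; rewrite /ty /=.
  by rewrite xpair_eqE (asboolF na) eqxx.
rewrite !cE//; case: t.1 => //.
have [te|nte] := boolP (t.2 \in es); last first.
  rewrite !(eq_in_count (a2 := pred0)) ?count_pred0// => o /inE_ /= h; apply/negP => /eqP E;
    by [have [_] := h dfb; rewrite E (negbTE nte)|have [_] := h dfa; rewrite E (negbTE nte)].
apply: (ies (c := fun e => count (fun o => mu o == e) (below s2 a))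
  (c' := fun e => count (fun o => mu o == e) (below s2 b))) => //.
rewrite -!sum_counts//; first by rewrite -!mu_dec//; case: sab.
  by move=> o /(inE_ _ _ dfb)[].
by move=> o /(inE_ _ _ dfa)[].
Qed.

(** For a in [al], the units below a and those below [x a] have the same types in the same numbers.
    Bijections between them, completed on the remaining units, make up the permutation x'. *)
Lemma ext_perm_units x (al : seq (set Y)) : uniq al -> djs al -> {in al, forall a, piece a} ->
  {in al, forall a, dec s a /\ dec s (x a)} ->
  exists (v : I -> aut) s' x', [/\ part s', ref s' s,
    forall i, inv (v i) s' /\ eqon (u i) (v i) s, inv x' s' & {in al, forall a, x' a = x a}].
Proof.
move=> ual dal pal hal; have /choice[v hv] := v_ex.
have Bal a : a \in al -> B a by move=> /pal[].
exists v, s2.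
(* The default value [size l] collects the units outside l; it is the last label of
   [perm_labels]. *)
pose f (l : seq (set Y)) o := find (fun a => `[< o `<=` a >]) l.
have fE l j o : uniq l -> djs l -> {in l, forall a, piece a} -> {in l, forall a, dec s2 a} ->
    o \in s2 -> (j < size l)%N -> (f l o == j) = `[< o `<=` nth set0 l j >].
  move=> ul dl pl hl q2 jl; have pq : piece o by case: part_s2 => _ + _ _; exact.
  apply/eqP/asboolP => [E|h].
    apply/asboolP; rewrite -E; apply: (nth_find set0 (a := fun a => `[< o `<=` a >])).
    by rewrite has_find -/(f l o) E.
  apply: contrapT => /eqP; rewrite neq_ltn => /orP[lt|lt].
    have hs : has (fun a => `[< o `<=` a >]) l by rewrite has_find (ltn_trans lt).
    have /asboolP h' := nth_find set0 hs; rewrite -/(f l o) in h'.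
    have n : nth set0 l (f l o) <> nth set0 l j.
      by move/eqP; rewrite nth_uniq ?(ltn_trans lt)// ltn_eqF.
    have dd := dl _ _ (mem_nth set0 (ltn_trans lt jl)) (mem_nth set0 jl) n.
    apply: (piece_dj pq h'); apply: djC; exact: (djS dd (@subset_refl _ _) h).
  by have := before_find set0 lt; move/asboolP; apply.
have hsz l o : (f l o <= size l)%N by exact: find_size.
have pal' : {in map x al, forall a, piece a} by move=> _ /mapP[a /pal pa ->]; exact: aut_piece.
have ual' : uniq (map x al).
  by rewrite map_inj_in_uniq// => a b /Bal ? /Bal ?; exact: af_inj.
have dal' : djs (map x al).
  move=> _ _ /mapP[a aal ->] /mapP[b bal ->] n; apply: af_dj; [exact: Bal|exact: Bal|].
  by apply: dal => // E; apply: n; rewrite E.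
have hd : {in al, forall a, dec s2 a} by move=> a /hal[h _]; exact: dec_trans ref_s2 h.
have hd' : {in map x al, forall a, dec s2 a}.
  by move=> _ /mapP[a /hal[_ h] ->]; exact: dec_trans ref_s2 h.
have us2 : uniq s2 by exact: undup_uniq.
have cnt l j (t : bool * R) : uniq l -> djs l -> {in l, forall a, piece a} -> {in l, forall a, dec s2 a} ->
    (j < size l)%N -> count (fun o => (f l o == j) && (ty o == t)) s2 =
    count (fun o => ty o == t) (below s2 (nth set0 l j)).
  move=> ul dl pl hl jl; rewrite /below count_filter; apply: eq_in_count => o q2 /=.
  by rewrite fE// andbC.
have [|g [g2 gl gi]] := @label_bij _ _ s2 (fun o => (f al o, ty o)) (fun o => (f (map x al) o, ty o)) us2.
  apply: (@perm_labels _ _ _ _ _ _ (size al)).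
  - by move=> o; exact: hsz.
  - by move=> o; rewrite -(size_map x); exact: hsz.
  move=> j t jal; have jal' : (j < size (map x al))%N by rewrite size_map.
  rewrite !cnt// (nth_map set0)//.
  have aj := mem_nth set0 jal; have [d1 d2] := hal _ aj; have pj := pal _ aj.
  apply: count_types => //; [exact: aut_piece|exact: hd| |exact/aut_sim/Bal].
  exact: dec_trans ref_s2 d2.
have h2 : {in s2, forall o, piece o} by case: part_s2.
have [||x' hx'] := @extend_part s2 g part_s2.
- move=> o q2; split; first exact/h2/g2.
  exact/ty_sim/esym/(congr1 snd (gl _ q2)).
- move=> o o' q2 q2' n; have [_ _ d2 _] := part_s2; apply: d2; [exact: g2|exact: g2|].
  by move=> /(gi _ _ q2 q2').
exists x'; split; [exact: part_s2|exact: ref_s2|exact: hv| |].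
  by move=> o q2; rewrite hx'//; exact: g2.
move=> a aal; have Ba := Bal _ aal; have [k jal ->] : exists2 j, (j < size al)%N & a = nth set0 al j.
  by exists (index a al); rewrite ?index_mem// nth_index.
have aj := mem_nth set0 jal; have Bj := Bal _ aj.
apply: sub_eq => //; [exact: afB| |by rewrite amu].
rewrite -{1}(dec_E part_s2 (hd _ aj)) af_uns; last exact: below_B part_s2.
move=> y [_ /mapP[ o /belowP[q2 qa] ->]]; rewrite hx'//.
have : f (map x al) (g o) == k.
  by have /= -> := congr1 fst (gl _ q2); rewrite fE//; exact/asboolP.
rewrite fE ?size_map//; last exact: g2.
by rewrite (nth_map set0)// => /asboolP; exact.
Qed.

End units.

(** A finite partial automorphism becomes a permutation of a finer partition, while maps that agree
    with [u] on s permute that partition too. This replaces arbitrary partial maps by finite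
    structures. *)
Lemma ext_perm (I : Type) (u : I -> aut) s x (al : seq (set Y)) :
  part s -> (forall i, inv (u i) s) ->
  uniq al -> djs al -> {in al, forall a, piece a} ->
  {in al, forall a, dec s a /\ dec s (x a)} ->
  exists (v : I -> aut) s' x', [/\ part s', ref s' s,
    forall i, inv (v i) s' /\ eqon (u i) (v i) s, inv x' s' & {in al, forall a, x' a = x a}].
Proof.
move=> ps hu h1 h2 h3 h4; have [es [un [k1 k2 k3 k4 k5]]] := units_ex ps.
exact: (ext_perm_units ps hu k1 k2 k3 k4 k5 h1 h2 h3 h4).
Qed.

Lemma fix_dec f s b : part s -> {in s, forall a, f a = a} -> dec s b -> f b = b.
Proof. by move=> ps h; exact: (@eqon_dec f aone s b). Qed.

Lemma fix_ag f b : B b -> f b = b -> ag f b = b.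
Proof. by move=> Bb {1}<-; rewrite afK. Qed.

(** * Generic tuples *)

Definition acj f x := amul f (amul x (ainv f)).

Lemma eqon_ref x (z : aut) s s' : part s' -> ref s' s -> eqon x z s' -> eqon x z s.
Proof. by move=> ps' rs e a /rs; exact: eqon_dec. Qed.

(** The inverses have to converge as well, since a pointwise limit of automorphisms may fail to be
    onto. *)
Lemma limit_aut (fk : nat -> aut) :
  (forall b, B b -> exists k, forall l, (k <= l)%N -> fk l b = fk k b /\ ag (fk l) b = ag (fk k) b) ->
  exists f : aut, forall b, B b -> exists k, forall l, (k <= l)%N -> fk l b = f b /\ ag (fk l) b = ag f b.
Proof.
move=> h; have /choice[n hn] : forall b, exists k, B b ->
    forall l, (k <= l)%N -> fk l b = fk k b /\ ag (fk l) b = ag (fk k) b.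
  move=> b; have [/h[k hk]|] := pselect (B b); first by exists k.
  by exists 0%N.
pose f b := fk (n b) b; pose g b := ag (fk (n b)) b.
have fE b l : B b -> (n b <= l)%N -> fk l b = f b by move=> Bb /(hn _ Bb)[].
have gE b l : B b -> (n b <= l)%N -> ag (fk l) b = g b by move=> Bb /(hn _ Bb)[].
have fB b : B b -> B (f b) by exact: afB.
have gB b : B b -> B (g b) by exact: agB.
have fK b : B b -> g (f b) = b.
  move=> Bb; pose l := maxn (n b) (n (f b)).
  rewrite -(gE _ l (fB _ Bb)) ?leq_maxr// -(fE _ l Bb) ?leq_maxl//.
  by rewrite afK.
have gK b : B b -> f (g b) = b.
  move=> Bb; pose l := maxn (n b) (n (g b)).
  rewrite -(fE _ l (gB _ Bb)) ?leq_maxr// -(gE _ l Bb) ?leq_maxl//.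
  by rewrite agK.
have fD a b : B a -> B b -> f (a `\` b) = f a `\` f b.
  move=> Ba Bb; pose l := maxn (n (a `\` b)) (maxn (n a) (n b)).
  have l1 : (n a <= l)%N by rewrite !leq_max leqnn !orbT.
  have l2 : (n b <= l)%N by rewrite !leq_max leqnn !orbT.
  by rewrite -(fE _ l (BD Ba Bb)) ?leq_maxl// -(fE _ l Ba)// -(fE _ l Bb)// afD.
have fm b : B b -> mu (f b) = mu b by move=> Bb; rewrite /f amu.
exists (RingAut fB gB fK gK fD fm) => b Bb; exists (n b) => l nl /=.
by rewrite fE// gE.
Qed.

Definition LF (I : Type) (u : I -> aut) := forall b, B b ->
  exists s, [/\ part s, dec s b & forall i, inv (u i) s].

Definition EP (I : Type) (u : I -> aut) := forall s v s2, part s -> part s2 -> ref s2 s ->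
  (forall i, [/\ inv (u i) s, inv (v i) s2 & eqon (u i) (v i) s]) ->
  exists f, {in s, forall a, f a = a} /\ forall i, {in s2, forall e, f (v i e) = u i (f e)}.

(* Generic tuples: LF is local finiteness, EP the extension property characterizing the
   Fraisse limit of finite structures with partial automorphisms. *)
Definition Gen (I : Type) (u : I -> aut) := LF u /\ EP u.

Definition snoc (I : Type) (u : I -> aut) x (o : option I) := if o is Some i then u i else x.

(** A basic open set is given by an automorphism S and a partition D and consists of the x that
    agree with S on D. The condition says that O contains a dense open set; O itself may fail to be
    open. *)
Definition dopen (O : set aut) := forall S D, part D -> exists S' D',
  [/\ part D', ref D' D, eqon S' S D & forall x, eqon x S' D' -> O x].

Lemma LF_decs (I : Type) (u : I -> aut) (l : seq (set Y)) : LF u -> {in l, forall b, B b} ->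
  exists s, [/\ part s, {in l, forall b, dec s b} & forall i, inv (u i) s].
Proof.
move=> lf; elim: l => [|b l IH] h; first by have [s [ps _ hs]] := lf _ B0; exists s.
have [|s [ps hs is_]] := IH; first by move=> c cl; apply: h; rewrite inE cl orbT.
have [t [pt ht it_]] := lf _ (h _ (mem_head _ _)).
have [_ _ ds _] := ps; have [_ _ dt _] := pt; have [r1 r2] := join_dec ds dt.
exists (join s t); split; first exact: join_part.
  by move=> c; rewrite inE => /orP[/eqP->|/hs]; [exact: dec_trans r2 ht|exact: dec_trans].
by move=> i; exact: join_inv.
Qed.

(** By [ext_perm] some x' extending S on D permutes a finer partition s', together with maps v that
    agree with [u] on s. [EP] finds a copy of v inside [u], and the same conjugation turns x' into
    S'. *)
Lemma gen_sat (I : Type) (u : I -> aut) (l : seq (set Y)) S D : Gen u -> part D -> {in l, forall b, B b} ->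
  exists S' D', [/\ part D', ref D' D, eqon S' S D, {in l, forall b, dec D' b} &
    forall o, inv (snoc u S' o) D'].
Proof.
move=> [lf ep] pD hl; have BD_ := part_B pD; have [uD hD dD _] := pD.
have [|s [ps ds is_]] := @LF_decs I u (D ++ map S D ++ l) lf.
  move=> b; rewrite !mem_cat => /or3P[/BD_//|/mapP[a /BD_ ? ->]|/hl//]; exact: afB.
have dsD a : a \in D -> dec s a by move=> aD; apply: ds; rewrite mem_cat aD.
have dsS a : a \in D -> dec s (S a) by move=> aD; apply: ds; rewrite !mem_cat map_f ?orbT.
have [|v [s' [x' [ps' rs' hv ix ex]]]] := ext_perm (x := S) ps is_ uD dD hD.
  by move=> a aD; split; [exact: dsD|exact: dsS].
have [|f [ff fc]] := ep s v s' ps ps' rs'.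
  by move=> i; have [? ?] := hv i; split => //; exact: is_.
have Bs' := part_B ps'.
have dmap b : dec s b -> dec (map f s') b.
  move=> db; rewrite -(fix_dec ps ff db); apply: dec_map => //; exact: dec_trans rs' db.
exists (acj f x'), (map f s'); split.
- exact: part_map.
- by move=> a /dsD; exact: dmap.
- move=> a aD; rewrite /= (fix_ag (BD_ _ aD) (fix_dec ps ff (dsD _ aD))) ex//.
  exact: fix_dec ps ff (dsS _ aD).
- by move=> b bl; apply: dmap; apply: ds; rewrite !mem_cat bl !orbT.
- move=> [i|] _ /mapP[e es ->] /=.
    by rewrite -fc// map_f//; have [-> //] := hv i.
  by rewrite afK ?map_f ?ix//; exact: Bs'.
Qed.

Lemma eqon_map x (z : aut) l : map x l = map z l -> eqon x z l.
Proof. by move/eq_in_map. Qed.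

Lemma eqon_sym x z s : eqon x z s -> eqon z x s.
Proof. by move=> h a /h. Qed.

Lemma eqon_trans x (y z : aut) s : eqon x y s -> eqon y z s -> eqon x z s.
Proof. by move=> h k a as_; rewrite h// k. Qed.

Lemma inv_eqon x z s : eqon x z s -> inv x s -> inv z s.
Proof. by move=> e h a as_; rewrite -e// h. Qed.

(** If S1 fits the problem (s2, v) over s, the structure of S1 on D1 is amalgamated with it, [EP]
    places the amalgam inside [u], and conjugation gives S'. If S1 does not fit, no x close to it
    does, and there is nothing to solve. *)
Lemma dopen_ext (I : Type) (u : I -> aut) s s2 (v : option I -> aut) : Gen u ->
  part s -> part s2 -> ref s2 s -> (forall o, inv (v o) s2) ->
  dopen [set x | (forall o, inv (snoc u x o) s /\ eqon (snoc u x o) (v o) s) ->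
    exists f, {in s, forall a, f a = a} /\
      forall o, {in s2, forall e, f (v o e) = snoc u x o (f e)}].
Proof.
move=> gu ps ps2 rs2 iv S D pD; have [_ ep] := gu.
have [S1 [D1 [pD1 rD1 eS1 dD1 iD1]]] := gen_sat S gu pD (part_B ps).
have eqs x : eqon x S1 D1 -> forall o, eqon (snoc u x o) (snoc u S1 o) s.
  by move=> e [i|] a as_ //=; exact: eqon_dec pD1 e (dD1 _ as_).
have [c|nc] := pselect (forall o, inv (snoc u S1 o) s /\ eqon (snoc u S1 o) (v o) s); last first.
  exists S1, D1; split => // x ex h; case: nc => o; have [h1 h2] := h o; split.
    exact: inv_eqon (eqs _ ex o) h1.
  by apply: eqon_trans h2; exact/eqon_sym/eqs.
have [|f [z [ff z1 z2]]] := amalg (u := snoc u S1) ps pD1 ps2 dD1 rs2 (v := v).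
  by move=> o; have [? ?] := c o; split.
have iz o : inv (z o) D1 by apply: inv_eqon (iD1 o) => a /(z1 o) ->.
have iz2 o : inv (z o) (map f s2) by move=> _ /mapP[e es ->]; rewrite z2// map_f ?iv.
have pf2 := part_map f ps2.
have pt := join_part pD1 pf2; set t := join D1 (map f s2) in pt *.
have [_ _ dj1 _] := pD1; have [_ _ dj2 _] := pf2.
have [r1 r2] := join_dec dj1 dj2; rewrite -/t in r1 r2.
have itz o : inv (z o) t by exact: join_inv.
have [|g [gf gc]] := ep D1 (fun i => z (Some i)) t pD1 pt r1.
  by move=> i; split; [exact: (iD1 (Some i))|exact: itz|move=> a /(z1 (Some i)) ->].
have Bt := part_B pt; have Bs := part_B ps; have B1 := part_B pD1; have B2 := part_B ps2.
have BD_ := part_B pD.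
have S'1 : eqon (acj g (z None)) S1 D1.
  move=> a a1; rewrite /= (fix_ag (B1 _ a1) (gf _ a1)) (z1 None)//= gf//.
  exact: (iD1 None).
have rD' : ref (map g t) D1.
  by move=> a a1; rewrite -(gf _ a1); apply: dec_map => //; exact: r1.
exists (acj g (z None)), (map g t); split.
- exact: part_map.
- exact: ref_trans rD' rD1.
- by apply: eqon_trans eS1; exact: eqon_ref S'1.
- move=> x ex _; exists (amul g f); split.
    by move=> a as_ /=; rewrite ff//; exact: fix_dec pD1 gf (dD1 _ as_).
  move=> o e es /=.
  have dfe : dec t (f e) by apply: r2; exact: map_f.
  rewrite -z2//; case: o => [i|] /=.
    have k : eqon (amul g (z (Some i))) (amul (u i) g) t by move=> a at_ /=; rewrite gc.
    exact: (eqon_dec pt k dfe).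
  have dg := dec_map g pt dfe.
  rewrite (eqon_dec (part_map g pt) ex dg) /= afK//.
  exact/afB/B2.
Qed.

(** An extension problem is determined by s, s2 and the values of v on s2, hence by finitely many
    indices in the enumeration [E]. So there are countably many problems, each of them solved on a
    dense open set. *)
Lemma gen_comeager (I : finType) (u : I -> aut) : Gen u -> exists O : nat -> set aut,
  (forall k, dopen (O k)) /\ forall x, (forall k, O k x) -> Gen (snoc u x).
Proof.
move=> gu; have [E [BE EB]] := r_E H.
have code (l : seq (set Y)) : {in l, forall b, B b} -> exists ns, l = map E ns.
  elim: l => [|b l IH] h; first by exists [::].
  have [|ns ->] := IH; first by move=> c cl; apply: h; rewrite inE cl orbT.
  have [n En] := EB _ (h _ (mem_head _ _)); by exists (n :: ns); rewrite /= En.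
pose T : countType := (nat + (seq nat * seq nat * {ffun option I -> seq nat}))%type.
pose O1 n : set aut := [set x | exists s, [/\ part s, dec s (E n) & forall o, inv (snoc u x o) s]].
pose O2 (c : seq nat * seq nat * {ffun option I -> seq nat}) : set aut :=
  [set x | forall s s2 (v : option I -> aut), s = map E c.1.1 -> s2 = map E c.1.2 ->
    (forall o, map (v o) s2 = map E (c.2 o)) -> part s -> part s2 -> ref s2 s ->
    (forall o, [/\ inv (snoc u x o) s, inv (v o) s2 & eqon (snoc u x o) (v o) s]) ->
    exists f, {in s, forall a, f a = a} /\
      forall o, {in s2, forall e, f (v o e) = snoc u x o (f e)}].
have triv : dopen setT.
  by move=> S D pD; exists S, D; split => //; exact: ref_refl.
have d1 n : dopen (O1 n).
  move=> S D pD; have [|S' [D' [p' r' e' d' i']]] := @gen_sat _ _ [:: E n] S D gu pD.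
    by move=> b; rewrite mem_seq1 => /eqP->.
  exists S', D'; split => // x ex; exists D'; split => //; first by apply: d'; rewrite mem_head.
  move=> [i|]; first exact: (i' (Some i)).
  exact: inv_eqon (eqon_sym ex) (i' None).
have d2 c : dopen (O2 c).
  set s := map E c.1.1; set s2 := map E c.1.2.
  have [[v [ps ps2 rs hv ev]]|nv] := pselect (exists v : option I -> aut,
      [/\ part s, part s2, ref s2 s, forall o, inv (v o) s2 & forall o, map (v o) s2 = map E (c.2 o)]).
    move=> S D pD; have [S' [D' [p' r' e' h']]] := dopen_ext gu ps ps2 rs hv S pD.
    exists S', D'; split => // x /h' hx _ _ w -> -> ew _ _ _ hw.
    have vw o : eqon (w o) (v o) s2 by apply: eqon_map; rewrite ev ew.
    have [|f [f1 f2]] := hx.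
      move=> o; have [k1 _ k3] := hw o; split => //; apply: eqon_trans k3 _.
      exact: eqon_ref ps2 rs (vw o).
    by exists f; split => // o e es; rewrite vw// f2.
  move=> S D pD; exists S, D; split => //; first exact: ref_refl.
  move=> x _ _ _ w -> -> ew ps ps2 rs hw; case: nv; exists w; split => // o.
  by have [] := hw o.
exists (fun k => if unpickle k is Some c then
  match (c : T) with inl n => O1 n | inr c' => O2 c' end else setT); split.
  by move=> k; case: unpickle => // -[n|c]; [exact: d1|exact: d2].
move=> x hx; split.
  move=> b /EB[n <-]; have := hx (pickle (inl n : T)).
  by rewrite pickleK.
move=> s v s2 ps ps2 rs hv.
have [n1 E1] := code _ (part_B ps); have [n2 E2] := code _ (part_B ps2).
have /choice[lf hlf] : forall o, exists l, map (v o) s2 = map E l.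
  move=> o; apply: code => _ /mapP[e es ->]; exact/afB/(part_B ps2).
have := hx (pickle (inr (n1, n2, [ffun o => lf o]) : T)); rewrite pickleK.
move=> /(_ s s2 v); apply => //= o; by rewrite ffunE.
Qed.

(** [EP] for [u] is applied to the structure of v transported by f, on the common refinement of s
    and an invariant partition that decides b. *)
Lemma back_forth_step (I : Type) (u v : I -> aut) f s b : LF v -> EP u -> part s ->
  (forall i, inv (v i) s) -> (forall i, {in s, forall e, f (v i e) = u i (f e)}) -> B b ->
  exists f' s', [/\ part s', ref s' s /\ dec s' b, forall i, inv (v i) s', eqon f' f s &
    forall i, {in s', forall e, f' (v i e) = u i (f' e)}].
Proof.
move=> lf ep ps is_ hc Bb; have [t [pt dt it_]] := lf _ Bb.
have [_ _ d1 _] := ps; have [_ _ d2 _] := pt.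
have [r1 r2] := join_dec d1 d2; have pj := join_part ps pt.
have ij i : inv (v i) (join s t) by exact: join_inv.
have Bj := part_B pj; have Bs := part_B ps.
have [|||i|g [gf gc]] := ep (map f s) (fun i => acj f (v i)) (map f (join s t)).
- exact: part_map.
- exact: part_map.
- by move=> _ /mapP[a as_ ->]; apply: dec_map => //; exact: r1.
- split.
  + by move=> _ /mapP[a as_ ->]; rewrite -hc// map_f// is_.
  + by move=> _ /mapP[a as_ ->] /=; rewrite afK ?map_f ?ij//; exact: Bj.
  + by move=> _ /mapP[a as_ ->] /=; rewrite afK ?hc//; exact: Bs.
exists (amul g f), (join s t); split => //.
- by split => //; exact: dec_trans r2 dt.
- by move=> a as_ /=; rewrite gf// map_f.
- move=> i e es /=; rewrite -gc ?map_f//= afK//; exact: Bj.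
Qed.

(** Uniqueness of the generic structure over s. The backward half of each stage is the forward step
    for the inverse map, with the two tuples exchanged. *)
Lemma gen_conj (I : Type) (u v : I -> aut) s : Gen u -> Gen v -> part s ->
  (forall i, inv (v i) s /\ eqon (v i) (u i) s) ->
  exists f, {in s, forall a, f a = a} /\ forall i b, B b -> f (v i b) = u i (f b).
Proof.
move=> [lu eu] [lv ev] ps hs; have [E [BE EB]] := r_E H.
pose ok (fs : aut * seq (set Y)) := [/\ part fs.2, forall i, inv (v i) fs.2 &
  forall i, {in fs.2, forall e, fs.1 (v i e) = u i (fs.1 e)}].
have step : forall tn : {fs | ok fs} * nat, exists t' : {fs | ok fs},
    [/\ ref (sval t').2 (sval tn.1).2, eqon (sval t').1 (sval tn.1).1 (sval tn.1).2,
      dec (sval t').2 (E tn.2) & dec (sval t').2 (ag (sval t').1 (E tn.2))].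
  move=> [[[f t] [/= pt it_ ct]] n] /=.
  have [f1 [s1 [ps1 [rs1 ds1] is1 e1 c1]]] := back_forth_step lv eu pt it_ ct (BE n).
  have B1 := part_B ps1.
  have [||| f2 [s2 [ps2 [rs2 ds2] is2 e2 c2]]] :=
      @back_forth_step I v u (ainv f1) (map f1 s1) (E n) lu ev (part_map _ ps1).
  - by move=> i _ /mapP[e es ->]; rewrite -c1// map_f// is1.
  - by move=> i _ /mapP[e es ->] /=; have Be := B1 _ es; rewrite -c1// (afK f1 (afB (v i) Be)) (afK f1 Be).
  - exact: BE.
  have B2 := part_B ps2.
  have inv2 e : e \in s1 -> f2 (f1 e) = e.
    by move=> es; rewrite e2 ?map_f//= afK//; exact: B1.
  have okn : ok (ainv f2, map f2 s2).
    split => /=; first exact: part_map.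
      by move=> i _ /mapP[e es ->]; rewrite -c2// map_f// is2.
    move=> i _ /mapP[e es ->] /=; have Be := B2 _ es.
    by rewrite -c2// (afK f2 (afB (u i) Be)) (afK f2 Be).
  have r21 : ref (map f2 s2) s1.
    move=> e es; rewrite -(inv2 _ es); apply: dec_map => //; apply: rs2; exact: map_f.
  exists (exist _ _ okn) => /=; split.
  - exact: ref_trans r21 rs1.
  - move=> a at_; rewrite -e1//.
    have k : eqon (ainv f2) f1 s1.
      by move=> e es /=; rewrite -{1}(inv2 _ es) afK//; exact/afB/B1.
    exact: eqon_dec ps1 k (rs1 _ at_).
  - exact: dec_trans r21 ds1.
  - by apply: dec_map.
have [nx hnx] := choice step.
have ok0 : ok (aone, s).
  by split => //= i; [have [] := hs i|move=> e es; have [_ ->] := hs i].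
pose st := fix st k := if k is k'.+1 then nx (st k', k') else exist _ (aone, s) ok0.
pose fk k := (sval (st k)).1; pose sk k := (sval (st k)).2.
have okk k : ok (fk k, sk k) by rewrite /fk /sk; case: (st k) => -[].
have pk k : part (sk k) by case: (okk k).
have rk k l : (k <= l)%N -> ref (sk l) (sk k).
  move=> /subnK <-; elim: (l - k)%N => [|n IH]; first exact: ref_refl.
  by rewrite addSn; apply: ref_trans IH; have [] := hnx (st (n + k)%N, (n + k)%N).
have ek k l : (k <= l)%N -> eqon (fk l) (fk k) (sk k).
  move=> /subnK <-; elim: (l - k)%N => [//|n IH]; rewrite addSn.
  apply: eqon_trans IH; apply: eqon_ref (rk _ _ (leq_addl n k)) _ => //.
  by have [] := hnx (st (n + k)%N, (n + k)%N).
have st_dec k l b : (k <= l)%N -> dec (sk k) b -> fk l b = fk k b.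
  by move=> kl; exact: eqon_dec (ek _ _ kl).
have st_ag k l b : (k <= l)%N -> B b -> dec (sk k) (ag (fk k) b) -> ag (fk l) b = ag (fk k) b.
  move=> kl Bb /(st_dec _ _ _ kl); rewrite (agK (fk k) Bb) => Ef.
  by rewrite -{1}Ef afK//; exact: agB.
have [|f hf] := @limit_aut fk.
  move=> b Bb; have [n En] := EB _ Bb; exists n.+1 => l nl.
  have [_ _ d1 d2] := hnx (st n, n); rewrite En in d1 d2.
  by split; [exact: st_dec|exact: st_ag].
have fE k b : B b -> dec (sk k) b -> f b = fk k b.
  move=> Bb db; have [m hm] := hf _ Bb.
  have [<- _] := hm (maxn m k) (leq_maxl _ _); apply: st_dec => //; exact: leq_maxr.
exists f; split.
  by move=> a as_; rewrite (fE 0%N)//; [exact: (part_B ps)|exact: dec_mem].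
move=> i b Bb; have [n En] := EB _ Bb.
have [_ _ d1 _] := hnx (st n, n); rewrite En in d1.
have [_ iv cv] := okk n.+1.
have Bv : B (v i b) by exact: afB.
have dv : dec (sk n.+1) (v i b).
  split.
    rewrite -(inv_uns (pk n.+1) (iv i)); case: d1 => d1 _.
    by apply: afS => //; apply: Buns; exact: part_B.
  move=> c cs; have [c0 c0s <-] := inv_surj (pk n.+1) (iv i) cs.
  have Bc0 := part_B (pk n.+1) c0s.
  have [_ /(_ _ c0s)[h|h]] := d1; [left; exact: afS|right; exact: af_dj].
rewrite (fE n.+1)// (fE n.+1)//.
have k : eqon (amul (fk n.+1) (v i)) (amul (u i) (fk n.+1)) (sk n.+1).
  by move=> e es /=; rewrite cv.
exact: (eqon_dec (pk n.+1) k d1).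
Qed.

(** * Baire category and the tree of generic tuples *)

Lemma mem_In (T : eqType) (a : T) (l : seq T) : a \in l -> List.In a l.
Proof. by elim: l => //= b l IH; rewrite inE => /orP[/eqP->|/IH]; [left|right]. Qed.

Lemma In_allpairs (T : Type) (g : nat -> nat -> T) m k l l' : List.In m l -> List.In k l' ->
  List.In (g m k) [seq g i j | i <- l, j <- l'].
Proof.
elim: l => //= i l IH [->|ml] kl; apply/List.in_app_iff; last by right; exact: IH.
by left; apply/List.in_map_iff; exists k.
Qed.

Lemma allpairs_In (T : Type) (g : nat -> nat -> T) (o : T) l l' :
  List.In o [seq g i j | i <- l, j <- l'] -> exists m k, o = g m k.
Proof.
elim: l => //= i l IH; move/List.in_app_iff => [|/IH//].
by move/List.in_map_iff => [k [<- _]]; exists i, k.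
Qed.

Lemma dopen_list (Os : seq (set aut)) S D : part D ->
  (forall O, List.In O Os -> dopen O) -> exists S' D',
  [/\ part D', ref D' D, eqon S' S D & forall x, eqon x S' D' -> forall O, List.In O Os -> O x].
Proof.
move=> pD; elim: Os => [|O Os IH] hO; first by exists S, D; split => //; exact: ref_refl.
have [|S1 [D1 [p1 r1 e1 h1]]] := IH; first by move=> O' h; apply: hO; right.
have [|S2 [D2 [p2 r2 e2 h2]]] := hO O _ S1 D1 p1; first by left.
exists S2, D2; split => //; first exact: ref_trans r1.
  by apply: eqon_trans e1; exact: eqon_ref e2.
move=> x ex O' [<-|h]; first exact: h2.
by apply: h1 => //; apply: eqon_trans e2; exact: eqon_ref ex.
Qed.

(* A is not meager in any basic open set contained in that of S and P. *)
Definition fat (A : set aut) S P := forall S' D', part D' -> ref D' P -> eqon S' S P ->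
  forall O : nat -> set aut, (forall k, dopen (O k)) ->
  exists x, [/\ A x, eqon x S' D' & forall k, O k x].

(** If no A n were fat, every basic open set would contain a smaller one where A n misses an
    intersection of countably many dense open sets. Shrinking for every n, while entering all these
    sets and stabilizing every [E j], produces an automorphism outside all A n. *)
Lemma baire (A : nat -> set aut) : (forall x, exists n, A n x) ->
  exists n S P, part P /\ fat (A n) S P.
Proof.
move=> cov; apply: contrapT => nf; have [E [BE EB]] := r_E H.
pose st := {SD : aut * seq (set Y) | part SD.2}.
have bad : forall nt : nat * st, exists r : st * (nat -> set aut),
    [/\ ref (sval r.1).2 (sval nt.2).2, eqon (sval r.1).1 (sval nt.2).1 (sval nt.2).2,
      forall k, dopen (r.2 k) &
      forall x, A nt.1 x -> eqon x (sval r.1).1 (sval r.1).2 -> ~ forall k, r.2 k x].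
  move=> [n [[S P] pP]] /=; apply: contrapT => h; apply: nf; exists n, S, P; split => //.
  move=> S' D' pD' rD' e' O dO; apply: contrapT => h'; apply: h.
  exists (exist _ (S', D') pD', O); split => // x Ax ex hO; apply: h'; by exists x.
have [F hF] := choice bad.
have fin_ : forall r : (seq (set aut) * set Y) * st, exists t : st,
    (forall O, List.In O r.1.1 -> dopen O) -> B r.1.2 ->
    [/\ ref (sval t).2 (sval r.2).2, eqon (sval t).1 (sval r.2).1 (sval r.2).2,
      forall x, eqon x (sval t).1 (sval t).2 -> forall O, List.In O r.1.1 -> O x &
      dec (sval t).2 r.1.2 /\ dec (sval t).2 (ag (sval t).1 r.1.2)].
  move=> [[Os b] [[S P] pP]] /=.
  have [hO|] := pselect (forall O, List.In O Os -> dopen O); last by exists (exist _ (S, P) pP).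
  have [Bb|] := pselect (B b); last by exists (exist _ (S, P) pP).
  have [S1 [D1 [p1 r1 e1 h1]]] := dopen_list S pP hO.
  have [|D2 [p2 d2]] := @part_decs [:: b; ag S1 b].
    by move=> c; rewrite !inE => /orP[/eqP->//|/eqP->]; exact: agB.
  have [_ _ dj1 _] := p1; have [_ _ dj2 _] := p2; have [q1 q2] := join_dec dj1 dj2.
  exists (exist _ (S1, join D1 D2) (join_part p1 p2)) => _ _ /=; split => //.
  - exact: ref_trans r1.
  - by move=> x ex; apply: h1; apply: eqon_ref ex => //; exact: join_part.
  - by split; apply: (dec_trans q2); apply: d2; rewrite !inE eqxx ?orbT.
have [G hG] := choice fin_.
(* The state is a basic open set and, for each A m already treated, its dense open sets. Stage j
   enters those with m, k <= j, so that every pair gets its turn, and decides [E j] and its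
   preimage. *)
pose stp j (s : st * (nat -> nat -> set aut)) : st * (nat -> nat -> set aut) :=
  let r := F (j, s.1) in
  let L := fun m => if m == j then r.2 else s.2 m in
  (G (([seq L m k | m <- iota 0 j.+1, k <- iota 0 j.+1], E j), r.1), L).
have [D0 [pD0 _]] := part_dec B0.
pose s0 : st * (nat -> nat -> set aut) :=
  (exist (fun SD : aut * seq (set Y) => part SD.2) (aone, D0) pD0, fun _ _ => setT).
pose sq := fix sq j := if j is j'.+1 then stp j' (sq j') else s0.
pose Sk j := (sval (sq j).1).1; pose Dk j := (sval (sq j).1).2; pose L j := (sq j).2.
have pD j : part (Dk j) by rewrite /Dk; case: (sq j).1.
have triv : dopen setT by move=> S D pD'; exists S, D; split => //; exact: ref_refl.
have dL j m k : dopen (L j m k).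
  rewrite /L; elim: j m => //= j IH m; case: eqP => // _.
  by have [_ _ + _] := hF (j, (sq j).1); exact.
have dLl j O : List.In O [seq L j.+1 m k | m <- iota 0 j.+1, k <- iota 0 j.+1] -> dopen O.
  by move=> h; have [m [k ->]] := allpairs_In h.
have hst j : [/\ ref (Dk j.+1) (Dk j), eqon (Sk j.+1) (Sk j) (Dk j),
    forall x, eqon x (Sk j.+1) (Dk j.+1) -> (A j x -> ~ forall k, L j.+1 j k x) /\
      forall m k, (m <= j)%N -> (k <= j)%N -> L j.+1 m k x &
    dec (Dk j.+1) (E j) /\ dec (Dk j.+1) (ag (Sk j.+1) (E j))].
  have [r1 e1 _ b1] := hF (j, (sq j).1).
  have [|r2 e2 h2 d2] := hG (([seq L j.+1 m k | m <- iota 0 j.+1, k <- iota 0 j.+1], E j), (F (j, (sq j).1)).1) (dLl j).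
    exact: BE.
  have p1 : part (sval (F (j, (sq j).1)).1).2 by case: (F (j, (sq j).1)).1.
  split => //.
  - exact: ref_trans r2 r1.
  - by apply: eqon_trans e1; exact: eqon_ref e2.
  - move=> x ex; split.
      move=> Ax; have := b1 x Ax _; rewrite /L /= eqxx; apply.
      by apply: eqon_trans e2; apply: eqon_ref ex => //; exact: pD.
    move=> m k mj kj; apply: (h2 x ex).
    have mi : List.In m (iota 0 j.+1) by apply: mem_In; rewrite mem_iota add0n ltnS.
    have ki : List.In k (iota 0 j.+1) by apply: mem_In; rewrite mem_iota add0n ltnS.
    exact: In_allpairs.
have rD j l : (j <= l)%N -> ref (Dk l) (Dk j).
  move=> /subnK <-; elim: (l - j)%N => [|n IH]; first exact: ref_refl.
  by rewrite addSn; apply: ref_trans IH; have [] := hst (n + j)%N.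
have eS j l : (j <= l)%N -> eqon (Sk l) (Sk j) (Dk j).
  move=> /subnK <-; elim: (l - j)%N => [//|n IH]; rewrite addSn.
  apply: eqon_trans IH; apply: eqon_ref (rD _ _ (leq_addl n j)) _; first exact: pD.
  by have [] := hst (n + j)%N.
have lm : forall b, B b -> exists k, forall l, (k <= l)%N ->
    Sk l b = Sk k b /\ ag (Sk l) b = ag (Sk k) b.
  move=> b Bb; have [n En] := EB _ Bb; exists n.+1 => l nl.
  have [_ _ _ [d1 d2]] := hst n; rewrite En in d1 d2.
  split; first exact: eqon_dec (pD _) (eS _ _ nl) d1.
  have := eqon_dec (pD _) (eS _ _ nl) d2; rewrite (agK (Sk n.+1) Bb) => Ef.
  by rewrite -{1}Ef afK//; exact: agB.
have [x hx] := limit_aut lm.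
have ex j : eqon x (Sk j) (Dk j).
  move=> a aj; have [m hm] := hx _ (part_B (pD j) aj).
  have [<- _] := hm (maxn m j) (leq_maxl _ _); apply: eS => //; exact: leq_maxr.
have [n An] := cov x.
(* The sequence attached to m is fixed at stage m and never changes afterwards. *)
have Lst m j k : (m < j)%N -> L j m k = L m.+1 m k.
  move=> mj; have -> : j = ((j - m.+1) + m.+1)%N by rewrite subnK.
  elim: (j - m.+1)%N => // i IH; rewrite addSn -IH /L /=.
  by case: eqP => // E'; move: E'; rewrite addnS => /eqP; rewrite ltn_eqF// ltnS leq_addl.
have [_ _ h1 _] := hst n; have [h2 _] := h1 x (ex _).
apply: (h2 An) => k; have [_ _ h3 _] := hst (maxn n k).
have [_ /(_ n k (leq_maxl _ _) (leq_maxr _ _))] := h3 x (ex _).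
by rewrite Lst// ltnS leq_maxl.
Qed.

Definition W2 (A : nat -> set aut) : set aut := [set x | exists n a b,
  [/\ A n a, A n b & forall c, B c -> x c = ag a (b c)]].

(** Translation by the inverse of an element of A n, chosen in the open set where A n is fat, moves
    that open set to the identity. *)
Lemma fat_W2 (A : nat -> set aut) : (forall x, exists n, A n x) ->
  exists P, part P /\ fat (W2 A) aone P.
Proof.
move=> cov; have [n [S [P [pP fA]]]] := baire cov.
have triv : dopen setT by move=> S' D' pD'; exists S', D'; split => //; exact: ref_refl.
have [a [Aa ea _]] := fA S P pP (ref_refl pP) (fun _ _ => erefl) (fun=> setT) (fun=> triv).
exists P; split => // S' D' pD' rD' e' O dO.
have BP := part_B pP.
have [|k|b [Ab eb Ob]] := fA (amul a S') D' pD' rD' _ (fun k => [set b | O k (amul (ainv a) b)]).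
- by move=> c cP /=; rewrite e'//= ea.
- move=> S1 D1 pD1; have [S2 [D2 [p2 r2 e2 h2]]] := dO k (amul (ainv a) S1) D1 pD1.
  have B1 := part_B pD1; have B2 := part_B p2.
  exists (amul a S2), D2; split => //.
    by move=> c c1 /=; rewrite e2//= agK//; exact/afB/B1.
  move=> x ex; apply: h2 => c c2 /=; rewrite ex//= afK//; exact/afB/B2.
exists (amul (ainv a) b); split => //.
  by exists n, a, b.
by move=> c cD /=; rewrite eb//= afK//; exact/afB/(part_B pD').
Qed.

Lemma fat_shift A P (y : aut) : part P -> fat A aone P -> {in P, forall a, y a = a} ->
  fat [set x | exists2 t : aut, A t & x = amul y t] aone P.
Proof.
move=> pP fA hy S' D' pD' rD' e' O dO.
have BP := part_B pP.
have [|k|t [At_ et Ot]] := fA (amul (ainv y) S') D' pD' rD' _ (fun k => [set b | O k (amul y b)]).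
- by move=> c cP /=; rewrite e'//= fix_ag ?hy//; exact: BP.
- move=> S1 D1 pD1; have [S2 [D2 [p2 r2 e2 h2]]] := dO k (amul y S1) D1 pD1.
  have B1 := part_B pD1; have B2 := part_B p2.
  exists (amul (ainv y) S2), D2; split => //.
    by move=> c c1 /=; rewrite e2//= afK//; exact/afB/B1.
  move=> x ex; apply: h2 => c c2 /=; rewrite ex//= agK//; exact/afB/B2.
exists (amul y t); split => //; first by exists t.
by move=> c cD /=; rewrite et//= agK//; exact/afB/(part_B pD').
Qed.

(** The pigeonhole principle for uncountably many branches, by Cantor's diagonal: an injective m
    would be refuted by the branch d. The two branches are ordered by their values at the first
    difference. *)
Lemma cantor_bool (m : (nat -> bool) -> nat) : exists a b n,
  [/\ m a = m b, forall k, (k < n)%N -> a k = b k, a n = false & b n = true].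
Proof.
have [a [b [mab nab]]] : exists a b : nat -> bool, m a = m b /\ a <> b.
  apply: contrapT => h.
  have inj (a b : nat -> bool) : m a = m b -> a = b.
    by move=> mab; apply: contrapT => nab; apply: h; exists a, b.
  pose d n := ~~ `[< exists2 a, m a = n & a n >].
  case dd: (d (m d)); move: (dd); rewrite {1}/d.
    by move/asboolP; apply; exists d.
  by move/negbFE/asboolP => [a /inj ->]; rewrite dd.
have ex : exists n, a n != b n.
  apply: contrapT => h; apply: nab; apply/funext => n; apply: contrapT => /eqP nn.
  by apply: h; exists n.
have [n nn mn] := ex_minnP ex.
have eq k : (k < n)%N -> a k = b k.
  by move=> kn; apply/eqP; apply: contraTT kn; rewrite -leqNgt; exact: mn.
case an: (a n) nn; case bn: (b n) => // _; last by exists a, b, n.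
by exists b, a, n; split => // k /eq.
Qed.

Record node := Node { nI : finType; nx : nI -> aut; nG : Gen nx; nh : aut }.

(* A binary tree of generic tuples: at each node one successor adds some x in W2 and the other y t with
   t in W2, and the conjugators nh converge along every branch. Two branches with limits in the same
   A n split at some node, and the quotient w of the two limits conjugates x to y t. *)
Lemma core (A : nat -> set aut) : (forall x, exists n, A n x) -> exists P, part P /\
  forall y : aut, {in P, forall a, y a = a} -> exists w x (t : aut),
  [/\ W2 A w, W2 A x, W2 A t & forall b, B b -> y (t b) = w (x (ag w b))].
Proof.
move=> cov; have [P [pP fW]] := fat_W2 cov; exists P; split => // y hy.
have fyW := fat_shift pP fW hy; have [E [BE EB]] := r_E H.
have step : forall nk : node * nat, exists r : (node * node) * (aut * aut),
    [/\ W2 A r.2.1, W2 A r.2.2,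
     [/\ forall i, exists j, nx (n := r.1.1) j = nx (n := nk.1) i,
      forall i, exists j, nx (n := r.1.2) j = nx (n := nk.1) i,
      exists j, nx (n := r.1.1) j = r.2.1 & exists j, nx (n := r.1.2) j = amul y r.2.2],
     nh r.1.1 = nh nk.1 & exists f D, [/\ nh r.1.2 = amul (nh nk.1) f,
        part D, {in [seq E k | k <- iota 0 nk.2.+1] ++ [seq ag (nh nk.1) (E k) | k <- iota 0 nk.2.+1],
           forall b, dec D b}, {in D, forall a, f a = a} &
        (forall i b, B b -> f (nx (n := nk.1) i b) = nx (n := nk.1) i (f b)) /\
        forall b, B b -> f (y (r.2.2 b)) = r.2.1 (f b)]].
  move=> [[I x gx h] k] /=.
  have [ O [dO hO]] := gen_comeager gx; have [lf _] := gx.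
  (* The map f will fix D, so h and h f agree on the first k + 1 sets of [E], and so do their
     inverses; hence convergence along every branch. *)
  have [|D [pD dD iD]] := @LF_decs I x
      (P ++ ([seq E j | j <- iota 0 k.+1] ++ [seq ag h (E j) | j <- iota 0 k.+1])) lf.
    move=> b; rewrite !mem_cat => /or3P[/(part_B pP)//|/mapP[j _ ->]//|/mapP[j _ ->]].
    exact/agB/BE.
  have rD : ref D P by move=> a aP; apply: dD; rewrite mem_cat aP.
  have [x0 [Wx0 e0 O0]] := fW aone D pD rD (fun _ _ => erefl) O dO.
  have [_ [[t Wt ->] e1 O1]] := fyW aone D pD rD (fun _ _ => erefl) O dO.
  have [|f [ff fc]] := gen_conj (hO _ O0) (hO _ O1) pD.
    move=> [i|]; first by split => //; exact: iD.
    split; first by move=> a aD; rewrite e1.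
    by move=> a aD; rewrite e1//= e0.
  (* As f carries y t to x0 and commutes with the old tuple, (h f) (y t) (h f)^-1 = h x0 h^-1, and
     the conjugates of the old entries stay the same. This persists to the limits. *)
  exists ((Node (hO _ O0) h, Node (hO _ O1) (amul h f)), (x0, t)) => /=; split => //.
    by split; [move=> i; exists (Some i)|move=> i; exists (Some i)|exists None|exists None].
  exists f, D; split => //; first by move=> b bl; apply: dD; rewrite mem_cat bl orbT.
  by split; [move=> i; exact: (fc (Some i))|exact: (fc None)].
have [F hF] := choice step.
have g0 : Gen (fun i : 'I_0 => aone).
  split; first by move=> b /part_dec[s [ps ds]]; exists s; split => // -[].
  by move=> s v s2 _ _ _ _; exists aone; split => // -[].
pose nd (al : nat -> bool) := fix nd n := if n is n'.+1 then
  (if al n' then (F (nd n', n')).1.2 else (F (nd n', n')).1.1) else Node g0 aone.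
pose hh al n := nh (nd al n).
have ndS al n : nd al n.+1 = if al n then (F (nd al n, n)).1.2 else (F (nd al n, n)).1.1 by [].
have stepE al k n : (k <= n)%N -> hh al n.+1 (E k) = hh al n (E k) /\
    ag (hh al n.+1) (E k) = ag (hh al n) (E k).
  move=> kn; rewrite /hh ndS.
  have [_ _ _ h0 [f [D [h1 pD dD fD _]]]] := hF (nd al n, n).
  case: (al n); last by rewrite h0.
  rewrite h1 /=; have kI : k \in iota 0 n.+1 by rewrite mem_iota.
  have d1 : dec D (E k) by apply: dD; rewrite mem_cat map_f.
  have d2 : dec D (ag (nh (nd al n)) (E k)).
    by apply: dD; rewrite mem_cat; apply/orP; right; apply/mapP; exists k.
  split; first by rewrite (fix_dec pD fD d1).
  by apply: fix_ag; [exact/agB/BE|exact: fix_dec pD fD d2].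
have lim al : forall b, B b -> exists k, forall l, (k <= l)%N ->
    hh al l b = hh al k b /\ ag (hh al l) b = ag (hh al k) b.
  move=> b /EB[k <-]; exists k => l /subnK <-.
  elim: (l - k)%N => // i [IH1 IH2]; rewrite addSn.
  by have [-> ->] := @stepE al k (i + k)%N (leq_addl _ _).
have /choice[hl hlP] := fun al => limit_aut (lim al).
have /choice[m hm] := fun al => cov (hl al).
have [al [be [n [mE pre an bn]]]] := cantor_bool m.
have ndE k : (k <= n)%N -> nd al k = nd be k.
  by elim: k => // k IH kn; rewrite !ndS IH ?pre// ltnW.
pose N := nd al n; have NE : nd be n = N by rewrite /N ndE.
have mono ga k l z : (k <= l)%N -> (exists i, nx (n := nd ga k) i = z) ->
    exists i, nx (n := nd ga l) i = z.
  move=> /subnK <-; elim: (l - k)%N => // i IH /IH[j <-]; rewrite addSn ndS.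
  have [_ _ [h0 h1 _ _] _ _] := hF (nd ga (i + k)%N, (i + k)%N).
  by case: (ga _); [exact: h1|exact: h0].
have inv_ ga k z : (exists i, nx (n := nd ga k) i = z) -> forall l b, (k <= l)%N -> B b ->
    hh ga l (z (ag (hh ga l) b)) = hh ga k (z (ag (hh ga k) b)).
  move=> hz l b /subnK <- Bb; elim: (l - k)%N => // i IH; rewrite -IH addSn.
  have [j jz] := mono ga _ _ _ (leq_addl i k) hz.
  rewrite /hh ndS; have [_ _ _ h0 [f [D [h1 _ _ _ [h2 _]]]]] := hF (nd ga (i + k)%N, (i + k)%N).
  case: (ga _); last by rewrite h0.
  rewrite h1 /= -jz h2; last exact/agB/agB.
  by rewrite agK//; exact: agB.
have limz ga k z : (exists i, nx (n := nd ga k) i = z) -> forall b, B b ->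
    hl ga (z (ag (hl ga) b)) = hh ga k (z (ag (hh ga k) b)).
  move=> hz b Bb; have [k1 hk1] := hlP ga _ Bb.
  have [k2 hk2] := hlP ga _ (afB z (agB (hl ga) Bb)).
  pose l := maxn k (maxn k1 k2).
  have [<- _] := hk2 l (leq_trans (leq_maxr _ _) (leq_maxr _ _)).
  have [_ <-] := hk1 l (leq_trans (leq_maxl _ _) (leq_maxr _ _)).
  by apply: inv_ => //; exact: leq_maxl.
have [Wx0 Wt [_ _ j0 j1] h0 [f [D [h1 _ _ _ [_ fc]]]]] := hF (N, n).
set x0 := (F (N, n)).2.1 in Wx0 j0 fc; set t := (F (N, n)).2.2 in Wt j1 fc.
have L0 b : B b -> hl al (x0 (ag (hl al) b)) = nh N (x0 (ag (nh N) b)).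
  move=> Bb; rewrite (limz al n.+1 x0)//; last by rewrite ndS an.
  by rewrite /hh ndS an h0.
have L1 b : B b -> hl be (y (t (ag (hl be) b))) = nh N (x0 (ag (nh N) b)).
  move=> Bb; have := limz be n.+1 (amul y t); rewrite /hh ndS bn NE => /(_ j1 b Bb) /= ->.
  rewrite h1 /= fc; last exact/agB/agB.
  by rewrite agK//; exact: agB.
exists (amul (ainv (hl be)) (hl al)), x0, t; split => //.
  by exists (m al), (hl be), (hl al); split => //; rewrite ?mE.
move=> b Bb /=; have Bhb := afB (hl be) Bb.
rewrite L0// -L1// !afK//; do 2 apply: afB => //.
Qed.

Lemma dff0 : dff set0. Proof. by move=> y. Qed.

Lemma restr (q : aut) K : B K -> q K = K ->
  exists q' : aut, forall b, B b -> q' b = q (b `&` K) `|` (b `\` K).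
Proof.
move=> BK qK; have gK : ag q K = K by rewrite -{1}qK afK.
have key (x : aut) : x K = K ->
   [/\ forall b, B b -> B (x (b `&` K) `|` (b `\` K)),
    forall b, B b -> (x (b `&` K) `|` (b `\` K)) `&` K = x (b `&` K) /\
      (x (b `&` K) `|` (b `\` K)) `\` K = b `\` K &
    forall a b, B a -> B b -> x ((a `\` b) `&` K) `|` ((a `\` b) `\` K) =
      (x (a `&` K) `|` (a `\` K)) `\` (x (b `&` K) `|` (b `\` K))].
  move=> xK; have sK b : B b -> x (b `&` K) `<=` K.
    by move=> Bb; rewrite -[X in _ `<=` X]xK; apply: afS => //; exact: BI.
  split.
  - by move=> b Bb; apply: BU; [exact/afB/BI|exact: BD].
  - move=> b Bb; split; apply/seteqP; split=> y.
    + by move=> [[//|[_ ?] ?]].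
    + by move=> h; split; [left|exact: sK h].
    + by move=> [[/(sK _ Bb)//|]].
    + by move=> [? ?]; split => //; right.
  - move=> a b Ba Bb; have -> : (a `\` b) `&` K = (a `&` K) `\` (b `&` K).
      apply/seteqP; split=> y; first by move=> [[ay nb] Ky]; split => // -[].
      by move=> [[ay Ky] nb]; split => //; split => // b_y; exact: nb.
    rewrite afD; [|exact: BI|exact: BI].
    apply/seteqP; split=> y.
      move=> [[h1 h2]|[[h1 h2] h3]].
        have Ky := sK _ Ba _ h1; by split; [left|case=> [/h2|[_]]].
      by split; [right|move=> [/(sK _ Bb)//|[]]].
    move=> [h1 h2]; case: h1 => [h1|[h1 h3]].
      by left; split => // h3; apply: h2; left.
    by right; split => //; split => // h4; apply: h2; right.
have [k1 k2 k3] := key q qK; have [l1 l2 l3] := key (ainv q) gK.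
have fK b : B b -> ag q ((q (b `&` K) `|` (b `\` K)) `&` K) `|` ((q (b `&` K) `|` (b `\` K)) `\` K) = b.
  by move=> Bb; have [-> ->] := k2 _ Bb; rewrite afK ?setUIDK//; exact: BI.
have gK' b : B b -> q ((ag q (b `&` K) `|` (b `\` K)) `&` K) `|` ((ag q (b `&` K) `|` (b `\` K)) `\` K) = b.
  by move=> Bb; have [-> ->] := l2 _ Bb; rewrite /= agK ?setUIDK//; exact: BI.
have fm b : B b -> mu (q (b `&` K) `|` (b `\` K)) = mu b.
  move=> Bb; have BIb := BI Bb BK; rewrite muU ?amu -?muDI//; [exact: afB|exact: BD|].
  by move=> y /(afS BIb BK (@subIsetr _ b K)); rewrite qK => Ky [].
by exists (RingAut k1 l1 fK gK' k3 fm).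
Qed.

(** * Automorphisms close to the identity *)

Definition supp x S := forall b, B b -> dj b S -> x b = b.

Lemma suppS x S T : S `<=` T -> supp x S -> supp x T.
Proof. by move=> ST h b Bb d; apply: h => //; exact: (djS d). Qed.

Lemma supp_self x S : B S -> supp x S -> x S = S.
Proof.
move=> BS h; apply: sub_eq => //; have BxS := afB x BS.
apply/setD_eq0P; have d : dj (x S `\` S) S by move=> y [].
have E := h _ (BD BxS BS) d; apply: dj_self => y [xy ny] [xy' ny'].
have : dj (x (x S `\` S)) (x S) by apply: af_dj => //; exact: BD.
by rewrite E => /(_ y); apply.
Qed.

Lemma supp_fix x S b : B S -> B b -> supp x S -> S `<=` b -> x b = b.
Proof.
move=> BS Bb h Sb; rewrite -{1}(setDUK Sb) afU//; last exact: BD.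
by rewrite supp_self// h ?setDUK//; [exact: BD|move=> y []].
Qed.

Lemma supp_inv x S : supp x S -> supp (ainv x) S.
Proof. by move=> h b Bb d /=; apply: fix_ag => //; exact: h. Qed.

(** The pairs (X a, K a), the pairs of their complements in a and the pair (XO, KO) form a partial
    isomorphism once empty ones are dropped. *)
Lemma move_part P (X K : set Y -> set Y) XO KO : part P ->
  {in P, forall a, [/\ B (X a), B (K a), X a `<=` a, K a `<=` a & mu (X a) = mu (K a)]} ->
  B XO -> B KO -> dff XO -> dff KO -> dj XO (uns P) -> dj KO (uns P) -> mu XO = mu KO ->
  exists p : aut, [/\ {in P, forall a, p a = a}, {in P, forall a, p (X a) = K a} & p XO = KO].
Proof.
move=> pP hX BXO BKO dX dK djX djK mO; have BP := part_B pP; have [uP hP dP xP] := pP.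
have e0 a b : B a -> B b -> mu a = mu b -> a = set0 -> b = set0.
  move=> Ba Bb E a0; apply: contrapT => /(mu_gt0 Bb).
  by rewrite -E a0 mu0 ltxx.
pose r0 : seq pr := [seq (X a, K a) | a <- P] ++ [seq (a `\` X a, a `\` K a) | a <- P] ++ [:: (XO, KO)].
pose r := [seq p <- r0 | ne p.1].
have r0P (p : pr) : p \in r0 <-> [\/ exists2 a, a \in P & p = (X a, K a),
    exists2 a, a \in P & p = (a `\` X a, a `\` K a) | p = (XO, KO)].
  rewrite !mem_cat mem_seq1; split.
    by move=> /or3P[/mapP h|/mapP h|/eqP]; [constructor 1|constructor 2|constructor 3].
  case=> [[a aP ->]|[a aP ->]|->]; apply/or3P.
  - by constructor 1; apply/mapP; exists a.
  - by constructor 2; apply/mapP; exists a.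
  - by constructor 3.
have rP (p : pr) : p \in r <-> p.1 <> set0 /\ p \in r0.
  rewrite mem_filter; split; first by move=> /andP[/asboolP].
  by move=> [h1 h2]; apply/andP; split => //; exact/asboolP.
have rB (p : pr) : p \in r0 -> [/\ B p.1, B p.2 & mu p.1 = mu p.2].
  move=> /r0P[[a aP ->]|[a aP ->]|->] //=; have [b1 b2 s1 s2 E] := hX _ aP => //.
  have Ba := BP _ aP.
  by split; [exact: BD|exact: BD|rewrite !muD// E].
have cov : uns P `<=` uns (unzip1 r0) /\ uns P `<=` uns (unzip2 r0).
  split=> y [a aP ay].
    have [Xy|Xy] := pselect (X a y).
      by exists (X a) => //; apply/mapP; exists (X a, K a) => //; apply/r0P; constructor 1; exists a.
    exists (a `\` X a) => //; apply/mapP; exists (a `\` X a, a `\` K a) => //.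
    by apply/r0P; constructor 2; exists a.
  have [Xy|Xy] := pselect (K a y).
    by exists (K a) => //; apply/mapP; exists (X a, K a) => //; apply/r0P; constructor 1; exists a.
  exists (a `\` K a) => //; apply/mapP; exists (a `\` X a, a `\` K a) => //.
  by apply/r0P; constructor 2; exists a.
have [|x hx] := @extend_pii r.
  split.
  - move=> p /rP[n0 p0]; have [b1 b2 E] := rB _ p0.
    have n1 : p.2 <> set0 by move=> h; apply: n0; apply: (e0 p.2).
    have sub a : a \in P -> p.1 `<=` a -> p.2 `<=` a -> [/\ piece p.1, piece p.2 & sim p.1 p.2].
      move=> aP s1 s2; have [? k1] := piece_sub (hP _ aP) b1 n0 s1.
      have [? k2] := piece_sub (hP _ aP) b2 n1 s2; split => //; split => //; tauto.
    case/r0P: p0 => [[a aP Ep]|[a aP Ep]|Ep].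
    + by have [_ _ s1 s2 _] := hX _ aP; apply: (sub a aP); rewrite Ep.
    + by apply: (sub a aP); rewrite Ep; exact: subDsetl.
    + rewrite Ep /= in n0 n1 b1 b2 E *; split; [exact: dff_piece|exact: dff_piece|split => //].
      by split=> /atm_dff; [move/(_ dX)|move/(_ dK)].
  - move=> p q /rP[_ p0] /rP[_ q0] npq.
    have inP a b (a1 b1 : set Y) : a \in P -> b \in P -> a <> b -> a1 `<=` a -> b1 `<=` b -> dj a1 b1.
      by move=> aP bP n; apply: djS; exact: dP.
    have outP a (a1 : set Y) (b1 : set Y) : a \in P -> a1 `<=` a -> dj b1 (uns P) -> dj a1 b1.
      by move=> aP aa d; apply: djC; apply: (djS d) => // y /aa ?; exists a.
    case/r0P: p0 npq => [[a aP ->]|[a aP ->]|->]; case/r0P: q0 => [[b bP ->]|[b bP ->]|->] //= npq;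
      try (have [_ _ s1 s2 _] := hX _ aP); try (have [_ _ t1 t2 _] := hX _ bP);
      try (by split; [apply: (outP a)|apply: (outP a)]; (try exact: subDsetl));
      try (by split; apply: djC; [apply: (outP b)|apply: (outP b)]; (try exact: subDsetl)).
    + have n : a <> b by move=> h; apply: npq; rewrite h.
      by split; exact: (inP a b).
    + have [<-|n] := pselect (a = b); first by split=> y ? [].
      by split; apply: (inP a b) => //; exact: subDsetl.
    + have [<-|n] := pselect (a = b); first by split=> y [].
      by split; apply: (inP a b) => //; exact: subDsetl.
    + have n : a <> b by move=> h; apply: npq; rewrite h.
      by split; apply: (inP a b) => //; exact: subDsetl.
  - move=> y /xP /(proj1 cov) [_ /mapP[p p0 ->] py]; apply/u1P; exists p => //; apply/rP; split => //.
    by move=> h; rewrite h in py.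
  - move=> y /xP /(proj2 cov) [_ /mapP[p p0 ->] py]; apply/u2P; exists p => //; apply/rP; split => //.
    by move=> h; have [b1 b2 E] := rB _ p0; rewrite (e0 _ _ b1 b2 E h) in py.
have hx0 (p : pr) : p \in r0 -> x p.1 = p.2.
  move=> p0; have [h|h] := pselect (p.1 = set0); last by apply: hx; exact/rP.
  by have [b1 b2 E] := rB _ p0; rewrite h af0 (e0 _ _ b1 b2 E h).
have hK : {in P, forall a, x (X a) = K a}.
  by move=> a aP; apply: (hx0 (X a, K a)); apply/r0P; constructor 1; exists a.
exists x; split => //.
  move=> a aP; have [b1 b2 s1 s2 _] := hX _ aP; have Ba := BP _ aP.
  rewrite -{1}(setDUK s1) afU//; last exact: BD.
  rewrite hK//= (hx0 (a `\` X a, a `\` K a)) /= ?setDUK//; apply/r0P.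
  by constructor 2; exists a.
by apply: (hx0 (XO, KO)); apply/r0P; constructor 3.
Qed.

(** An automorphism that fixes the union and sends c to c' sends c' to c, as complements in the
    union. Restricting it to the union gives the support. *)
Lemma swap c c' : piece c -> piece c' -> dff c -> dff c' -> mu c = mu c' -> dj c c' ->
  exists x, [/\ x c = c', x c' = c & supp x (c `|` c')].
Proof.
move=> pc pc' dc dc' E d; have [Bc c0 _] := pc; have [Bc' _ _] := pc'.
have BU' := BU Bc Bc'; have [s [us hs ds Es]] := PD (BD BXf BU').
have du : dff (c `|` c') by move=> y [/dc|/dc'].
have pu : piece (c `|` c').
  by apply: dff_piece => // h; apply: c0; rewrite -subset0 -h => y; left.
have djus : dj (c `|` c') (uns s) by rewrite Es => y h [].
have djs' b : b \in s -> dj (c `|` c') b by move=> bs y h b_y; apply: (djus y) => //; exists b.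
pose P := (c `|` c') :: s.
have pP : part P.
  split.
  - rewrite /= us andbT; apply/negP => /djs' /dj_self; exact: piece_neq0.
  - by move=> b; rewrite inE => /orP[/eqP->|/hs].
  - move=> b b'; rewrite !inE => /orP[/eqP->|bs] /orP[/eqP->|bs'] // n; [exact: djs'| |exact: ds].
    exact/djC/djs'.
  - by rewrite uns_cons Es => y Xy; have [|] := pselect ((c `|` c') y); [left|right].
pose X b := if b == c `|` c' then c else set0.
pose K b := if b == c `|` c' then c' else set0.
have [|x [h1 h2 _]] := move_part (X := X) (K := K) pP _ B0 B0 dff0 dff0 (fun _ h _ => h) (fun _ h _ => h) erefl.
  by move=> b _; rewrite /X /K; case: eqP => [->|_]; split => //.
have u0 : c `|` c' \in P by rewrite mem_head.
have xu := h1 _ u0; have xc : x c = c' by have := h2 _ u0; rewrite /X /K eqxx.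
have cD : c' = (c `|` c') `\` c.
  apply/seteqP; split=> y; last by move=> [[]].
  by move=> cy; split; [right|move=> cy'; exact: (d y)].
have cD' : c = (c `|` c') `\` c'.
  apply/seteqP; split=> y; last by move=> [[]].
  by move=> cy; split; [left|move=> cy'; exact: (d y)].
have xc' : x c' = c by rewrite {1}cD afD// xu xc -cD'.
have [z hz] := restr BU' xu; exists z; split.
- rewrite hz// (_ : c `&` _ = c); last by apply/setIidPl; exact: subsetUl.
  by rewrite xc (_ : c `\` _ = set0) ?setU0//; apply/setD_eq0P; exact: subsetUl.
- rewrite hz// (_ : c' `&` _ = c'); last by apply/setIidPl; exact: subsetUr.
  by rewrite xc' (_ : c' `\` _ = set0) ?setU0//; apply/setD_eq0P; exact: subsetUr.
- move=> b Bb db; rewrite hz// (_ : b `&` _ = set0); last by rewrite -subset0 => y [by_ cy]; exact: (db y).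
  rewrite af0 set0U; apply/seteqP; split=> y; first by case.
  by move=> b_y; split => // cy; exact: (db y).
Qed.

Lemma swaps (L : seq (set Y)) (c c' : set Y -> set Y) : uniq L ->
  {in L, forall a, [/\ piece (c a), piece (c' a), dff (c a), dff (c' a) & mu (c a) = mu (c' a)]} ->
  {in L, forall a, dj (c a) (c' a)} ->
  {in L &, forall a b, a <> b -> dj (c a `|` c' a) (c b `|` c' b)} ->
  exists x, [/\ {in L, forall a, x (c a) = c' a}, {in L, forall a, x (c' a) = c a} &
    supp x (uns [seq c a `|` c' a | a <- L])].
Proof.
elim: L => [|a L IH] /=; first by exists aone.
move=> /andP[aL uL] h1 h2 h3.
have sL b : b \in L -> b \in a :: L by move=> bL; rewrite inE bL orbT.
have [|||x [xc xc' xs]] := IH uL.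
- by move=> b /sL /h1.
- by move=> b /sL /h2.
- by move=> b b' /sL bL /sL bL'; exact: h3.
have aa : a \in a :: L by rewrite mem_head.
have [p1 p2 d1 d2 E] := h1 _ aa.
have [y [yc yc' ys]] := swap p1 p2 d1 d2 E (h2 _ aa).
have dab b : b \in L -> dj (c a `|` c' a) (c b `|` c' b).
  by move=> bL; apply: h3 => //; [exact: sL|move=> h; rewrite h bL in aL].
have dL : dj (c a `|` c' a) (uns [seq c a `|` c' a | a <- L]).
  by move=> z cz [_ /mapP[b bL ->]]; exact: (dab _ bL z).
have fx z : B z -> z `<=` c a `|` c' a -> x z = z.
  by move=> Bz sz; apply: xs => //; exact: (djS dL).
have fy b z : b \in L -> B z -> z `<=` c b `|` c' b -> y z = z.
  by move=> bL Bz sz; apply: ys => //; apply: djC; exact: (djS (dab _ bL)).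
exists (amul y x); split.
- move=> b; rewrite inE => /orP[/eqP->|bL] /=.
    by rewrite fx ?yc//; case: p1.
  have [q1 q2 _ _ _] := h1 _ (sL _ bL).
  by rewrite xc// (fy b)//; case: q2.
- move=> b; rewrite inE => /orP[/eqP->|bL] /=.
    by rewrite fx ?yc'//; case: p2.
  have [q1 q2 _ _ _] := h1 _ (sL _ bL).
  by rewrite xc'// (fy b)//; case: q1.
- rewrite uns_cons => b Bb db /=; rewrite xs ?ys//.
    by apply: (djS db) => // z; left.
  by apply: (djS db) => // z; right.
Qed.

(** Differences of consecutive terms of a decreasing sequence obtained by repeated halving. *)
Lemma disjoint_seq a : piece a -> dff a -> exists z : nat -> set Y,
  (forall j, [/\ piece (z j), dff (z j) & z j `<=` a]) /\
  forall i j, i <> j -> dj (z i) (z j).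
Proof.
move=> pa da; pose T := {b | [/\ piece b, dff b & b `<=` a]}.
have /choice[h hh] : forall b : T, exists c : T, sval c `<=` sval b /\ sval b `\` sval c <> set0.
  move=> [b [pb db ba]] /=; have m0 := piece_mu pb; have Bb := pieceB pb.
  have [|c [Bc cb mc]] := SP Bb db (half_V (Vmu Bb)); first by lra.
  have c0 : c <> set0 by move=> E; move: mc; rewrite E mu0; lra.
  have okc : [/\ piece c, dff c & c `<=` a].
    by split; [apply: dff_piece => //; exact: dffS cb|exact: dffS cb|exact: subset_trans ba].
  exists (exist _ c okc) => /=; split => // E.
  by have := muD Bb Bc cb; rewrite E mu0 mc; lra.
have oka : [/\ piece a, dff a & a `<=` a] by split.
pose w := fix w j := if j is j'.+1 then h (w j') else exist _ a oka : T.
pose v j := sval (w j).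
have vP j : [/\ piece (v j), dff (v j) & v j `<=` a] by exact: (svalP (w j)).
have vS j : v j.+1 `<=` v j by have [] := hh (w j).
have vm i j : (i <= j)%N -> v j `<=` v i.
  move=> /subnK <-; elim: (j - i)%N => // n IH; rewrite addSn; exact: subset_trans IH.
exists (fun j => v j `\` v j.+1); split.
  move=> j; have [p1 d1 s1] := vP j; have [p2 _ _] := vP j.+1.
  have sD := @subDsetl _ (v j) (v j.+1).
  split; [|exact: dffS sD|exact: subset_trans s1].
  apply: dff_piece; [apply: BD; exact: pieceB| |exact: dffS sD].
  by have [] := hh (w j).
have key i j : (i < j)%N -> dj (v i `\` v i.+1) (v j `\` v j.+1).
  by move=> ij y [_ ny] [/(vm _ _ ij)].
move=> i j /eqP; rewrite neq_ltn => /orP[/key//|/key]; exact: djC.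
Qed.

Lemma same_measure z z' : piece z -> piece z' -> dff z -> dff z' -> exists c c',
  [/\ [/\ piece c, dff c & c `<=` z], [/\ piece c', dff c' & c' `<=` z'] & mu c = mu c'].
Proof.
wlog le : z z' / mu z <= mu z'.
  move=> wl pz pz' dz dz'; case/orP: (le_total (mu z) (mu z')) => h; first exact: wl.
  by have [c [c' [h1 h2 E]]] := wl _ _ h pz' pz dz' dz; exists c', c.
move=> pz pz' dz dz'; have [Bz z0 _] := pz; have [Bz' _ _] := pz'.
have [E|n] := eqVneq (mu z) (mu z'); first by exists z, z'; split => //; split.
have [|c [Bc cz mc]] := SP Bz' dz' (Vmu Bz); first by rewrite piece_mu// lt_neqAle n.
have c0 : c <> set0 by move=> E; have := piece_mu pz; rewrite -mc E mu0 ltxx.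
by exists z, c; split => //; split => //; [apply: dff_piece => //|]; exact: dffS cz.
Qed.

Lemma pos_min (l : seq R) : {in l, forall v, 0 < v} ->
  exists e, 0 < e /\ {in l, forall v, e <= v}.
Proof.
elim: l => [|v l IH] h; first by exists 1.
have [|e [e0 he]] := IH; first by move=> w wl; apply: h; rewrite inE wl orbT.
exists (Num.min v e); split; first by rewrite lt_min e0 h// mem_head.
move=> w; rewrite inE => /orP[/eqP->|/he wl]; first by rewrite ge_min lexx.
by rewrite ge_min wl orbT.
Qed.

(* x moves mass between the pieces of P only; since p^-1 = q p' x^-1 and p' fix P, the double
   coset of x modulo the stabilizer of P contains an automorphism supported in C. *)
Lemma near_one P (x : aut) C : part P -> B C -> dff C -> {in P, forall a, atm a -> x a = a} ->
  {in P, forall a, dff a -> exists c, [/\ B c, c `<=` C `&` a & mu (x a `\` a) < mu c]} ->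
  (Xf = set0 -> exists c, [/\ B c, c `<=` C `\` uns P & mu (x (uns P) `\` uns P) < mu c]) ->
  exists p q p' : aut, [/\ {in P, forall a, p a = a}, {in P, forall a, p' a = a}, supp q C &
    forall b, B b -> p (x b) = q (p' b)].
Proof.
move=> pP BC dC hat hdf hout; have BP := part_B pP; have [uP hP dP xP] := pP.
have BuP := Buns BP; set U := uns P in BuP hout *.
(* The mass that x carries out of a equals the mass that it carries into a. *)
have muIx a : B a -> mu (a `\` ag x a) = mu (x a `\` a) /\ mu (a `\` x a) = mu (x a `\` a).
  move=> Ba; have Bxa := afB x Ba.
  have h1 : mu (a `\` ag x a) = mu (x a `\` a).
    by rewrite -(amu x (BD Ba (agB x Ba))) afD ?agK//; exact: agB.
  split => //; have := muDI Ba Bxa; have := muDI Bxa Ba; rewrite amu// setIC; lra.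
have sub_exists c v : B c -> dff c -> V v -> 0 <= v < mu c -> exists k, [/\ B k, k `<=` c & mu k = v].
  move=> Bc dc Vv /andP[]; rewrite le_eqVlt => /orP[/eqP<- _|v0 vc]; first by exists set0; rewrite mu0; split.
  by apply: SP => //; rewrite v0.
(* K a is room inside both C and a, of exactly the mass that x carries out of a. An atom is fixed
   and needs none. *)
have /choice[K hK] : forall a, exists K, a \in P -> [/\ B K, K `<=` a, mu K = mu (x a `\` a) & K `<=` C].
  move=> a; have [aP|] := boolP (a \in P); last by exists set0.
  have [Ba _ [aa|da]] := hP _ aP; first by exists set0; rewrite hat// setDv mu0; split.
  have [c [Bc cC mc]] := hdf _ aP da.
  have BxD := BD (afB x Ba) Ba.
  have [||k [Bk kc mk]] := sub_exists c _ Bc _ (Vmu BxD); last by exists k => _; split => // y /kc /cC [].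
    by apply: (dffS da) => y /cC [].
  by rewrite mu_ge0.
pose MO := ag x U `\` U; pose NO := x U `\` U.
have BMO : B MO by apply: BD => //; exact: agB.
have BNO : B NO by apply: BD => //; exact: afB.
have mMO : mu MO = mu NO.
  have := muIx _ BuP; rewrite /MO /NO => -[h1 h2].
  rewrite -(amu x BMO) /MO afD ?agK//; exact: agB.
have dout (z : aut) : {in P, forall a, atm a -> z a = a} -> dff (z U `\` U).
  move=> hz y [zy ny]; move: zy; rewrite /U af_uns// => -[_ /mapP[a aP ->] ay].
  have [Ba _ [aa|da]] := hP _ aP; last exact: aut_dff ay.
  by move: ay; rewrite hz// => ay; case: ny; exists a.
have dMO : dff MO.
  by apply: (dout (ainv x)) => a aP aa /=; apply: fix_ag; [exact: BP|exact: hat].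
have dNO : dff NO by exact: dout.
have [KO [BKO dKO KOU mKO KOC]] : exists KO, [/\ B KO, dff KO, dj KO U, mu KO = mu NO & KO `<=` C].
  have [Xf0|nX] := pselect (Xf = set0).
    have [c [Bc cC mc]] := hout Xf0; have dc : dff c by apply: (dffS dC) => y /cC [].
    have [|k [Bk kc mk]] := sub_exists c _ Bc dc (Vmu BNO); first by rewrite mu_ge0.
    exists k; split => //; first exact: dffS kc.
      by move=> y /kc /cC [].
    by move=> y /kc /cC [].
  have NO0 : NO = set0.
    by rewrite -subset0 => y Ny; have [_] := Ny; apply; apply: xP; exact: (XfT nX BNO dNO).
  by exists set0; rewrite NO0 mu0; split.
have djMO : dj MO U by move=> y [].
have djNO : dj NO U by move=> y [].
have [||p' [p'P p'X p'O]] := move_part (X := fun a => a `\` ag x a) (K := K) pP _ BMO BKO dMO dKO djMO KOU.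
- move=> a aP; have Ba := BP _ aP; have [h1 h2 h3 _] := hK _ aP.
  split => //; [apply: BD => //; exact: agB|].
  by rewrite h3; case: (muIx _ Ba).
- by rewrite mMO.
have [||sg [sP sX sO]] := move_part (X := fun a => a `\` x a) (K := K) pP _ BNO BKO dNO dKO djNO KOU.
- move=> a aP; have Ba := BP _ aP; have [h1 h2 h3 _] := hK _ aP.
  split => //; [apply: BD => //; exact: afB|].
  by rewrite h3; case: (muIx _ Ba).
- by rewrite mKO.
pose KK := uns (map K P) `|` KO.
have BmK : {in map K P, forall b, B b} by move=> _ /mapP[a aP ->]; have [] := hK _ aP.
have BKK : B KK by apply: BU => //; exact: Buns.
(* M is what changes cell under x, with the exterior of U counted as one more cell, except for what
   goes from U to the exterior and is found in the cells anyway; N is its image. Both are moved onto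
   KK, by p' and sg. *)
pose M := uns [seq a `\` ag x a | a <- P] `|` MO.
pose N := uns [seq a `\` x a | a <- P] `|` NO.
have BmM : {in [seq a `\` ag x a | a <- P], forall b, B b}.
  by move=> _ /mapP[a aP ->]; apply: BD; [exact: BP|exact/agB/BP].
have BmN : {in [seq a `\` x a | a <- P], forall b, B b}.
  by move=> _ /mapP[a aP ->]; apply: BD; [exact: BP|exact/afB/BP].
have BM : B M by apply: BU => //; exact: Buns.
have BN : B N by apply: BU => //; exact: Buns.
have pM : p' M = KK.
  rewrite /M afU//; last exact: Buns.
  by rewrite p'O af_uns// -map_comp /KK; congr (uns _ `|` _); apply/eq_in_map => a aP /=; exact: p'X.
have sN : sg N = KK.
  rewrite /N afU//; last exact: Buns.
  by rewrite sO af_uns// -map_comp /KK; congr (uns _ `|` _); apply/eq_in_map => a aP /=; exact: sX.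
have xM : x M = N.
  have -> : x M = uns [seq x a `\` a | a <- P] `|` (U `\` x U).
    rewrite /M afU//; last exact: Buns.
    rewrite /MO afD ?agK//; last exact: agB.
    rewrite af_uns// -map_comp; congr (uns _ `|` _); apply/eq_in_map => a aP /=.
    by rewrite afD ?agK//; [exact: BP|exact: BP|exact/agB/BP].
  have xU : x U = uns (map x P) by rewrite af_uns.
  have xinP a b y : a \in P -> b \in P -> x a y -> x b y -> a = b.
    move=> aP bP xy yb; apply: contrapT => n.
    by apply: (@af_dj x a b (BP _ aP) (BP _ bP) (dP _ _ aP bP n) y).
  have inPP a b y : a \in P -> b \in P -> a y -> b y -> a = b.
    by move=> aP bP xy yb; apply: contrapT => n; exact: (dP _ _ aP bP n y).
  apply/seteqP; split=> y.
    move=> [[_ /mapP[a aP ->] [xy ny]]|[[a aP ay] nx]].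
      have [[b bP b_y]|nU] := pselect (U y).
        left; exists (b `\` x b); first by apply/mapP; exists b.
        by split => // yb; rewrite (xinP _ _ _ bP aP yb xy) in b_y.
      by right; split => //; rewrite xU; exists (x a) => //; exact: map_f.
    left; exists (a `\` x a); first by apply/mapP; exists a.
    by split => // xy; apply: nx; rewrite xU; exists (x a) => //; exact: map_f.
  move=> [[_ /mapP[a aP ->] [xy ny]]|[]].
    have [|nU] := pselect (x U y); last by right; split => //; exists a.
    rewrite xU => -[_ /mapP[b bP ->] b_y]; left; exists (x b `\` b); first by apply/mapP; exists b.
    by split => // yb; rewrite (inPP _ _ _ bP aP yb xy) in b_y.
  rewrite xU => -[_ /mapP[b bP ->] b_y] nU; left; exists (x b `\` b); first by apply/mapP; exists b.
  by split => // yb; apply: nU; exists b.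
pose th := amul sg (amul x (ainv p')).
have thK : th KK = KK by rewrite /th /= -pM afK// xM sN.
(* On KK the map q is sg x p'^-1, which preserves KK; elsewhere it is the identity. *)
have [q hq] := restr BKK thK.
have KC : KK `<=` C.
  by move=> y [[_ /mapP[a aP ->]]|/KOC//]; have [_ _ _ h] := hK _ aP; exact: h.
have sq : supp q KK.
  move=> b Bb db; rewrite hq// (_ : b `&` KK = set0); last by rewrite -subset0 => y [by_ cy]; exact: (db y).
  rewrite af0 set0U; apply/seteqP; split=> y; first by case.
  by move=> b_y; split => // cy; exact: (db y).
exists (amul q (amul p' (ainv x))), q, p'; split => //; last 2 first.
- exact: suppS sq.
- by move=> b Bb /=; rewrite afK.
move=> a aP /=; have Ba := BP _ aP; have [BKa Ka mKa _] := hK _ aP.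
have Bxa := afB x Ba; have Bga := agB x Ba.
have BaM : B (a `\` ag x a) by exact: BD.
have BaN : B (a `\` x a) by exact: BD.
(* q p' x^-1 fixes a: the part of x^-1 a inside a goes to a minus K a, and the part that x brings
   into a from elsewhere goes to K a. *)
have Eg : ag x a = (a `\` (a `\` ag x a)) `|` ag x (a `\` x a).
  rewrite agD// afK// setDD; apply/seteqP; split=> y.
    by move=> gy; have [|] := pselect (a y); [left|right].
  by case=> [[]|[]].
have E1 : p' (a `\` (a `\` ag x a)) = a `\` K a by rewrite afD// p'P// p'X.
have E2 : q (a `\` K a) = a `\` K a.
  apply: sq; first exact: BD.
  move=> y [ay nK] [[_ /mapP[b bP ->] Kb]|/KOU]; last by apply; exists a.
  have [_ Kbb _ _] := hK _ bP; apply: nK.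
  suff -> : a = b by [].
  by apply: contrapT => n; exact: (dP _ _ aP bP n y ay (Kbb _ Kb)).
have E3 : q (p' (ag x (a `\` x a))) = K a.
  have BgN := agB x BaN; have BpgN := afB p' BgN.
  have sK : p' (ag x (a `\` x a)) `<=` KK.
    rewrite -pM -[M](afK x BM) xM; apply: afS => //; first exact: agB.
    apply: (@afS (ainv x)) => // y h; left; exists (a `\` x a) => //.
    by apply/mapP; exists a.
  rewrite hq// (_ : _ `&` KK = p' (ag x (a `\` x a))); last exact/setIidPl.
  rewrite (_ : _ `\` KK = set0) ?setU0; last exact/setD_eq0P.
  by rewrite /th /= afK// agK// sX.
rewrite {1}Eg afU//; [|exact: BD|exact: agB].
rewrite afU//; [|exact/afB/BD|exact/afB/agB].
by rewrite E1 E2 E3 setUC setDUK.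
Qed.

(** An atom is moved entirely or not at all. *)
Lemma atm_near (x : aut) a : B a -> atm a -> mu (x a `\` a) < mu a -> x a = a.
Proof.
move=> Ba aa h; have Bxa := afB x Ba; have xa := aut_atm x Ba aa.
have [E|E] := atm_sub xa (@subIsetl _ (x a) a).
  move: h; rewrite (_ : x a `\` a = x a) ?amu ?ltxx//.
  apply/seteqP; split=> y; first by case.
  by move=> xy; split => // ay; have : (x a `&` a) y by []; rewrite E.
by apply: sub_eq => //; rewrite -E; exact: subIsetr.
Qed.

(** * The Steinhaus argument in the group *)

Section group.
Local Open Scope group_scope.
Variables (G : groupType) (io : aut -> G) (A : nat -> set G).
Hypothesis ioM : forall x z : aut, io (amul x z) = io x * io z.
Hypothesis ioE : forall x z : aut, (forall b, B b -> x b = z b) -> io x = io z.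
Hypothesis covA : forall g, exists n, A n g.
(** g plays the part of the union of those tau k for which al k holds. Only its conjugation action
    on automorphisms supported in a single S k is recorded. *)
Hypothesis glue : forall (tau : nat -> aut) (S : nat -> set Y),
  (forall k, B (S k)) -> (forall k l, k <> l -> dj (S k) (S l)) ->
  (forall k, supp (tau k) (S k)) -> forall al : nat -> bool, exists g : G,
  forall k (r : aut), supp r (S k) -> g * io r = io (if al k then acj (tau k) r else r) * g.

Definition gprod (l : seq G) := foldr (fun g h => g * h) 1 l.
Definition Wg (g : G) := exists n a b, [/\ A n a, A n b & g = a^-1 * b].
Definition Wn n (g : G) := exists l, [/\ size l = n, {in l, forall h, Wg h} & gprod l = g].

Lemma WgV g : Wg g -> Wg g^-1.
Proof. by move=> [n [a [b [Aa Ab ->]]]]; exists n, b, a; split => //; rewrite invgM invgK. Qed.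

Lemma gprod_cat l1 l2 : gprod (l1 ++ l2) = gprod l1 * gprod l2.
Proof. by elim: l1 => /= [|g l ->]; rewrite ?mul1g ?mulgA. Qed.

Lemma WnM m n g h : Wn m g -> Wn n h -> Wn (m + n) (g * h).
Proof.
move=> [l1 [<- h1 <-]] [l2 [<- h2 <-]]; exists (l1 ++ l2); rewrite size_cat gprod_cat; split => //.
by move=> k; rewrite mem_cat => /orP[/h1|/h2].
Qed.

Lemma Wn1 g : Wg g -> Wn 1 g.
Proof.
by move=> h; exists [:: g]; split => //=; rewrite ?mulg1// => k; rewrite mem_seq1 => /eqP->.
Qed.

Lemma io1 : io aone = 1.
Proof. by apply: (@mulgI _ (io aone)); rewrite mulg1 -ioM; exact: ioE. Qed.

Lemma ioV (x : aut) : io (ainv x) = (io x)^-1.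
Proof.
apply: (@mulgI _ (io x)); rewrite mulgV -ioM -io1; apply: ioE => b Bb /=.
by rewrite agK.
Qed.

Lemma stab_W4 : exists P, part P /\ forall y : aut, {in P, forall a, y a = a} -> Wn 4 (io y).
Proof.
have [|P [pP h]] := @core (fun n => [set x | A n (io x)]); first by move=> x; exact: covA.
exists P; split => // y /h[w [x [t [Ww Wx Wt E]]]].
have W2g z : W2 (fun n => [set x | A n (io x)]) z -> Wg (io z).
  move=> [n [a [b [Aa Ab Ez]]]]; exists n, (io a), (io b); split => //.
  by rewrite -ioV -ioM; exact: ioE.
have -> : io y = io w * (io x * ((io w)^-1 * (io t)^-1)).
  rewrite !mulgA -!ioV -!ioM; apply: ioE => b Bb /=.
  have Bt := agB t Bb; have := E _ Bt; by rewrite agK// => ->.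
apply: (@WnM 1 3); first exact/Wn1/W2g.
apply: (@WnM 1 2); first exact/Wn1/W2g.
by apply: (@WnM 1 1); apply/Wn1/WgV/W2g.
Qed.

(* 14 = 4 + 1 + 4 + 1 + 4 for x = p w r w^-1 p', where w in Wg is a quotient of two glued elements
   and p, r, p' fix P0. *)
Lemma near_W14 : exists (L : seq (set Y)) e, [/\ 0%R < e, {in L, forall b, B b} &
  forall x : aut, {in L, forall b, mu (x b `\` b) < e} -> exists2 n, (n <= 14)%N & Wn n (io x)]%R.
Proof.
have [P0 [pP0 hP0]] := stab_W4.
have pmu P : part P -> {in map mu P, forall v : R, 0 < v}%R.
  by move=> [_ hP _ _] _ /mapP[a /hP pa ->]; exact: piece_mu.
(* Without diffuse pieces a small displacement fixes every cell of P0, and four factors suffice. *)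
have [[a0 [pa0 da0]]|nd] := pselect (exists a, piece a /\ dff a); last first.
  have [e [e0 he]] := pos_min (pmu _ pP0); have BP := part_B pP0.
  exists P0, e; split => // x hx; exists 4%N => //; apply: hP0 => a aP.
  case: (pP0) => _ hP _ _; have pa := hP _ aP; have [Ba _ [aa|da]] := pa; last by case: nd; exists a.
  apply: atm_near => //; apply: lt_le_trans (hx _ aP) _; apply: he; exact: map_f.
have [P [pP rP [A1 [A1P dA1]]]] : exists P, [/\ part P, ref P P0 & exists a, a \in P /\ dff a].
  have [t [pt dt]] := part_dec (pieceB pa0).
  have [_ _ d1 _] := pP0; have [_ _ d2 _] := pt; have [r1 r2] := join_dec d1 d2.
  exists (join P0 t); split => //; first exact: join_part.
  have [c1 c2] := dec_trans r2 dt; have [y ay] := piece_ne pa0.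
  have [a aj a_y] := c1 _ ay; exists a; split => //.
  by have [h|h] := c2 _ aj; [exact: dffS h|case: (h y)].
have stab (z : aut) : {in P, forall a, z a = a} -> Wn 4 (io z).
  by move=> hz; apply: hP0 => a aP; exact: fix_dec pP hz (rP _ aP).
have [uP hP dP xP] := pP; have BP := part_B pP.
have pA1 := hP _ A1P.
(* [near_one] asks for room in every diffuse cell and, when [Xf] is empty, also outside the
   partition; the extra piece O1 provides the latter. *)
have [L [[uL dL hL] LP LO]] : exists L, [/\ [/\ uniq L, djs L & {in L, forall a, piece a /\ dff a}],
    {in P, forall a, dff a -> a \in L} &
    Xf = set0 -> exists2 a, a \in L & dj a (uns P)].
  pose al := [seq a <- P | `[< dff a >]].
  have alP a : a \in al <-> a \in P /\ dff a.
    rewrite mem_filter; split; first by move=> /andP[/asboolP].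
    by move=> [h1 h2]; apply/andP; split => //; exact/asboolP.
  have ual : uniq al by exact: filter_uniq.
  have dal : djs al by move=> a b /alP[aP _] /alP[bP _]; exact: dP.
  have [Xf0|nX] := pselect (Xf = set0); last first.
    exists al; split => //; last by move=> a aP da; exact/alP.
    by split => // a /alP[/hP].
  have [|O1 [pO [_ sO] dO]] := INF pA1 _ (Buns BP); first by rewrite Xf0 => y.
  have dfO : dff O1 by case: (pO) => _ _ [/sO /atm_dff /(_ dA1)|].
  exists (O1 :: al); split => //; last 2 first.
  - by move=> a aP da; rewrite inE; apply/orP; right; exact/alP.
  - by move=> _; exists O1; rewrite ?mem_head.
  have key a : a \in al -> dj O1 a.
    by move=> /alP[aP _]; apply: (djS dO) => // y; exists a.
  split.
  - rewrite /= ual andbT; apply/negP => /key /dj_self; exact: piece_neq0.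
  - move=> a b; rewrite !inE => /orP[/eqP->|aP] /orP[/eqP->|bP] // n; [exact: key|exact/djC/key|exact: dal].
  - by move=> a; rewrite inE => /orP[/eqP->//|/alP[/hP]].
have A1L := LP _ A1P dA1.
have /choice[zz hzz] : forall a, exists z : nat -> set Y, a \in L ->
    (forall j, [/\ piece (z j), dff (z j) & z j `<=` a]) /\ forall i j, i <> j -> dj (z i) (z j).
  move=> a; have [aL|] := boolP (a \in L); last by exists (fun=> set0).
  by have [pa da] := hL _ aL; have [z hz] := disjoint_seq pa da; exists z.
(* For each k and each a in L there will be a set C k a inside A1 and a copy C' k a of the same mass
   inside a. [Some] of the index of a marks the former and [None] the latter, which keeps them
   disjoint even when a is A1. *)
pose pk (c : nat * option nat) : nat := pickle c.
have pk_inj : injective pk by exact: pcan_inj pickleK.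
have zdj u v i j : u \in L -> v \in L -> u <> v \/ i <> j -> dj (zz u i) (zz v j).
  move=> uL' vL h; have [E|n] := pselect (u = v).
    by rewrite E in h *; have [_ k] := hzz _ vL; apply: k; case: h.
  have [k1 _] := hzz _ uL'; have [k2 _] := hzz _ vL.
  by apply: (djS (dL _ _ uL' vL n)); [have [] := k1 i|have [] := k2 j].
have /choice[cc hcc] : forall ak : set Y * nat, exists cc : set Y * set Y, ak.1 \in L ->
    [/\ [/\ piece cc.1, dff cc.1 & cc.1 `<=` zz A1 (pk (ak.2, Some (index ak.1 L)))],
        [/\ piece cc.2, dff cc.2 & cc.2 `<=` zz ak.1 (pk (ak.2, None))] & mu cc.1 = mu cc.2].
  move=> [a k] /=; have [aL|] := boolP (a \in L); last by exists (set0, set0).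
  have [k1 _] := hzz _ A1L; have [k2 _] := hzz _ aL.
  have [p1 d1 _] := k1 (pk (k, Some (index a L))); have [p2 d2 _] := k2 (pk (k, None)).
  by have [c [c' h]] := same_measure p1 p2 d1 d2; exists (c, c').
pose C k a := (cc (a, k)).1; pose C' k a := (cc (a, k)).2.
have hC k a : a \in L -> [/\ piece (C k a), piece (C' k a), dff (C k a), dff (C' k a) & mu (C k a) = mu (C' k a)].
  by move=> aL; have [[? ? _] [? ? _] ?] := hcc (a, k) aL.
have C1 k a : a \in L -> C k a `<=` zz A1 (pk (k, Some (index a L))).
  by move=> aL; have [[]] := hcc (a, k) aL.
have C2 k a : a \in L -> C' k a `<=` zz a (pk (k, None)).
  by move=> aL; have [_ []] := hcc (a, k) aL.
have CA k a : a \in L -> C k a `<=` A1.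
  move=> aL; apply: subset_trans (C1 k a aL) _; have [h _] := hzz _ A1L.
  by have [] := h (pk (k, Some (index a L))).
have CA' k a : a \in L -> C' k a `<=` a.
  move=> aL; apply: subset_trans (C2 k a aL) _; have [h _] := hzz _ aL.
  by have [] := h (pk (k, None)).
have dCC' k l a b : a \in L -> b \in L -> dj (C k a) (C' l b).
  move=> aL bL; apply: (djS _ (C1 k a aL) (C2 l b bL)); apply: zdj => //; right.
  by move/pk_inj.
have dU k l a b : a \in L -> b \in L -> a <> b \/ k <> l ->
    dj (C k a `|` C' k a) (C l b `|` C' l b).
  move=> aL bL h y [y1|y1] [y2|y2].
  - have : dj (C k a) (C l b); last by move/(_ y); exact.
    apply: (djS _ (C1 k a aL) (C1 l b bL)); apply: zdj => //; right.
    move/pk_inj => -[E1 E2]; case: h => //; apply.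
    by rewrite -(nth_index set0 aL) E2 nth_index.
  - exact: (dCC' k l a b aL bL y).
  - exact: (dCC' l k b a bL aL y).
  - have : dj (C' k a) (C' l b); last by move/(_ y); exact.
    apply: (djS _ (C2 k a aL) (C2 l b bL)); apply: zdj => //.
    by case: h => h; [left|right => /pk_inj[]].
pose S k := uns [seq C k a `|` C' k a | a <- L].
have BS k : B (S k).
  apply: Buns => _ /mapP[a aL ->]; have [[? _ _] [? _ _] _ _ _] := hC k a aL; exact: BU.
have djS_ k l : k <> l -> dj (S k) (S l).
  move=> kl y [_ /mapP[a aL ->] y1] [_ /mapP[b bL ->] y2].
  by apply: (dU k l a b aL bL _ y) => //; right.
have /choice[tau htau] : forall k, exists x : aut, [/\ {in L, forall a, x (C k a) = C' k a},
    {in L, forall a, x (C' k a) = C k a} & supp x (S k)].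
  move=> k; apply: swaps => //; first by move=> a aL; exact: hC.
    by move=> a aL; exact: dCC'.
  by move=> a b aL bL n; apply: dU => //; left.
have /choice[ga hga] := glue BS djS_ (fun k => let: And3 _ _ h := htau k in h).
have /choice[m hm] := fun al => covA (ga al).
have [al [be [k [mE _ ak bk]]]] := cantor_bool m.
pose w := (ga al)^-1 * ga be.
have Ww : Wg w by exists (m al), (ga al), (ga be); split => //; rewrite mE.
have [t1 t2 ts] := htau k.
(* At k the two sequences differ: [ga be] acts on S k as tau k, while [ga al] commutes with
   everything supported there. So w acts on such automorphisms as conjugation by tau k. *)
have conjw (r : aut) : supp r (S k) -> io (acj (tau k) r) = w * (io r * w^-1).
  move=> sr; have h1 := hga be k r sr; rewrite bk in h1.
  have sr' : supp (acj (tau k) r) (S k).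
    move=> b Bb db /=; have -> : ag (tau k) b = b := supp_inv ts Bb db.
    by rewrite (sr _ Bb db); exact: ts.
  have h2 := hga al k _ sr'; rewrite ak in h2.
  rewrite /w invgM invgK !mulgA -(mulgA _ (ga be)) h1.
  by rewrite !mulgA mulgK -(mulgA _ _ (ga al)) -h2 mulKg.
pose CC := uns [seq C' k a | a <- L]; pose CS := uns [seq C k a | a <- L].
have BCC : B CC by apply: Buns => _ /mapP[a aL ->]; have [_ [? _ _] _ _ _] := hC k a aL.
have BCS : B CS by apply: Buns => _ /mapP[a aL ->]; have [[? _ _] _ _ _ _] := hC k a aL.
have dCC : dff CC by move=> y [_ /mapP[a aL ->] ay]; have [_ _ _ d _] := hC k a aL; exact: d.
have CCS : CC `<=` S k.
  by move=> y [_ /mapP[a aL ->] ay]; exists (C k a `|` C' k a); [apply/mapP; exists a|right].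
have CSA : CS `<=` A1 by move=> y [_ /mapP[a aL ->]]; exact: CA.
have tCS : tau k CS = CC.
  rewrite af_uns; last by move=> _ /mapP[a aL ->]; have [[? _ _] _ _ _ _] := hC k a aL.
  rewrite -map_comp; congr uns; apply/eq_in_map => a aL; exact: t1.
have [|e [e0 he]] := @pos_min ([seq mu (C' k a) | a <- L] ++ map mu P).
  move=> v; rewrite mem_cat => /orP[/mapP[a aL ->]|]; last exact: pmu.
  by have [_ p _ _ _] := hC k a aL; exact: piece_mu.
exists (uns P :: P), e; split => //.
  by move=> b; rewrite inE => /orP[/eqP->|/BP//]; exact: Buns.
move=> x hx.
have xa a : a \in P -> (mu (x a `\` a) < e)%R by move=> aP; apply: hx; rewrite inE aP orbT.
have eC a : a \in L -> (e <= mu (C' k a))%R.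
  by move=> aL; apply: he; rewrite mem_cat; apply/orP; left; apply/mapP; exists a.
have [|||p [q [p' [fp fp' sq E]]]] := @near_one P x CC pP BCC dCC.
- move=> a aP aa; apply: atm_near => //; first exact: BP.
  by apply: lt_le_trans (xa _ aP) _; apply: he; rewrite mem_cat map_f ?orbT.
- move=> a aP da; have aL := LP _ aP da; exists (C' k a); split.
  + by have [_ [? _ _] _ _ _] := hC k a aL.
  + move=> y ay; split; last exact: (CA' k a aL).
    by exists (C' k a) => //; apply/mapP; exists a.
  + exact: lt_le_trans (xa _ aP) (eC _ aL).
- move=> /LO[a aL dj_a]; exists (C' k a); split.
  + by have [_ [? _ _] _ _ _] := hC k a aL.
  + move=> y ay; split; first by exists (C' k a) => //; apply/mapP; exists a.
    by apply: dj_a; exact: (CA' k a aL).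
  + apply: lt_le_trans (eC _ aL); apply: hx; exact: mem_head.
(* Conjugation by tau k brings the support of q from CC, spread over all of L, into the single cell
   A1; therefore r fixes every cell of P. *)
pose r := amul (ainv (tau k)) (amul q (tau k)).
have sr : supp r (S k).
  move=> b Bb db /=; rewrite ts// sq//; last exact: (djS db).
  exact: (supp_inv ts).
have sr' : supp r CS.
  move=> b Bb db /=; rewrite sq ?afK//; first exact: afB.
  by rewrite -tCS; exact: af_dj.
have fr : {in P, forall a, r a = a}.
  move=> a aP; have [->|n] := pselect (a = A1); first by apply: (supp_fix BCS) => //; exact: BP.
  apply: sr'; first exact: BP.
  by apply: (djS (dP _ _ aP A1P n)).
have Eq : io q = w * (io r * w^-1).
  by rewrite -conjw//; apply: ioE => b Bb /=; rewrite !agK//; exact: afB.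
have Ex : io x = io (ainv p) * (w * (io r * w^-1) * io p').
  have := ioM p x; rewrite (@ioE (amul p x) (amul q p'))//= ioM Eq => ->.
  by rewrite ioV mulKg.
exists 14%N => //; rewrite Ex.
have fpV : {in P, forall a, ainv p a = a}.
  by move=> a aP; apply: fix_ag; [exact: BP|exact: fp].
apply: (@WnM 4 10); first exact: stab.
apply: (@WnM 6 4); last exact: stab.
apply: (@WnM 1 5); first exact: Wn1.
by apply: (@WnM 4 1); [exact: stab|exact/Wn1/WgV].
Qed.

End group.
End Core.

(** * Standard Borel spaces *)

Definition opn (Y : Type) (nr : nat -> Y -> Y -> Prop) (O : set Y) :=
  forall y, O y -> exists n, nr n y `<=` O.

(* nr n y z stands for dist y z < 2^-n. *)
Record polish d (Y : measurableType d) (nr : nat -> Y -> Y -> Prop) (xs : nat -> Y) : Prop := Polish {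
  p_refl : forall n y, nr n y y;
  p_sym : forall n y z, nr n y z -> nr n z y;
  p_tri : forall n x y z, nr n.+1 x y -> nr n.+1 y z -> nr n x z;
  p_sep : forall y z, (forall n, nr n y z) -> y = z;
  p_dense : forall y n, exists j, nr n (xs j) y;
  p_lim : forall s, (forall n, nr n (s n) (s n.+1)) -> exists l, forall n, nr n (s n.+2) l;
  p_meas : @measurable d Y = <<s opn nr >>;
  p_opn : forall n y, opn nr (nr n y) }.

Lemma half_pow_lt (R : realType) (e : R) : 0 < e -> exists n, 2^-1 ^+ n < e.
Proof.
move=> e0; have [n _ /(_ n (leqnn _)) /= h] := near_infty_natSinv_expn_lt (PosNum e0).
by exists n; move: h; rewrite exprVn div1r.
Qed.

(** The metric is kept only through the relations of being at distance less than 2^-n, transported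
    to Y; the sequel then needs no real-valued distance. *)
Lemma standard_polish (R : realType) d (Y : measurableType d) : standard_borel R Y -> Y ->
  exists nr xs, @polish d Y nr xs.
Proof.
move=> [X [D cD dD] [F [G FK GK] mF]] y0.
pose r n : R := 2^-1 ^+ n; have r0 n : 0 < r n by rewrite exprn_gt0// invr_gt0.
have rS n : r n = r n.+1 + r n.+1.
  by rewrite /r exprS; lra.
have /countable_injP[f fi] := cD.
have [x0 Dx0] : D !=set0.
  have [||x [_ ?]] := dD setT; [by exists (F y0)|exact: openT|by exists x].
have /choice[e he] : forall n, exists x, (exists2 x', D x' & f x' = n) -> D x /\ f x = n.
  move=> n; have [[x' Dx' fx']|h] := pselect (exists2 x', D x' & f x' = n); first by exists x'.
  by exists x0 => /h.
have eD x : D x -> e (f x) = x.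
  move=> Dx; have [|De fe] := he (f x); first by exists x.
  by apply: fi; rewrite ?inE.
pose nr n y z := ball (F y) (r n) (F z).
have opO B : open B -> opn nr (F @^-1` B).
  move=> oB y By; have /nbhs_ballP[e1 e10 eB] : nbhs (F y) B by exact: open_nbhs_nbhs.
  have [n hn] := half_pow_lt e10; exists n => z h; apply: eB.
  exact: le_ball (ltW hn) _ h.
exists nr, (fun n => G (e n)); split.
- by move=> n y; exact: ballxx.
- by move=> n y z; exact: ball_sym.
- by move=> n x y z h k; rewrite /nr rS; exact: ball_triangle k.
- move=> y z h; rewrite -(FK y) -(FK z); congr G; apply: mdist_positivity.
  apply/eqP; rewrite eq_le mdist_ge0 andbT leNgt; apply/negP => /half_pow_lt[n hn].
  by have := h n; rewrite /nr ballEmdist /= => /(lt_trans hn); rewrite ltxx.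
- move=> y n; have [||x [bx Dx]] := dD (ball (F y) (r n))°.
  + exists (F y); exact: nbhsx_ballx.
  + exact: open_interior.
  + exists (f x); rewrite /nr GK eD//; apply: ball_sym; exact: interior_subset bx.
- move=> s hs; pose x n := F (s n).
  have key k n : ball (x n) (r n + r n) (x (n + k)%N).
    elim: k n => [|k IH] n; first by rewrite addn0; apply: ballxx; rewrite addr_gt0.
    have := IH n.+1; rewrite -rS addSnnS => h; exact: ball_triangle (hs n) h.
  have : cauchy (x @ \oo).
    apply: cauchy_exP => eps eps0; have [n hn] := half_pow_lt eps0.
    exists (x n.+1); exists n.+1 => // m /= nm; apply: le_ball (ltW hn) _ _.
    by rewrite -/(r n) rS -(subnKC nm); exact: key.
  move/cauchy_cvg => /cvg_ex[l /cvg_ballP hl].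
  (* From n + 2 on the sequence stays within 2 r (n + 2) of its term there, and some later term is
     as close to the limit; together this is r n. *)
  exists (G l) => n; rewrite /nr GK (_ : r n = (r n.+2 + r n.+2) + (r n.+2 + r n.+2)); last by rewrite -!rS.
  have [m _ hm] := hl (r n.+2 + r n.+2) (addr_gt0 (r0 _) (r0 _)).
  apply: (ball_triangle (y := x (maxn n.+2 m))).
    by rewrite -(subnKC (leq_maxl n.+2 m)); exact: key.
  by apply: ball_sym; apply: hm; exact: leq_maxr.
- apply/seteqP; split=> A.
    have -> : A = F @^-1` (G @^-1` A) by apply/seteqP; split=> y /=; rewrite FK.
    move/mF; move: (G @^-1` A); apply: smallest_sub.
      have [s0 sC sU] := @sigma_algebra_measurable _ (g_sigma_algebraType (opn nr)).
      split.
      + by rewrite /= preimage_set0; exact: s0.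
      + by move=> B /= /sC; rewrite !setTD.
      + by move=> B_ /= /sU; rewrite preimage_bigcup.
    by move=> B oB /=; apply: sub_sigma_algebra; exact: opO.
  apply: smallest_sub; first exact: sigma_algebra_measurable.
  move=> O oO; have -> : O = F @^-1` (G @^-1` O) by apply/seteqP; split=> y /=; rewrite FK.
  apply/mF; apply: sub_sigma_algebra; rewrite openE => x /= /oO[n hn].
  apply/nbhs_ballP; exists (r n) => //= z bz; apply: hn.
  by rewrite /nr !GK.
- move=> n y; apply: (opO (ball (F y) (r n))); rewrite openE => z /=.
  rewrite ballEmdist /= => h; apply/nbhs_ballP.
  exists (r n - mdist (F y) z); first by rewrite /= subr_gt0.
  move=> w; rewrite !ballEmdist /= => h2; apply: le_lt_trans (metric_triangle _ z _) _.
  by rewrite addrC -ltrBrDr.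
Qed.

(** * Closing off under countably many operations *)

Section closure.
Variables (D : Type) (op : nat -> seq D -> D).

(** Trees labelled by natural numbers serve as terms: they are countable, so unpickling enumerates
    all their values. *)
Fixpoint term_eval (t : GenTree.tree nat) : D := match t with
  | GenTree.Leaf i => op i [::]
  | GenTree.Node i ts => op i (map term_eval ts) end.

Definition closure_enum (n : nat) : D :=
  term_eval (odflt (GenTree.Leaf 0%N) (unpickle n)).

Lemma closure_op i l : (forall x, List.In x l -> exists n, closure_enum n = x) ->
  exists n, closure_enum n = op i l.
Proof.
move=> h; have [ts ->] : exists ts, l = map term_eval ts.
  elim: l h => [|x l IH] h; first by exists [::].
  have [|ts ->] := IH; first by move=> z zl; apply: h; right.
  have [n <-] := h x (or_introl erefl).
  by exists ((odflt (GenTree.Leaf 0%N) (unpickle n)) :: ts).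
by exists (pickle (GenTree.Node i ts)); rewrite /closure_enum pickleK.
Qed.

Lemma closure_ind (P : D -> Prop) :
  (forall i l, (forall x, List.In x l -> P x) -> P (op i l)) -> forall n, P (closure_enum n).
Proof.
move=> h n; rewrite /closure_enum; move: (odflt _ _) => t.
move: t; fix IH 1 => -[i|i ts] /=; first by apply: h.
apply: h; elim: ts => [|t ts IHts] x //= [<-|]; first exact: IH.
exact: IHts.
Qed.
End closure.

(** * Subsets of prescribed measure *)

Section intermediate_value.
Context d (Y : measurableType d) (R : realType) (la : {measure set Y -> \bar R}).
Variables (nr : nat -> Y -> Y -> Prop) (xs : nat -> Y).
Hypothesis pY : polish nr xs.
Local Open Scope ereal_scope.

Lemma nr_measurable n (y : Y) : measurable (nr n y).
Proof. by rewrite (p_meas pY); apply: sub_sigma_algebra; exact: (p_opn pY). Qed.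

Lemma nr_mono n m y z : (n <= m)%N -> nr m y z -> nr n y z.
Proof.
move=> /subnK <-; elim: (m - n)%N => // k IH; rewrite addSn => h; apply: IH.
exact: (p_tri pY h (p_refl pY _ _)).
Qed.

Lemma set1_cap y : [set y] = \bigcap_n (nr n y : set Y).
Proof.
apply/seteqP; split=> z; first by move=> -> n _; exact: (p_refl pY).
by move=> h; apply/esym; apply: (p_sep pY) => n; exact: h.
Qed.

Lemma measurable_point (y : Y) : measurable [set y].
Proof. by rewrite set1_cap; apply: bigcapT_measurable => n; exact: nr_measurable. Qed.

Lemma small_nbhs b y (e : R) : measurable b -> la b < +oo -> la [set y] = 0 -> (0 < e)%R ->
  exists n, la (b `&` nr n y) < e%:E.
Proof.
move=> mb fb y0 e0; apply: contrapT => h.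
have mF n : measurable (b `&` nr n y) by apply: measurableI => //; exact: nr_measurable.
have le_e n : e%:E <= la (b `&` nr n y).
  by rewrite leNgt; apply/negP => l; apply: h; exists n.
have mI : measurable (\bigcap_n (b `&` nr n y)) by exact: bigcapT_measurable.
have cv : (la \o (fun n => b `&` nr n y)) @ \oo --> la (\bigcap_n (b `&` nr n y)).
  apply: nonincreasing_cvg_mu => //.
    by apply: le_lt_trans fb; apply: le_measure; rewrite ?inE.
  move=> n m nm; apply/subsetPset => z [bz hz]; split => //; exact: nr_mono hz.
have z0 : la (\bigcap_n (b `&` nr n y)) = 0.
  apply: (subset_measure0 (B := [set y])) => //; first exact: measurable_point.
  by move=> z hz; rewrite set1_cap => n _; have [] := hz n I.
rewrite z0 in cv.
have : e%:E <= lim ((la \o (fun n => b `&` nr n y)) @ \oo).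
  by apply: lime_ge; [apply/cvg_ex; exists 0|exact: nearW].
by rewrite (cvg_lim _ cv)// lee_fin leNgt e0.
Qed.

(* Greedy choice: add the k-th basic set whenever the total stays below v. *)
Lemma exact_subset b (v : R) : measurable b -> la b < +oo -> (forall y, b y -> la [set y] = 0) ->
  (0 < v)%R -> v%:E < la b -> exists c, [/\ measurable c, c `<=` b & la c = v%:E].
Proof.
move=> mb fb ab v0 vb.
pose u k := if unpickle k is Some nj then b `&` nr nj.1 (xs nj.2) else set0 : set Y.
have mu_ k : measurable (u k).
  by rewrite /u; case: unpickle => // -[n j]; apply: measurableI => //; exact: nr_measurable.
pose c := fix c k : set Y := if k is k'.+1 then
  (if la (c k' `|` u k') <= v%:E then c k' `|` u k' else c k') else set0.
have cS k : c k.+1 = if la (c k `|` u k) <= v%:E then c k `|` u k else c k by [].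
have mc k : measurable (c k).
  by elim: k => [|k IH]; [exact: measurable0|rewrite cS; case: ifP => // _; exact: measurableU].
have cb k : c k `<=` b.
  elim: k => [|k IH]; first exact: sub0set.
  rewrite cS; case: ifP => // _; rewrite subUset; split => //.
  by rewrite /u; case: unpickle => // -[n j] z [].
have cv k : la (c k) <= v%:E.
  by elim: k => [|k IH]; [rewrite measure0 lee_fin ltW|rewrite cS; case: ifP].
have cSsub k : c k `<=` c k.+1 by rewrite cS; case: ifP => _ z // h; left.
have cmono n m : (n <= m)%N -> c n `<=` c m.
  move=> /subnK <-; elim: (m - n)%N => // k IH; rewrite addSn; exact: subset_trans (cSsub _).
pose cc := \bigcup_k c k; have mcc : measurable cc by exact: bigcupT_measurable.
have ccb : cc `<=` b by move=> z [k _ /cb].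
have lcc : la cc <= v%:E.
  have h : (la \o c) @ \oo --> la cc.
    by apply: nondecreasing_cvg_mu => // n m nm; apply/subsetPset; exact: cmono.
  rewrite -(cvg_lim _ h)//; apply: lime_le; first by apply/cvg_ex; exists (la cc).
  exact: nearW.
exists cc; split => //; apply/eqP; rewrite eq_le lcc leNgt; apply/negP => lt.
have fcc : la cc \is a fin_num by rewrite ge0_fin_numE// (lt_trans lt)// ltry.
have e0 : (0 < v - fine (la cc))%R by rewrite subr_gt0 -lte_fin fineK.
(* If the total stays below v, every point of b has a basic set whose trace on b is smaller than the
   gap, and the greedy choice cannot have rejected it. *)
suff bcc : b `<=` cc.
  have : la b <= la cc by apply: le_measure; rewrite ?inE.
  by rewrite leNgt (lt_trans lt vb).
move=> y b_y; have [n hn] := small_nbhs mb fb (ab _ b_y) e0.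
have [j hj] := p_dense pY y n.+1.
pose k := pickle (n.+1, j); have uk : u k = b `&` nr n.+1 (xs j) by rewrite /u pickleK.
exists k.+1 => //; rewrite cS ifT; first by right; rewrite uk.
apply: le_trans (measureU2 _ (mc k) (mu_ k)) _.
have l1 : la (c k) <= la cc by apply: le_measure; rewrite ?inE// => z hz; exists k.
have l2 : la (u k) <= (v - fine (la cc))%:E.
  apply: ltW; apply: le_lt_trans hn; apply: le_measure; rewrite ?inE//.
    by apply: measurableI => //; exact: nr_measurable.
  rewrite uk => z [bz hz]; split => //; apply: (p_tri pY) hz.
  exact: (p_sym pY).
apply: le_trans (leeD l1 l2) _.
by rewrite -[X in X + _]fineK// -EFinD lee_fin subrKC.
Qed.

End intermediate_value.

(** * Realization of ring automorphisms by measure preserving bijections *)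

Section preserving.
Context d (Y : measurableType d) (R : realType) (la : {measure set Y -> \bar R}).
Local Open Scope ereal_scope.

Definition mmap (T : Y -> Y) := forall A, measurable A -> measurable (T @^-1` A).
Definition pmap (T : Y -> Y) := forall A, measurable A -> la (T @^-1` A) = la A.

Lemma measure_off (N X Z : set Y) : measurable N -> la N = 0 -> measurable X -> measurable Z ->
  X `\` N = Z `\` N -> la X = la Z.
Proof.
move=> mN N0 mX mZ E; rewrite (measureDI la mX mN) (measureDI la mZ mN) E; congr (_ + _).
have z W : measurable W -> la (W `&` N) = 0.
  move=> mW; apply: (subset_measure0 (B := N)) => //; exact: measurableI.
exact: (etrans (z _ mX) (esym (z _ mZ))).
Qed.

Lemma ae_null (P : set Y) : {ae la, forall y, P y} ->
  exists N, [/\ measurable N, la N = 0 & forall y, ~ N y -> P y].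
Proof.
move=> [N [mN N0 h]]; exists N; split => // y Ny; apply: contrapT => nP.
by apply: Ny; exact: h.
Qed.

Lemma null_ae (P N : set Y) : measurable N -> la N = 0 -> (forall y, ~ N y -> P y) ->
  {ae la, forall y, P y}.
Proof.
move=> mN N0 h; exists N; split => // y nP; apply: contrapT => /h; exact: nP.
Qed.

Lemma ae_pmap T (P : set Y) : mmap T -> pmap T -> {ae la, forall y, P y} -> {ae la, forall y, P (T y)}.
Proof.
move=> mT pT /ae_null[N [mN N0 h]]; apply: (@null_ae _ (T @^-1` N)); [exact: mT|by rewrite pT|].
by move=> y; exact: h.
Qed.

Lemma measure_bigcup_eq (P Q : nat -> set Y) : (forall k, measurable (P k)) ->
  (forall k, measurable (Q k)) -> trivIset setT P -> trivIset setT Q ->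
  (forall k, la (P k) = la (Q k)) -> la (\bigcup_k P k) = la (\bigcup_k Q k).
Proof.
move=> mP mQ tP tQ E; rewrite !measure_semi_bigcup//; try exact: bigcupT_measurable.
by apply: eq_eseriesr => k _.
Qed.

Lemma pres_pieces T (P Q : nat -> set Y) : mmap T -> (forall k, measurable (P k)) ->
  (forall k, measurable (Q k)) -> trivIset setT P -> trivIset setT Q ->
  \bigcup_k P k = \bigcup_k Q k ->
  (forall k A, measurable A -> la (Q k `&` T @^-1` A) = la (P k `&` A)) ->
  (forall y, ~ (\bigcup_k Q k) y -> T y = y) -> pmap T.
Proof.
move=> mT mP mQ tP tQ E h out A mA; have mTA := mT _ mA.
have mU : measurable (\bigcup_k Q k) by exact: bigcupT_measurable.
rewrite (measureDI la mTA mU) (measureDI la mA mU); congr (_ + _).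
  congr (la _); apply/seteqP; split=> y [h1 h2]; split => //; move: h1; by rewrite /= out.
rewrite -{2}E ![_ `&` \bigcup_k _]setIC !setI_bigcupl.
apply: measure_bigcup_eq => //.
- by move=> k; exact: measurableI.
- by move=> k; exact: measurableI.
- exact: trivIset_setIr.
- exact: trivIset_setIr.
- by move=> k; rewrite h.
Qed.

(** The points whose orbit under T or under S meets the exceptional null set form a null set again.
    Off it T and S are exact inverses; on it they are replaced by the identity. The inverse also
    shows that images of Borel sets are Borel. *)
Lemma mpbij_ae (T S : Y -> Y) : mmap T -> mmap S -> pmap T -> pmap S ->
  {ae la, forall y, S (T y) = y} -> {ae la, forall y, T (S y) = y} ->
  exists M : mpbij la, {ae la, forall y, M y = T y}.
Proof.
move=> mT mS pT pS /ae_null[N1 [mN1 N10 h1]] /ae_null[N2 [mN2 N20 h2]].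
pose N := N1 `|` N2; have mN : measurable N by exact: measurableU.
have N0 : la N = 0 by exact: null_set_setU.
have it f : mmap f -> pmap f -> forall n, measurable (iter n f @^-1` N) /\ la (iter n f @^-1` N) = 0.
  move=> mf pf; elim=> // n [IH1 IH2].
  have -> : iter n.+1 f @^-1` N = f @^-1` (iter n f @^-1` N).
    by apply/seteqP; split=> y; rewrite /preimage /= -iterSr -iterS.
  by split; [exact: mf|rewrite pf].
pose Bad := (\bigcup_n (iter n T @^-1` N)) `|` \bigcup_n (iter n S @^-1` N).
have mBad : measurable Bad.
  by apply: measurableU; apply: bigcupT_measurable => n; [have [] := it T mT pT n|have [] := it S mS pS n].
have Bad0 : la Bad = 0.
  apply: measure_negligible => //; apply: negligibleU; apply: negligible_bigcup => n.
    by have [m z] := it T mT pT n; apply/negligibleP.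
  by have [m z] := it S mS pS n; apply/negligibleP.
have NBad y : ~ Bad y -> S (T y) = y /\ T (S y) = y.
  move=> h; have nN : ~ N y by move=> Ny; apply: h; left; exists 0%N.
  by split; [apply: h1|apply: h2] => h'; apply: nN; [left|right].
have key (D : set Y) f g y : (forall z, ~ D z -> g (f z) = z) ->
   (forall z, D z <-> (exists n, N (iter n f z)) \/ exists n, N (iter n g z)) ->
   ~ D y -> ~ D (f y).
  move=> hgf hD nD /hD [[n hn]|[[|n] hn]]; apply: (nD); apply/hD.
  - by left; exists n.+1; rewrite iterSr.
  - by left; exists 1%N.
  - right; exists n; move: hn; by rewrite iterSr hgf.
have BadE z : Bad z <-> (exists n, N (iter n T z)) \/ exists n, N (iter n S z).
  by split=> [[[n _ h]|[n _ h]]|[[n h]|[n h]]]; [left|right|left|right]; exists n.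
have gT y : ~ Bad y -> ~ Bad (T y).
  by apply: (key Bad T S) => // z /NBad[].
have gS y : ~ Bad y -> ~ Bad (S y).
  by apply: (key Bad S T) => [z /NBad[]//|z]; rewrite BadE; tauto.
pose G f y := if pselect (Bad y) then y else f y : Y.
have Gb f y : Bad y -> G f y = y by rewrite /G; case: pselect.
have Gg f y : ~ Bad y -> G f y = f y by rewrite /G; case: pselect.
have GK f g : (forall y, ~ Bad y -> ~ Bad (f y)) -> (forall y, ~ Bad y -> g (f y) = y) ->
    cancel (G f) (G g).
  move=> hf hg y; have [b|nb] := pselect (Bad y); first by rewrite !Gb.
  by rewrite (Gg f)// Gg ?hg//; exact: hf.
have TSK : cancel (G T) (G S) by apply: GK => // y /NBad[].
have STK : cancel (G S) (G T) by apply: GK => // y /NBad[].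
have mG f : mmap f -> mmap (G f).
  move=> mf A mA; rewrite (_ : _ @^-1` A = (A `&` Bad) `|` (f @^-1` A `\` Bad)).
    by apply: measurableU; [exact: measurableI|apply: measurableD => //; exact: mf].
  apply/seteqP; split=> y; rewrite /preimage /=.
    by have [b|nb] := pselect (Bad y); [rewrite Gb//; left|rewrite Gg//; right].
  by move=> [[Ay b]|[Ay b]]; [rewrite Gb|rewrite Gg].
have pG : pmap (G T).
  move=> A mA; rewrite -(pT _ mA); apply: (measure_off mBad Bad0); [exact: mG|exact: mT|].
  by apply/seteqP; split=> y; rewrite /preimage /= => -[h nb]; split => //; move: h; rewrite Gg.
have bG : bijective (G T) by exists (G S).
have mGT : measurable_fun setT (G T) by move=> _ A mA; rewrite setTI; exact: mG.
have iG A : measurable A -> measurable (G T @` A).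
  move=> mA; rewrite (_ : _ @` A = G S @^-1` A); first exact: mG.
  apply/seteqP; split=> y; first by move=> [x Ax <-]; rewrite /preimage /= TSK.
  by move=> h; exists (G S y).
exists (MPBij bG mGT iG pG); apply: (null_ae mBad Bad0) => y nb /=.
exact: Gg.
Qed.
End preserving.

Section restricted_image.
Context d (Y : measurableType d) (R : realType) (la : {measure set Y -> \bar R}).
Variables (T : Y -> Y) (Q : set Y).
Local Open Scope ereal_scope.

(** The measurability proofs are arguments so that the structure of a measure can be attached to the
    definition. *)
Definition restricted_image (mT : mmap T) (mQ : measurable Q) (A : set Y) := la (Q `&` T @^-1` A).

Variables (mT : mmap T) (mQ : measurable Q).
Let m0 : restricted_image mT mQ set0 = 0.
Proof. by rewrite /restricted_image preimage_set0 setI0 measure0. Qed.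
Let m_ge0 A : 0 <= restricted_image mT mQ A.
Proof. exact: measure_ge0. Qed.
Let m_additive : semi_sigma_additive (restricted_image mT mQ).
Proof.
move=> F mF tF mUF; rewrite /restricted_image preimage_bigcup setI_bigcupr.
apply: measure_semi_sigma_additive.
- by move=> n; apply: measurableI => //; exact: mT.
- apply: trivIset_setIl; apply/trivIsetP => /= i j _ _ ij; rewrite -preimage_setI.
  by move/trivIsetP : tF => /(_ _ _ _ _ ij) ->//; rewrite preimage_set0.
- by apply: bigcupT_measurable => n; apply: measurableI => //; exact: mT.
Qed.
HB.instance Definition _ := isMeasure.Build _ _ _ (restricted_image mT mQ) m0 m_ge0 m_additive.
End restricted_image.

Section realization.
Context d (Y : measurableType d) (R : realType) (la : {measure set Y -> \bar R}).
Variables (nr : nat -> Y -> Y -> Prop) (xs : nat -> Y).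
Hypothesis pY : polish nr xs.
Variables (B : set (set Y)) (At Xf : set Y) (V : set R).
Let mu (b : set Y) : R := fine (la b).
Hypothesis H : mring B mu At Xf V.
Hypothesis hB : forall b, B b -> measurable b /\ (la b < +oo)%E.
Hypothesis hnr : forall b n j, B b -> B (b `&` nr n (xs j)).
Local Notation aut := (aut B mu).
Implicit Types (phi psi : aut) (b c A : set Y) (y z : Y).
Local Open Scope ereal_scope.

Let E := sval (cid (r_E H)).
Let BE k : B (E k). Proof. by have [+ _] := svalP (cid (r_E H)); exact. Qed.
Let EB b : B b -> exists k, E k = b. Proof. by have [_ +] := svalP (cid (r_E H)); exact. Qed.
Let Bm b : B b -> measurable b. Proof. by move=> /hB[]. Qed.
Let Bfin b : B b -> la b < +oo. Proof. by move=> /hB[]. Qed.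

Let la_mu b : B b -> la b = (mu b)%:E.
Proof. by move=> Bb; rewrite fineK// ge0_fin_numE//; exact: Bfin. Qed.

Let la_af phi b : B b -> la (phi b) = la b.
Proof. by move=> Bb; rewrite !la_mu// ?amu//; exact: afB. Qed.

Definition support := [set y | exists b, B b /\ b y].

Lemma support_sep y z : support y -> (forall b, B b -> (b y <-> b z)) -> y = z.
Proof.
move=> [b [Bb b_y]] h; apply: (p_sep pY) => n; have [j hj] := p_dense pY y n.+1.
have [_ hz] : (b `&` nr n.+1 (xs j)) z by apply/(h _ (hnr n.+1 j Bb)).
exact: (p_tri pY (p_sym pY hj) hz).
Qed.

Definition cell n j := [set y | nr n (xs j) y /\ forall i, (i < j)%N -> ~ nr n (xs i) y].

Lemma cell_B n j b : B b -> B (b `&` cell n j).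
Proof.
move=> Bb; suff h k : B (b `&` [set y | forall i, (i < k)%N -> ~ nr n (xs i) y]).
  have -> : b `&` cell n j = (b `&` [set y | forall i, (i < j)%N -> ~ nr n (xs i) y]) `&` nr n (xs j).
    by apply/seteqP; split=> y [h1 h2]; [case: h2|case: h1].
  exact: hnr.
elim: k => [|k IH]; first by rewrite (_ : [set _ | _] = setT) ?setIT//; apply/seteqP; split.
set D := (_ `&` _) in IH.
rewrite (_ : _ `&` _ = D `\` (D `&` nr n (xs k))); first by apply: (r_BD H) => //; exact: hnr.
apply/seteqP; split=> y.
  move=> [b_y hy]; have Dy : D y by split => // i ik; apply: hy; rewrite ltnS ltnW.
  by split => // -[_]; apply: hy.
move=> [[b_y hy] nD]; split => // i; rewrite ltnS leq_eqVlt => /orP[/eqP->|/hy//].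
by move=> h; apply: nD.
Qed.

Lemma cell_ex n y : exists j, cell n j y.
Proof.
have ex : exists j, `[< nr n (xs j) y >] by have [j hj] := p_dense pY y n; exists j; exact/asboolP.
have [j /asboolP hj mj] := ex_minnP ex; exists j; split => // i ij h.
have /mj : `[< nr n (xs i) y >] by exact/asboolP.
by rewrite leqNgt ij.
Qed.

Lemma cell_uq n i j y : cell n i y -> cell n j y -> i = j.
Proof.
move=> [h1 h2] [k1 k2]; case: (ltngtP i j) => // ij; first by case: (k2 _ ij).
by case: (h2 _ ij).
Qed.

(** Continuity from below carries preservation of measure over to countable unions, which may leave
    [B] and have infinite measure. *)
Lemma la_bigcup_af phi (b : nat -> set Y) : (forall k, B (b k)) ->
  la (\bigcup_k phi (b k)) = la (\bigcup_k b k).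
Proof.
move=> Bb; pose G := fix G m : set Y := if m is m'.+1 then G m' `|` b m' else set0.
have BG m : B (G m) by elim: m => [|m IH]; [exact: (r_B0 H)|exact: (r_BU H)].
have Gmono : {homo G : n m / (n <= m)%N >-> (n <= m)%O}.
  move=> n m /subnK <-; elim: (m - n)%N => // k IH; rewrite addSn.
  by apply: le_trans IH _; apply/subsetPset => z; left.
have Gb : \bigcup_m G m = \bigcup_k b k.
  apply/seteqP; split=> y.
    by move=> [m _]; elim: m => //= m IH [/IH//|h]; exists m.
  by move=> [k _ h]; exists k.+1 => //; right.
have pGb : \bigcup_m phi (G m) = \bigcup_k phi (b k).
  apply/seteqP; split=> y.
    move=> [m _]; elim: m => [|m IH] /=; first by rewrite (af0 H).
    by rewrite (afU H)// => -[/IH//|h]; exists m.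
  by move=> [k _ h]; exists k.+1 => //=; rewrite (afU H)//; right.
have c1 : (la \o G) @ \oo --> la (\bigcup_m G m).
  by apply: nondecreasing_cvg_mu => //; [move=> i; exact: (Bm (BG i))|apply: bigcupT_measurable => i; exact: (Bm (BG i))].
have c2 : (la \o (fun m => phi (G m))) @ \oo --> la (\bigcup_m phi (G m)).
  apply: nondecreasing_cvg_mu => //; [move=> i; exact: (Bm (afB phi (BG i)))|apply: bigcupT_measurable => i; exact: (Bm (afB phi (BG i)))|].
  by move=> n m /Gmono /subsetPset h; apply/subsetPset; exact: (afS H).
rewrite -Gb -pGb -(cvg_lim _ c1)// -(cvg_lim _ c2)//; congr (lim (_ @ \oo)).
by apply/funext => m /=; exact: la_af.
Qed.

(** The point map T to be built sends phi b to b, so it induces the inverse of phi. Here j names the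
    cell of level n where T y is expected. *)
Definition idx phi n y j := exists b, B b /\ phi (b `&` cell n j) y.

Lemma idx_uq phi n y i j : idx phi n y i -> idx phi n y j -> i = j.
Proof.
move=> [b [Bb h]] [c [Bc k]]; apply: contrapT => ij.
have d' : dj (b `&` cell n i) (c `&` cell n j).
  by move=> z [_ h1] [_ h2]; apply: ij; exact: cell_uq h1 h2.
exact: (af_dj H (cell_B n i Bb) (cell_B n j Bc) d' h k).
Qed.

Lemma idx_b phi n y j b : B b -> phi b y -> idx phi n y j -> phi (b `&` cell n j) y.
Proof.
move=> Bb h [c [Bc k]]; have Bcc := cell_B n j Bc.
have : phi (b `&` (c `&` cell n j)) y by rewrite (afI H).
apply: (afS H); [exact: (BI H)|exact: cell_B|].
by move=> z [h1 [h2 h3]].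
Qed.

Definition located phi := [set y | (exists b, B b /\ phi b y) /\ forall n, exists j, idx phi n y j].

Lemma located_lim phi y : located phi y -> exists z, forall n j, idx phi n.+3 y j -> nr n (xs j) z.
Proof.
move=> [[b [Bb b_y]] /choice[js hj]].
(* Consecutive centres are compared through a common point of their cells, which costs one level,
   and [p_lim] costs two; hence the shift by 3. *)
have [l hl] : exists l, forall n, nr n (xs (js n.+3)) l.
  apply: (p_lim pY (s := fun n => xs (js n.+1))) => n.
  have h1 := idx_b Bb b_y (hj n.+1); have h2 := idx_b Bb b_y (hj n.+2).
  have [w [w1 w2]] : exists w, cell n.+1 (js n.+1) w /\ cell n.+2 (js n.+2) w.
    apply: contrapT => nw.
    have d' : dj (b `&` cell n.+1 (js n.+1)) (b `&` cell n.+2 (js n.+2)).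
      by move=> z [_ z1] [_ z2]; apply: nw; exists z.
    exact: (af_dj H (cell_B _ _ Bb) (cell_B _ _ Bb) d' h1 h2).
  apply: (p_tri pY (y := w)); first by case: w1.
  by apply: (p_sym pY); apply: (nr_mono pY (m := n.+2)) => //; case: w2.
by exists l => n j /(idx_uq (hj n.+3)) <-.
Qed.

Lemma opn_measurable (O : set Y) : opn nr O -> measurable O.
Proof. by rewrite (p_meas pY) => h; exact: sub_sigma_algebra. Qed.

(** The level n + 3 is that of [opn_idx], so that O and its preimage under T are countable unions
    over the same indices. *)
Lemma opn_cells (O : set Y) y : opn nr O ->
  O y <-> exists n j, nr n (xs j) `<=` O /\ cell n.+3 j y.
Proof.
move=> oO; split=> [/oO[m hm]|[n [j [h [k _]]]]]; last first.
  by apply: h; apply: (nr_mono pY (m := n.+3)) => //; rewrite -addn3 leq_addr.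
have [j hj] := cell_ex m.+4 y; exists m.+1, j; split => // z hz; apply: hm.
apply: (p_tri pY (y := xs j)) => //; apply: (p_sym pY).
by apply: (nr_mono pY (m := m.+4)); [rewrite -addn4 -addn1 leq_add2l|case: hj].
Qed.

Lemma opn_idx phi (O : set Y) y z : opn nr O -> located phi y ->
  (forall n j, idx phi n.+3 y j -> nr n (xs j) z) ->
  O z <-> exists n j, nr n (xs j) `<=` O /\ idx phi n.+3 y j.
Proof.
move=> oO [_ ly] hz; split=> [/oO[m hm]|[n [j [h /hz]]]]; last exact: h.
have [j hj] := ly m.+4; exists m.+1, j; split => // w hw; apply: hm.
by apply: (p_tri pY (y := xs j)) => //; apply: (p_sym pY); exact: hz.
Qed.

Lemma idx_measurable phi n j : measurable [set y | idx phi n y j].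
Proof.
rewrite (_ : [set y | _] = \bigcup_k phi (E k `&` cell n j)).
  by apply: bigcupT_measurable => k; exact: (Bm (afB phi (cell_B n j (BE k)))).
apply/seteqP; split=> y; first by move=> [b [/EB[k <-] h]]; exists k.
by move=> [k _ h]; exists (E k).
Qed.

Lemma located_measurable phi : measurable (located phi).
Proof.
rewrite (_ : located phi = (\bigcup_k phi (E k)) `&` \bigcap_n \bigcup_j [set y | idx phi n y j]).
  apply: measurableI; first by apply: bigcupT_measurable => k; exact: (Bm (afB phi (BE k))).
  by apply: bigcapT_measurable => n; apply: bigcupT_measurable => j; exact: idx_measurable.
apply/seteqP; split=> y.
  move=> [[b [/EB[k <-] h]] hy]; split; first by exists k.
  by move=> n _; have [j hj] := hy n; exists j.
move=> [[k _ h] hy]; split; first by exists (E k).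
by move=> n; have [j _ hj] := hy n I; exists j.
Qed.

(** At each level the images of the cells of b have total mass that of phi b, which is finite, so
    they fill phi b up to a null set. *)
Lemma located_ae phi b : B b -> la (phi b `\` located phi) = 0.
Proof.
move=> Bb; have Bpb := afB phi Bb.
have mD : measurable (phi b `\` located phi).
  by apply: measurableD; [exact: Bm|exact: located_measurable].
apply: measure_negligible => //.
apply: (negligibleS (A := \bigcup_n (phi b `\` \bigcup_j phi (b `&` cell n j)))).
  move=> y [b_y nl]; apply: contrapT => nn; apply: nl; split; first by exists b.
  move=> n; apply: contrapT => nj; apply: nn; exists n => //; split => // -[j _ h].
  by apply: nj; exists j, b.
apply: negligible_bigcup => n; have mU : measurable (\bigcup_j phi (b `&` cell n j)).
  by apply: bigcupT_measurable => j; exact: (Bm (afB phi (cell_B n j Bb))).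
apply/negligibleP; first by apply: measurableD => //; exact: Bm.
set U := \bigcup_j _ in mU *.
have E1 : la (phi b) = la (phi b `\` U) + la (phi b `&` U) := measureDI la (Bm Bpb) mU.
have E2 : la U = la b.
  rewrite (la_bigcup_af phi (fun j => cell_B n j Bb)); congr (la _).
  apply/seteqP; split=> y; first by move=> [j _ []].
  by move=> b_y; have [j hj] := cell_ex n y; exists j.
have E3 : phi b `&` U = U.
  by apply/setIidPr => y [j _]; apply: (afS H) => //; exact: cell_B.
move: E1; rewrite E3 E2 la_af// la_mu// => E1.
have key (x : \bar R) : (mu b)%:E = x + (mu b)%:E -> x = 0.
  by case: x => [r| |] //= [Er]; rewrite (_ : r = 0%R)//; lra.
exact: key E1.
Qed.

Section limit_map.
Variables (phi : aut) (T : Y -> Y).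
Hypothesis hT : forall y, (located phi y -> forall n j, idx phi n.+3 y j -> nr n (xs j) (T y)) /\
  (~ located phi y -> T y = y).

Lemma limit_map_measurable : mmap T.
Proof.
move=> A mA; have : <<s opn nr >> A by rewrite -(p_meas pY).
move: A {mA}; apply: smallest_sub.
  have [s0 sC sU] := @sigma_algebra_measurable _ Y; split.
  - by rewrite /= preimage_set0.
  - by move=> A /= /sC; rewrite !setTD.
  - by move=> A /= /sU; rewrite preimage_bigcup.
move=> O oO /=; have mL := located_measurable phi.
rewrite (_ : _ @^-1` _ = (located phi `&` \bigcup_n \bigcup_j
   (if `[< nr n (xs j) `<=` O >] then [set y | idx phi n.+3 y j] else set0)) `|` (O `\` located phi)).
  apply: measurableU; last by apply: measurableD => //; exact: opn_measurable.
  apply: measurableI => //; apply: bigcupT_measurable => n; apply: bigcupT_measurable => j.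
  by case: asboolP => _ //; exact: idx_measurable.
apply/seteqP; split=> y; rewrite /preimage /=.
  have [h1 h2] := hT y; have [l|nl] := pselect (located phi y); last by rewrite h2//; right.
  move/(opn_idx oO l (h1 l)) => [n [j [s k]]]; left; split => //; exists n => //; exists j => //.
  by rewrite asboolT.
have [h1 h2] := hT y; move=> [[l [n _ [j _]]]|[h nl]]; last by rewrite h2.
by case: asboolP => // s k; apply/(opn_idx oO l (h1 l)); exists n, j.
Qed.

(** By uniqueness of finite measures it is enough to treat open sets O. There the left-hand set is,
    up to a null set, the union of the images of the cells that make up the right-hand one. *)
Lemma limit_map_measure b A : B b -> measurable A -> la (phi b `&` T @^-1` A) = la (b `&` A).
Proof.
move=> Bb; have mT := limit_map_measurable.
have mb := Bm Bb; have mpb := Bm (afB phi Bb).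
have mid : mmap (@idfun Y) by move=> X.
pose m1 := restricted_image la mT mpb; pose m2 := restricted_image la mid mb.
move=> mA; rewrite -[LHS]/(m1 A) -[RHS]/(m2 A); move: A mA.
apply: (measure_unique (opn nr) (fun=> setT)).
- exact: (p_meas pY).
- move=> O1 O2 o1 o2 y [/o1[n hn] /o2[m hm]]; exists (maxn n m) => z hz; split.
    by apply: hn; apply: (nr_mono pY) hz; exact: leq_maxl.
  by apply: hm; apply: (nr_mono pY) hz; exact: leq_maxr.
- by move=> _ y _; exists 0%N.
- by rewrite bigcup_const//; exists 0%N.
- move=> O oO; rewrite /m1 /m2 /= /restricted_image.
  pose bb m := if unpickle m is Some nj then
    (if `[< nr nj.1 (xs nj.2) `<=` O >] then b `&` cell nj.1.+3 nj.2 else set0) else set0.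
  have Bbb m : B (bb m).
    rewrite /bb; case: unpickle => [[n j]|]; last exact: (r_B0 H).
    by case: asboolP => _; [exact: cell_B|exact: (r_B0 H)].
  have -> : b `&` idfun @^-1` O = \bigcup_m bb m.
    apply/seteqP; split=> y.
      move=> [b_y /(opn_cells _ oO)[n [j [s k]]]]; exists (pickle (n, j)) => //.
      by rewrite /bb pickleK asboolT.
    move=> [m _]; rewrite /bb; case: unpickle => // -[n j]; case: asboolP => // s [b_y k].
    by split => //; apply/(opn_cells _ oO); exists n, j.
  rewrite -(la_bigcup_af phi Bbb).
  apply: (@measure_off _ _ _ _ (phi b `\` located phi)).
  + by apply: measurableD => //; exact: located_measurable.
  + exact: located_ae.
  + by apply: measurableI => //; exact: (mT _ (opn_measurable oO)).
  + by apply: bigcupT_measurable => m; exact: (Bm (afB phi (Bbb m))).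
  + have bbs m : phi (bb m) `<=` phi b.
      apply: (afS H) => //; rewrite /bb; case: unpickle => [[n j]|]; last by move=> y [].
      by case: asboolP => _ y [].
    have loc y : phi b y -> ~ (phi b `\` located phi) y -> located phi y.
      by move=> b_y nn; apply: contrapT => nl; apply: nn.
    apply/seteqP; split=> y.
      move=> [[b_y Oy] nn]; split => //; have l := loc _ b_y nn; have [h1 _] := hT y.
      move/(opn_idx oO l (h1 l)): Oy => [n [j [s k]]]; exists (pickle (n, j)) => //.
      by rewrite /bb pickleK asboolT//; exact: idx_b.
    move=> [[m _ hm] nn]; have b_y := bbs _ _ hm; split => //; split => //.
    have l := loc _ b_y nn; have [h1 _] := hT y; apply/(opn_idx oO l (h1 l)).
    move: hm; rewrite /bb; case: unpickle => [[n j]|]; last by rewrite (af0 H).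
    case: asboolP => [s h|_]; last by rewrite (af0 H).
    by exists n, j; split => //; exists b.
- move=> _; rewrite /m1 /= /restricted_image; apply: le_lt_trans (Bfin (afB phi Bb)).
  by apply: le_measure; rewrite ?inE//; apply: measurableI => //; exact: (mT _ measurableT).
Qed.

Lemma limit_map_ae : {ae la, forall y, forall b, B b -> (b (T y) <-> phi b y)}.
Proof.
have mT := limit_map_measurable.
suff : {ae la, forall y, forall k, (E k (T y) <-> phi (E k) y)}.
  by apply: filterS => y h b /EB[k <-].
apply: ae_foralln => k; pose b := E k; have Bb : B b := BE k.
(* The two ways to fail: y lies in the image of E i minus b but T y in b, or y lies in phi b but T y
   outside b. Both sets are null by [limit_map_measure]. *)
pose N i := (phi (E i `\` b) `&` T @^-1` b) `|` (phi b `&` T @^-1` (~` b)).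
have mb := Bm Bb; have BD i : B (E i `\` b) by exact: (r_BD H).
have mN i : measurable (N i).
  apply: measurableU; apply: measurableI; [exact: (Bm (afB phi (BD i)))|exact: mT|exact: (Bm (afB phi Bb))|].
  by apply: mT; exact: measurableC.
have N0 i : la (N i) = 0.
  have h1 : la (phi (E i `\` b) `&` T @^-1` b) = 0.
    by rewrite limit_map_measure// setDE -setIA setICl setI0 measure0.
  have h2 : la (phi b `&` T @^-1` (~` b)) = 0.
    by rewrite limit_map_measure ?setICr ?measure0//; exact: measurableC.
  apply: null_set_setU => //; apply: measurableI; [exact: (Bm (afB phi (BD i)))|exact: mT|exact: (Bm (afB phi Bb))|].
  by apply: mT; exact: measurableC.
have mU : measurable (\bigcup_i N i) by exact: bigcupT_measurable.
apply: (null_ae mU).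
  by apply: measure_negligible => //; apply: negligible_bigcup => i; apply/negligibleP; [exact: mN|exact: N0].
move=> y nN; split=> h; apply: contrapT => nb; apply: nN; last first.
  by exists 0%N => //; right.
suff [i Ei] : exists i, phi (E i) y.
  by exists i => //; left; split => //; rewrite afD//.
have [l|nl] := pselect (located phi y).
  by have [[c [/EB[i <-] cy]] _] := l; exists i.
have [_ h2] := hT y; rewrite h2// in h.
by have [i Ei] := EB (agB phi Bb); exists i; rewrite Ei agK.
Qed.

Let BdE k : B (seqDU E k).
Proof.
apply: (r_BD H) => //; elim/big_ind: _ => [|a b Ba Bb|i _]; [exact: (r_B0 H)|exact: (r_BU H)|exact: BE].
Qed.

Lemma limit_map_out y : ~ support y -> T y = y.
Proof.
by move=> ns; have [_] := hT y; apply=> -[[b [Bb h]] _]; apply: ns; exists (phi b); split => //; exact: afB.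
Qed.

Lemma limit_map_pmap : pmap la T.
Proof.
have phiU k : phi (\big[setU/set0]_(i < k) E i) = \big[setU/set0]_(i < k) phi (E i).
  elim: k => [|k IH]; first by rewrite !big_ord0 (af0 H).
  rewrite !big_ord_recr /= (afU H) ?IH//.
  by elim/big_ind: _ => [|a b Ba Bb|i _]; [exact: (r_B0 H)|exact: (r_BU H)|exact: BE].
have QE : (fun k => phi (seqDU E k)) = seqDU (fun k => phi (E k)).
  apply/funext => k; rewrite /seqDU afD ?phiU//.
  by elim/big_ind: _ => [|a b Ba Bb|i _]; [exact: (r_B0 H)|exact: (r_BU H)|exact: BE].
have Esup : \bigcup_k E k = support.
  apply/seteqP; split=> y; first by move=> [k _ h]; exists (E k).
  by move=> [b [/EB[k <-] h]]; exists k.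
have phisup : \bigcup_k phi (E k) = support.
  apply/seteqP; split=> y; first by move=> [k _ h]; exists (phi (E k)); split => //; exact: afB.
  by move=> [b [Bb h]]; have [k Ek] := EB (agB phi Bb); exists k => //; rewrite Ek agK.
apply: (@pres_pieces _ _ _ _ _ (seqDU E) (fun k => phi (seqDU E k))).
- exact: limit_map_measurable.
- by move=> k; exact: (Bm (BdE k)).
- by move=> k; exact: (Bm (afB phi (BdE k))).
- exact: trivIset_seqDU.
- by rewrite QE; exact: trivIset_seqDU.
- by rewrite QE -!seqDU_bigcup_eq Esup phisup.
- by move=> k A mA; apply: limit_map_measure.
- by move=> y; rewrite QE -seqDU_bigcup_eq phisup; exact: limit_map_out.
Qed.

End limit_map.

(** Being the identity off the support makes the realization unique up to null sets. *)
Definition realizes (M : mpbij la) phi := {ae la, forall y,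
  (forall b, B b -> (b y <-> phi b (M y))) /\ (~ support y -> M y = y)}.

Lemma limit_ex phi : exists T, [/\ mmap T, pmap la T,
  {ae la, forall y, forall b, B b -> (b (T y) <-> phi b y)} & forall y, ~ support y -> T y = y].
Proof.
have /choice[T hT] : forall y, exists z,
    (located phi y -> forall n j, idx phi n.+3 y j -> nr n (xs j) z) /\ (~ located phi y -> z = y).
  move=> y; have [l|nl] := pselect (located phi y); last by exists y.
  by have [z hz] := located_lim l; exists z.
exists T; split; [exact: limit_map_measurable hT|exact: limit_map_pmap hT|exact: limit_map_ae hT|].
exact: limit_map_out hT.
Qed.

(** The limit maps of phi and of its inverse are inverse to each other almost everywhere, because
    [B] separates the points of its support. The limit map of the inverse is the one that realizes
    phi. *)
Lemma realize phi : exists M, realizes M phi.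
Proof.
have [T [mT pT aT oT]] := limit_ex phi; have [S [mS pS aS oS]] := limit_ex (ainv H phi).
have comp (f g : aut) F G : mmap F -> pmap la F ->
    {ae la, forall y, forall b, B b -> (b (F y) <-> f b y)} -> (forall y, ~ support y -> F y = y) ->
    {ae la, forall y, forall b, B b -> (b (G y) <-> g b y)} -> (forall y, ~ support y -> G y = y) ->
    (forall b, B b -> f (g b) = b) -> {ae la, forall y, G (F y) = y}.
  move=> mF pF aF oF aG oG fg.
  apply: filterS2 aF (ae_pmap mF pF aG) => y h1 h2.
  have [s|ns] := pselect (support y); last by rewrite oF// oG.
  apply/esym; apply: support_sep => // b Bb.
  have Bg := afB g Bb; split=> [b_y|/(h2 _ Bb)/(h1 _ Bg)]; last by rewrite fg.
  by apply/(h2 _ Bb)/(h1 _ Bg); rewrite fg.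
have [M hM] := mpbij_ae mS mT pS pT
  (comp _ _ _ _ mS pS aS oS aT oT (fun b Bb => afK phi Bb))
  (comp _ _ _ _ mT pT aT oT aS oS (fun b Bb => agK phi Bb)).
exists M; apply: filterS2 hM aS => y -> h; split; last exact: oS.
by move=> b Bb; have := h _ (afB phi Bb); rewrite /= afK//; tauto.
Qed.

Implicit Types (M N : mpbij la).

Definition cl (M : mpbij la) : Aut la := (\pi_(Aut la) M)%qT.

Lemma cl_eq M N : {ae la, forall y, M y = N y} -> cl M = cl N.
Proof. by move=> h; apply/eqP/Aut_eqP. Qed.

Lemma cl_ae M N : cl M = cl N -> {ae la, forall y, M y = N y}.
Proof. by move=> /eqP/Aut_eqP. Qed.

Lemma clM M N : cl (mpbijM M N) = (cl M * cl N)%g.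
Proof. by rewrite -[RHS]/(AutM (cl M) (cl N)) AutME. Qed.

Lemma realizes_support M phi : realizes M phi -> {ae la, forall y, support y <-> support (M y)}.
Proof.
apply: filterS => y [h1 h2]; split.
  by move=> [b [Bb /(h1 _ Bb) h]]; exists (phi b); split => //; exact: afB.
by move=> s; apply: contrapT => ns; apply: (ns); move: s; rewrite h2.
Qed.

Lemma realizes_uniq M N phi : realizes M phi -> realizes N phi -> cl M = cl N.
Proof.
move=> hM hN; apply: cl_eq; have sM := realizes_support hM.
apply: filterS3 hM hN sM => y [h1 h2] [k1 k2] s.
have [sy|ns] := pselect (support y); last by rewrite h2 ?k2.
apply: support_sep; first exact/s.
move=> c Bc; have Bg := agB phi Bc; have := h1 _ Bg; have := k1 _ Bg.
by rewrite agK//; tauto.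
Qed.

Lemma realizesM M N phi psi : realizes M phi -> realizes N psi ->
  realizes (mpbijM M N) (amul phi psi).
Proof.
move=> hM hN; apply: filterS2 hN (ae_preimage N hM) => y [h1 h2] [k1 k2]; split.
  by move=> b Bb /=; have := h1 _ Bb; have := k1 _ (afB psi Bb); tauto.
by move=> ns /=; move: k2; rewrite h2//; exact.
Qed.

Lemma realizesV M phi : realizes M phi -> realizes (mpbijV M) (ainv H phi).
Proof.
move=> hM; apply: filterS2 (ae_preimage (mpbijV M) hM) (ae_preimage (mpbijV M) (realizes_support hM)).
move=> y; rewrite /= mpfun_invK => -[h1 h2] s; split.
  by move=> b Bb; have := h1 _ (agB phi Bb); rewrite agK//; tauto.
by move=> ns; apply/esym/h2 => sy; apply/ns/s.
Qed.

Lemma realizes_ext M phi psi : (forall b, B b -> phi b = psi b) -> realizes M phi -> realizes M psi.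
Proof.
by move=> h; apply: filterS => y [h1 h2]; split => // b Bb; rewrite -h//; exact: h1.
Qed.

Definition rlz phi : mpbij la := projT1 (cid (realize phi)).
Lemma rlzP phi : realizes (rlz phi) phi. Proof. by rewrite /rlz; case: cid. Qed.
Definition io phi : Aut la := cl (rlz phi).

Lemma ioP M phi : realizes M phi -> cl M = io phi.
Proof. by move=> h; apply: realizes_uniq h (rlzP phi). Qed.

Lemma ioM phi psi : io (amul phi psi) = (io phi * io psi)%g.
Proof. by rewrite -clM; apply/esym/ioP/realizesM; exact: rlzP. Qed.

Lemma io_ext phi psi : (forall b, B b -> phi b = psi b) -> io phi = io psi.
Proof. by move=> h; apply: ioP; apply: realizes_ext h (rlzP phi). Qed.

Lemma supp_realizes M phi S : B S -> supp phi S -> realizes M phi ->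
  {ae la, forall y, (S y <-> S (M y)) /\ (~ S y -> M y = y)}.
Proof.
move=> BS sS; apply: filterS => y [h1 h2].
have hS : S y <-> S (M y) by have := h1 _ BS; rewrite (supp_self H).
split => // nS; have [s|ns] := pselect (support y); last exact: h2.
apply/esym; apply: support_sep => // b Bb.
have BD : B (b `\` S) by exact: (r_BD H).
have := h1 _ BD; rewrite sS//; last by move=> z [].
move=> [k1 k2]; split; first by move=> b_y; have [] := k1 (conj b_y nS).
by move=> b_y; have [|] := k2; first by split => // /hS.
Qed.

Lemma glue_map (S : nat -> set Y) (f : nat -> Y -> Y) : (forall k, measurable (S k)) ->
  trivIset setT S -> (forall k, mmap (f k)) ->
  (forall k A, measurable A -> la (S k `&` f k @^-1` A) = la (S k `&` A)) ->
  exists T, [/\ forall k y, S k y -> T y = f k y, forall y, ~ (\bigcup_k S k) y -> T y = y,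
    mmap T & pmap la T].
Proof.
move=> mS tS mf pf.
have /choice[T hT] : forall y, exists z,
    (forall k, S k y -> z = f k y) /\ (~ (\bigcup_k S k) y -> z = y).
  move=> y; have [[k _ Sk]|n] := pselect ((\bigcup_k S k) y); last first.
    by exists y; split => // k Sk; case: n; exists k.
  exists (f k y); split; last by case; exists k.
  by move=> l Sl; congr (f _ y); apply: (tS k l I I); exists y.
have T1 k y : S k y -> T y = f k y by have [h _] := hT y; exact: h.
have T2 y : ~ (\bigcup_k S k) y -> T y = y by have [_ h] := hT y; exact: h.
have mT : mmap T.
  move=> A mA; rewrite (_ : T @^-1` A = (\bigcup_k (S k `&` f k @^-1` A)) `|` (A `\` \bigcup_k S k)).
    apply: measurableU; last by apply: measurableD => //; exact: bigcupT_measurable.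
    by apply: bigcupT_measurable => k; apply: measurableI => //; exact: mf.
  apply/seteqP; split=> y; rewrite /preimage /=.
    have [[k _ Sk]|n] := pselect ((\bigcup_k S k) y); last by rewrite T2//; right.
    by rewrite (T1 k)// => h; left; exists k.
  by move=> [[k _ [Sk h]]|[h n]]; [rewrite (T1 k)|rewrite T2].
exists T; split => //; apply: (@pres_pieces _ _ _ _ _ S S) => // k A mA.
rewrite -[RHS]pf//; congr (la _); apply/seteqP; split=> y [Sk h]; split => //; move: h;
  by rewrite /preimage /= (T1 k).
Qed.

Lemma supp_measure M phi S A : B S -> supp phi S -> realizes M phi -> measurable A ->
  la (S `&` M @^-1` A) = la (S `&` A).
Proof.
move=> BS sS hM mA; have mS := Bm BS.
have mSA : measurable (S `&` A) by exact: measurableI.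
rewrite -(mpfun_preserving M mSA).
have [N [mN N0 hN]] := ae_null (supp_realizes BS sS hM).
apply: (measure_off mN N0).
- by apply: measurableI => //; exact: mpfun_preimage.
- exact: mpfun_preimage.
- by apply/seteqP; split=> y [[h1 h2] nN]; have [h _] := hN _ nN; split => //; split => //; exact/h.
Qed.

(** The glued map is the realization of tau k on each selected S k and the identity elsewhere,
    whence the commutation when al k is false. *)
Lemma io_glue (tau : nat -> aut) (S : nat -> set Y) : (forall k, B (S k)) ->
  (forall k l, k <> l -> dj (S k) (S l)) -> (forall k, supp (tau k) (S k)) ->
  forall al : nat -> bool, exists g : Aut la, forall k (r : aut), supp r (S k) ->
  (g * io r = io (if al k then acj H (tau k) r else r) * g)%g.
Proof.
move=> BS dS sS al; pose S' k := if al k then S k else set0.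
have S'S k : S' k `<=` S k by rewrite /S'; case: (al k).
have mS' k : measurable (S' k) by rewrite /S'; case: (al k) => //; exact: (Bm (BS k)).
have tS' : trivIset setT S'.
  apply/trivIsetP => i j _ _ /eqP ij; rewrite -subset0 => y [/S'S hi /S'S hj].
  exact: (dS _ _ ij y hi hj).
have mM (M : mpbij la) : mmap M by move=> A mA; exact: mpfun_preimage.
have pM (x : nat -> aut) (M : nat -> mpbij la) : (forall k, supp (x k) (S k)) ->
    (forall k, realizes (M k) (x k)) ->
    forall k A, measurable A -> la (S' k `&` M k @^-1` A) = la (S' k `&` A).
  move=> hx hM k A mA; rewrite /S'; case: (al k); last by rewrite !set0I.
  exact: supp_measure (BS k) (hx k) (hM k) mA.
pose M k := rlz (tau k); have hM k : realizes (M k) (tau k) by exact: rlzP.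
have sV k : supp (ainv H (tau k)) (S k) by exact: supp_inv.
have hV k : realizes (mpbijV (M k)) (ainv H (tau k)) by exact: realizesV.
have [T [T1 T2 mT pT]] := glue_map mS' tS' (fun k => mM (M k)) (pM _ _ sS hM).
have [U [U1 U2 mU pU]] := glue_map mS' tS' (fun k => mM (mpbijV (M k))) (pM _ _ sV hV).
have keep (x : nat -> aut) (N : nat -> mpbij la) : (forall k, supp (x k) (S k)) ->
    (forall k, realizes (N k) (x k)) -> {ae la, forall y, forall k, S' k y -> S' k (N k y)}.
  move=> hx hN; apply: ae_foralln => k.
  apply: filterS (supp_realizes (BS k) (hx k) (hN k)) => y [h _].
  by rewrite /S'; case: (al k) => // /h.
have inv_ (N N' : nat -> mpbij la) F G (x : nat -> aut) : (forall k, supp (x k) (S k)) ->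
    (forall k, realizes (N k) (x k)) -> (forall k, cancel (N k) (N' k)) ->
    (forall k y, S' k y -> F y = N k y) -> (forall y, ~ (\bigcup_k S' k) y -> F y = y) ->
    (forall k y, S' k y -> G y = N' k y) -> (forall y, ~ (\bigcup_k S' k) y -> G y = y) ->
    {ae la, forall y, G (F y) = y}.
  move=> hx hN NK F1 F2 G1 G2; apply: filterS (keep _ _ hx hN) => y h.
  have [[k _ Sk]|n] := pselect ((\bigcup_k S' k) y); last by rewrite F2// G2.
  by rewrite (F1 k)// (G1 k) ?NK//; exact: h.
have [g0 hg] := mpbij_ae mT mU pT pU
  (inv_ M (fun k => mpbijV (M k)) T U tau sS hM (fun k => mpfunK (M k)) T1 T2 U1 U2)
  (inv_ (fun k => mpbijV (M k)) M U T _ sV hV (fun k => mpfun_invK (M k)) U1 U2 T1 T2).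
exists (cl g0) => k r sr; set r' := if al k then _ else _.
have sr' : supp r' (S k).
  rewrite /r'; case: (al k) => // b Bb db /=.
  have -> : ag (tau k) b = b := supp_inv H (sS k) Bb db.
  by rewrite sr// sS.
rewrite /io -!clM; apply: cl_eq.
have hr := supp_realizes (BS k) sr (rlzP r).
have hr' := supp_realizes (BS k) sr' (rlzP r').
have k1 := ae_preimage (rlz r) hg.
have k2 := ae_preimage g0 hr'.
have k3 := keep _ _ sS hM.
have k4 : {ae la, forall y, al k -> M k (rlz r y) = rlz r' (M k y)}.
  case ak: (al k); last by apply: aeW.
  have : cl (mpbijM (M k) (rlz r)) = cl (mpbijM (rlz r') (M k)).
    rewrite !clM -!/(io _) -!ioM; apply: io_ext => b Bb.
    by rewrite /r' ak /= afK.
  by move/cl_ae; apply: filterS => y.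
apply: filterS3 (filterI hg hr) (filterI k1 k2) (filterI k3 k4).
move=> y [e1 [a1 a2]] [e2 [b1 b2]] [c1 c2] /=.
have [Sy|nS] := pselect (S k y).
  have SMy : S k (rlz r y) by exact/a1.
  case ak: (al k).
    have S'y z : S k z -> S' k z by rewrite /S' ak.
    by rewrite e2 e1 (T1 k) ?(T1 k y); [exact: c2|exact: S'y|exact: S'y].
  have out z : S k z -> ~ (\bigcup_l S' l) z.
    move=> Sz [l _ S'l]; have [kl|kl] := pselect (k = l).
      by move: S'l; rewrite -kl /S' ak.
    by apply: (dS _ _ kl z Sz); exact: S'S.
  by rewrite e2 e1 (T2 y (out _ Sy)) (T2 _ (out _ SMy)) /r' ak.
rewrite a2// b2// => Sg; apply: nS; move: Sg; rewrite e1.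
have [[l _ S'l]|n] := pselect ((\bigcup_l S' l) y); last by rewrite T2.
rewrite (T1 l)// => Sk; have Sl := S'S _ _ (c1 _ S'l).
have [kl|kl] := pselect (k = l); first by rewrite kl; exact: S'S.
by case: (dS _ _ kl _ Sk Sl).
Qed.

End realization.

(** * Atoms and closing off *)

(** Singletons and empty sets are enumerated instead of points, so that an empty A requires no
    separate treatment. *)
Lemma countable_points (T : Type) (A : set T) : countable A -> exists e : nat -> set T,
  (forall n, e n = set0 \/ exists2 y, A y & e n = [set y]) /\
  forall y, A y -> exists n, e n = [set y].
Proof.
move=> /countable_injP[f fi]; exists (fun n => [set y | A y /\ f y = n]).
have E y : A y -> [set z | A z /\ f z = f y] = [set y].
  move=> Ay; apply/seteqP; split=> z; last by move=> ->.
  by move=> [Az fz]; apply: fi; rewrite ?inE.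
split=> [n|y Ay]; last by exists (f y); exact: E.
have [[y [Ay <-]]|h] := pselect (exists y, A y /\ f y = n); first by right; exists y => //; exact: E.
by left; rewrite -subset0 => z hz; apply: h; exists z.
Qed.

Section atoms.
Context d (Y : measurableType d) (R : realType) (la : {sigma_finite_measure set Y -> \bar R}).
Variables (nr : nat -> Y -> Y -> Prop) (xs : nat -> Y).
Hypothesis pY : polish nr xs.
Local Open Scope ereal_scope.

Let mpt (y : Y) : measurable [set y]. Proof. exact: (measurable_point pY). Qed.

Lemma exhaustion : exists F : nat -> set Y, [/\ \bigcup_k F k = setT,
  {homo F : n m / (n <= m)%N >-> (n <= m)%O} & forall k, measurable (F k) /\ la (F k) < +oo].
Proof.
have /sigma_finiteP[F [FT Fm Ff]] := sigma_finiteT la.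
by exists F; split.
Qed.

Lemma la_point_fin (y : Y) : la [set y] < +oo.
Proof.
have [F [FT _ hF]] := exhaustion; have : (\bigcup_k F k) y by rewrite FT.
move=> [k _ Fy]; have [mF fF] := hF k; apply: le_lt_trans fF.
by apply: le_measure; rewrite ?inE// => z ->.
Qed.

Lemma heavy_points_finite (D : set Y) (e : R) : measurable D -> la D < +oo -> (0 < e)%R ->
  finite_set [set y | D y /\ e%:E <= la [set y]].
Proof.
move=> mD fD e0; apply: contrapT => /infiniteP/pcard_leP[f].
pose g n := (f n : Y).
have gi i j : g i = g j -> i = j by move/(@inj _ _ _ f); apply; rewrite inE.
have gP n : D (g n) /\ e%:E <= la [set g n] by exact: (@funS _ _ _ _ f n I).
have Dfin : la D \is a fin_num by rewrite ge0_fin_numE.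
pose v := fine (la D); have v0 : (0 <= v)%R by exact: fine_ge0.
(* v + 1 rather than v, which may vanish; n is chosen so that n + 1 points of mass e outweigh D. *)
have ev0 : (0 < e / (v + 1))%R by rewrite divr_gt0// ltr_wpDl.
have [n _ /(_ n (leqnn _)) /= hn] := near_infty_natSinv_lt (PosNum ev0).
have {}hn : (v < n.+1%:R * e)%R.
  have n0 : (0 < n.+1%:R :> R)%R by rewrite ltr0n.
  move: hn; rewrite ltr_pdivlMr ?ltr_wpDl// mulrC ltr_pdivrMr// mulrC; lra.
pose U := fix U m : set Y := if m is m'.+1 then U m' `|` [set g m'] else set0.
have UE m y : U m y -> exists2 i, (i < m)%N & y = g i.
  elim: m => //= m IH [/IH[i im ->]|->]; first by exists i => //; rewrite ltnS ltnW.
  by exists m.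
have mU m : measurable (U m) by elim: m => [|m IH]; [exact: measurable0|exact: measurableU].
have hU m : (m%:R * e)%:E <= la (U m).
  elim: m => [|m IH]; first by rewrite mul0r measure0.
  rewrite /= measureU//.
    by rewrite -natr1 mulrDl mul1r EFinD leeD//; have [] := gP m.
  rewrite -subset0 => y [/UE[i im ->] /gi im']; by rewrite im' ltnn in im.
have : (n.+1%:R * e)%:E <= la D.
  apply: le_trans (hU n.+1) _; apply: le_measure; rewrite ?inE// => y /UE[i _ ->].
  by have [] := gP i.
by rewrite -(fineK Dfin) lee_fin leNgt hn.
Qed.

Definition atoms := [set y : Y | 0 < la [set y]].

Lemma atoms_countable : countable atoms.
Proof.
have [F [FT _ hF]] := exhaustion.
have -> : atoms = \bigcup_k \bigcup_m [set y | F k y /\ (m.+1%:R^-1)%:E <= la [set y]].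
  apply/seteqP; split=> y.
    move=> y0; have : (\bigcup_k F k) y by rewrite FT.
    move=> [k _ Fy]; exists k => //.
    have fy : la [set y] \is a fin_num by rewrite ge0_fin_numE// la_point_fin.
    have y0' : (0 < fine (la [set y]))%R by rewrite fine_gt0// y0 la_point_fin.
    have [m _ /(_ m (leqnn _)) /= hm] := near_infty_natSinv_lt (PosNum y0').
    by exists m => //; split => //; rewrite -(fineK fy) lee_fin ltW.
  move=> [k _ [m _ [_ h]]]; apply: lt_le_trans h.
  by rewrite lte_fin invr_gt0 ltr0n.
apply: bigcup_countable => // k _; apply: bigcup_countable => // m _.
apply: finite_set_countable; have [mF fF] := hF k; exact: heavy_points_finite.
Qed.

Lemma countable_measurable (A : set Y) : countable A -> measurable A.
Proof.
move=> /countable_points[e [h1 h2]]; rewrite (_ : A = \bigcup_n e n).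
  by apply: bigcupT_measurable => n; case: (h1 n) => [->|[y _ ->]].
apply/seteqP; split=> y; first by move=> /h2[n En]; exists n; rewrite ?En.
by move=> [n _]; case: (h1 n) => [->//|[z Az ->] ->].
Qed.

Definition siblings (y : Y) := [set z : Y | la [set z] = la [set y]].
Definition inf_atoms := [set y | atoms y /\ infinite_set (siblings y)].
(** Atoms of multiplicity one are included. *)
Definition fin_atoms := [set y | atoms y /\ finite_set (siblings y)].
Definition diffuse := ~` atoms.

Lemma inf_atoms_countable : countable inf_atoms.
Proof. by apply: sub_countable atoms_countable; apply: subset_card_le => y []. Qed.

Lemma fin_atoms_measurable : measurable fin_atoms.
Proof.
apply: countable_measurable; apply: sub_countable atoms_countable.
by apply: subset_card_le => y [].
Qed.

Lemma diffuse0 y : ~ inf_atoms y -> ~ fin_atoms y -> la [set y] = 0.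
Proof.
move=> ni nf; apply/eqP; rewrite eq_le measure_ge0 andbT leNgt; apply/negP => h.
by have [f|i] := pselect (finite_set (siblings y)); [apply: nf|apply: ni].
Qed.

Lemma la_image_point (T : mpbij la) (y : Y) : la [set T y] = la [set y].
Proof. by rewrite -(mpfun_image_preserving T (mpt y)) image_set1. Qed.

Lemma inf_atoms_map (T : mpbij la) y : inf_atoms (T y) <-> inf_atoms y.
Proof. by rewrite /inf_atoms /= /atoms /siblings /= la_image_point. Qed.

(** * The countable ring closed under the bad maps *)

Section closing_off.
Variable bad : seq (set Y) -> nat -> mpbij la.
Hypothesis bad_fix : forall P n y, fin_atoms y -> bad P n y = y.

Let F := sval (cid exhaustion).
Let FT : \bigcup_k F k = setT. Proof. by case: (svalP (cid exhaustion)). Qed.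
Let Fmono : {homo F : n m / (n <= m)%N >-> (n <= m)%O}.
Proof. by case: (svalP (cid exhaustion)). Qed.
Let Fm k : measurable (F k). Proof. by case: (svalP (cid exhaustion)) => _ _ /(_ k)[]. Qed.
Let Ff k : la (F k) < +oo. Proof. by case: (svalP (cid exhaustion)) => _ _ /(_ k)[]. Qed.
Let sg := sval (cid (countable_points inf_atoms_countable)).
Let sg1 n : sg n = set0 \/ exists2 y, inf_atoms y & sg n = [set y].
Proof. by have [h _] := svalP (cid (countable_points inf_atoms_countable)); exact: h. Qed.
Let sg2 y : inf_atoms y -> exists n, sg n = [set y].
Proof. by have [_ h] := svalP (cid (countable_points inf_atoms_countable)); exact: h. Qed.

(** A choice made once and for all turns splitting into an operation under which the family can be
    closed. *)
Let split_ex : exists sp : set Y -> R -> set Y, forall b v,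
  [/\ measurable (sp b v), sp b v `<=` b &
    (exists c, [/\ measurable c, c `<=` b & la c = v%:E]) -> la (sp b v) = v%:E].
Proof.
have /choice[f hf] : forall bv : set Y * R, exists c,
  [/\ measurable c, c `<=` bv.1 &
    (exists c, [/\ measurable c, c `<=` bv.1 & la c = bv.2%:E]) -> la c = bv.2%:E].
  move=> [b v] /=; have [[c [h1 h2 h3]]|n] := pselect (exists c, [/\ measurable c, c `<=` b & la c = v%:E]).
    by exists c.
  by exists set0; split => //; exact: measurable0.
by exists (fun b v => f (b, v)) => b v; exact: (hf (b, v)).
Qed.
Let sp := sval (cid split_ex).
Let spP b v := svalP (cid split_ex) b v.

Let Fd := if la diffuse < +oo then diffuse else set0.

(* Sets and reals are closed off simultaneously, as pairs in which one component is idle; the tags 8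
   and 9 apply the bad map attached to a finite list of sets already obtained. *)
Let D := (set Y * R)%type.
Let d0 : D := (set0, 0%R).
Let op1 (km : nat * nat) (l : seq D) : D :=
  let b := (nth d0 l 0).1 in let v := (nth d0 l 0).2 in
  let b' := (nth d0 l 1).1 in let v' := (nth d0 l 1).2 in
  match km.1 with
  | 0 => (b `|` b', 0%R)
  | 1 => (b `\` b', 0%R)
  | 2 => (set0, fine (la b))
  | 3 => (set0, v - v')%R
  | 4 => (set0, v * v')%R
  | 5 => (set0, v^-1)%R
  | 6 => (sp b v', 0%R)
  | 7 => (b `&` (if unpickle km.2 is Some nj then nr nj.1 (xs nj.2) else set0), 0%R)
  | 8 => (bad (map fst (behead l)) km.2 @` b, 0%R)
  | 9 => (bad (map fst (behead l)) km.2 @^-1` b, 0%R)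
  | 10 => (F km.2 `\` inf_atoms `\` fin_atoms, 0%R)
  | 11 => (sg km.2, 0%R)
  | _ => (Fd, 0%R)
  end.
Let op i := op1 (odflt (0, 0)%N (unpickle i)).
Let ce := closure_enum op.
Let Bp : set (set Y) := [set b | exists n, (ce n).1 = b].
Let V : set R := [set v | exists n, (ce n).2 = v].

Let ce_op k m l : (forall x, List.In x l -> exists n, ce n = x) -> exists n, ce n = op1 (k, m) l.
Proof.
move=> /(closure_op (pickle (k, m)))[n hn]; exists n.
by rewrite /ce hn /op pickleK.
Qed.

(** The invariant of the closing-off. A set of finite measure may contain infinitely many atoms,
    with masses tending to 0, but [r_PD] asks for finitely many pieces. *)
Let good (b : set Y) := [/\ measurable b, la b < +oo, finite_set (b `&` inf_atoms) & b `&` fin_atoms = set0].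

Let good_sub (b c : set Y) : good b -> measurable c -> c `<=` b -> good c.
Proof.
move=> [mb fb ib nb] mc cb; split => //.
- by apply: le_lt_trans fb; apply: le_measure; rewrite ?inE.
- by apply: sub_finite_set ib => y [/cb].
- by rewrite -subset0 -nb => y [/cb].
Qed.

Let good0 : good set0.
Proof. by split; rewrite ?measure0 ?set0I//; exact: measurable0. Qed.

Let mIA : measurable inf_atoms. Proof. exact/countable_measurable/inf_atoms_countable. Qed.
Let mdiffuse : measurable diffuse.
Proof. by apply: measurableC; exact/countable_measurable/atoms_countable. Qed.

Let good_map (T : mpbij la) b : (forall y, fin_atoms y -> T y = y) -> good b -> good (T @` b).
Proof.
move=> fT [mb fb ib nb]; split.
- exact: mpfun_image.
- by rewrite mpfun_image_preserving.
- apply: (@sub_finite_set _ _ (T @` (b `&` inf_atoms))); last exact: finite_image.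
  by move=> _ [[y b_y <-] /inf_atoms_map h]; exists y.
- rewrite -subset0 -nb => _ [[y b_y <-] h]; have E := fT _ h.
  by move: E => /(bij_inj (mpfun_bij T)) E; split => //; rewrite E.
Qed.

Let good_ce n : good (ce n).1.
Proof.
apply: (@closure_ind _ op (fun x => good x.1)) => i l hl.
have gn k : good (nth d0 l k).1.
  elim: l k hl => [|x l IH] [|k] hl //=; [exact: hl (or_introl _ erefl)|].
  by apply: IH => z hz; apply: hl; right.
rewrite /op; case: (odflt _ _) => k m /=; have g0 := gn 0%N; have g1 := gn 1%N.
have [m0 f0 i0 n0] := g0; have [m1 f1 i1 n1] := g1.
rewrite /op1 /=.
case: k => [|[|[|[|[|[|[|[|[|[|[|[|k]]]]]]]]]]]] /=.
- split; first exact: measurableU.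
  + by apply: le_lt_trans (measureU2 _ m0 m1) _; rewrite lte_add_pinfty.
  + by rewrite setIUl finite_setU.
  + by rewrite setIUl n0 n1 setU0.
- by apply: good_sub g0 _ _; [exact: measurableD|exact: subDsetl].
- exact: good0.
- exact: good0.
- exact: good0.
- exact: good0.
- by have [h1 h2 _] := spP (nth d0 l 0).1 (nth d0 l 1).2; exact: good_sub g0 h1 h2.
- apply: good_sub g0 _ (@subIsetl _ _ _); apply: measurableI => //.
  by case: unpickle => [[i' j]|]; [exact: (nr_measurable pY)|exact: measurable0].
- by apply: good_map => // y; exact: bad_fix.
- rewrite -image_mpfun_inv; apply: (@good_map (mpbijV _)) => // y fy /=.
  by rewrite -{1}(bad_fix (map fst (behead l)) m fy) mpfunK.
- have mF : measurable (F m `\` inf_atoms `\` fin_atoms).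
    apply: measurableD; last exact: fin_atoms_measurable.
    exact: measurableD.
  split => //.
  + by apply: le_lt_trans (Ff m); apply: le_measure; rewrite ?inE// => y [[]].
  + by rewrite (_ : _ `&` _ = set0)// -subset0 => y [[[_ ?] _]].
  + by rewrite -subset0 => y [[]].
- case: (sg1 m) => [->|[y iy ->]]; first exact: good0.
  split => //; first exact: la_point_fin.
    by apply: sub_finite_set (finite_set1 y) => z [].
  by rewrite -subset0 => z [-> [_ h]]; case: iy.
- rewrite /Fd; case: ifP => [fd|_]; last exact: good0.
  split => //.
    by rewrite (_ : _ `&` _ = set0)// -subset0 => y [h [/h]].
  by rewrite -subset0 => y [h [/h]].
Qed.

Let Bp_op k m (l : seq D) : (forall x, List.In x l -> exists n, ce n = x) ->
  Bp (op1 (k, m) l).1 /\ V (op1 (k, m) l).2.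
Proof. by move=> /(@ce_op k m)[n <-]; split; exists n. Qed.

Let in1 (x : D) : (exists n, ce n = x) -> forall z, List.In z [:: x] -> exists n, ce n = z.
Proof. by move=> h z [<-|[]]. Qed.
Let in2 (x z : D) : (exists n, ce n = x) -> (exists n, ce n = z) ->
  forall w, List.In w [:: x; z] -> exists n, ce n = w.
Proof. by move=> h k w [<-|[<-|[]]]. Qed.
Let exce n : exists m, ce m = ce n. Proof. by exists n. Qed.

Let Bp_U a b : Bp a -> Bp b -> Bp (a `|` b).
Proof. by move=> [n <-] [m <-]; have [+ _] := @Bp_op 0 0 _ (in2 (exce n) (exce m)). Qed.
Let Bp_D a b : Bp a -> Bp b -> Bp (a `\` b).
Proof. by move=> [n <-] [m <-]; have [+ _] := @Bp_op 1 0 _ (in2 (exce n) (exce m)). Qed.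
Let V_mu b : Bp b -> V (fine (la b)).
Proof. by move=> [n <-]; have [_ +] := @Bp_op 2 0 _ (in1 (exce n)). Qed.
Let V_B u v : V u -> V v -> V (u - v)%R.
Proof. by move=> [n <-] [m <-]; have [_ +] := @Bp_op 3 0 _ (in2 (exce n) (exce m)). Qed.
Let V_M u v : V u -> V v -> V (u * v)%R.
Proof. by move=> [n <-] [m <-]; have [_ +] := @Bp_op 4 0 _ (in2 (exce n) (exce m)). Qed.
Let V_V u : V u -> V (u^-1)%R.
Proof. by move=> [n <-]; have [_ +] := @Bp_op 5 0 _ (in1 (exce n)). Qed.
Let Bp_sp b v : Bp b -> V v -> Bp (sp b v).
Proof. by move=> [n <-] [m <-]; have [+ _] := @Bp_op 6 0 _ (in2 (exce n) (exce m)). Qed.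
Let Bp_nr b n j : Bp b -> Bp (b `&` nr n (xs j)).
Proof.
by move=> [k <-]; have [+ _] := @Bp_op 7 (pickle (n, j)) _ (in1 (exce k)); rewrite /op1 /= pickleK.
Qed.
Let Bp_F m : Bp (F m `\` inf_atoms `\` fin_atoms).
Proof. by have [|+ _] := @Bp_op 10 m [::]. Qed.
Let Bp_sg y : inf_atoms y -> Bp [set y].
Proof. by move=> /sg2[m <-]; have [|+ _] := @Bp_op 11 m [::]. Qed.
Let Bp_Fd : Bp Fd.
Proof. by have [|+ _] := @Bp_op 12 0 [::]. Qed.
Let Bp0 : Bp set0.
Proof. by rewrite -(setDv Fd); exact: Bp_D. Qed.

Let bad_list (P : seq (set Y)) : {in P, forall b, Bp b} ->
  exists l : seq D, map fst l = P /\ forall x, List.In x l -> exists n, ce n = x.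
Proof.
elim: P => [|b P IH] h; first by exists [::].
have [|l [<- hl]] := IH; first by move=> c cP; apply: h; rewrite inE cP orbT.
have [n <-] := h _ (mem_head _ _); exists (ce n :: l); split => // x [<-|/hl//].
by exists n.
Qed.

Let Bp_bad P m b : {in P, forall b, Bp b} -> Bp b -> Bp (bad P m @` b) /\ Bp (bad P m @^-1` b).
Proof.
move=> /bad_list[l [<- hl]] [n <-].
have h x : List.In x (ce n :: l) -> exists n, ce n = x by move=> [<-|/hl//]; exists n.
by split; [have [+ _] := @Bp_op 8 m _ h|have [+ _] := @Bp_op 9 m _ h].
Qed.

Let Bp_good b : Bp b -> good b. Proof. by move=> [n <-]; exact: good_ce. Qed.
Let Bp_m b : Bp b -> measurable b. Proof. by move=> /Bp_good[]. Qed.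
Let Bp_fin b : Bp b -> la b < +oo. Proof. by move=> /Bp_good[]. Qed.

(** Null members of the countable family [Bp] add up to a null set. Removing it makes the measure
    strictly positive on nonempty members of the ring. *)
Let N0 := [set y | exists b, [/\ Bp b, la b = 0 & b y]].

Let N0E : N0 = \bigcup_n (if la (ce n).1 == 0 then (ce n).1 else set0).
Proof.
apply/seteqP; split=> y; first by move=> [b [[n <-] z h]]; exists n; rewrite // z eqxx.
by move=> [n _]; case: eqP => // z h; exists (ce n).1; split => //; exists n.
Qed.

Let mN0 : measurable N0.
Proof.
rewrite N0E; apply: bigcupT_measurable => n; case: eqP => _ //.
by apply: Bp_m; exists n.
Qed.

Let laN0 : la N0 = 0.
Proof.
rewrite N0E; apply: measure_negligible; first by rewrite -N0E.
apply: negligible_bigcup => n; case: eqP => [z|_]; last exact: negligible_set0.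
by apply/negligibleP => //; apply: Bp_m; exists n.
Qed.

Let N0_atoms y : N0 y -> ~ atoms y.
Proof.
move=> [b [Bb z b_y]]; rewrite /atoms /= => h.
have : la [set y] <= la b.
  by apply: le_measure; rewrite ?inE//; [exact: Bp_m|move=> w ->].
by rewrite z leNgt h.
Qed.

Let B : set (set Y) := [set b | exists2 b', Bp b' & b = b' `\` N0].
Let mu (b : set Y) : R := fine (la b).

Let BBp b : Bp b -> B (b `\` N0). Proof. by exists b. Qed.

Let la_N0 b : measurable b -> la (b `\` N0) = la b.
Proof.
move=> mb; apply: (measure_off mN0 laN0) => //; first exact: measurableD.
by rewrite setDDl setUid.
Qed.

Let B_U a b : B a -> B b -> B (a `|` b).
Proof. by move=> [a' pa ->] [b' pb ->]; rewrite -setDUl; apply: BBp; exact: Bp_U. Qed.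

Let B_D a b : B a -> B b -> B (a `\` b).
Proof.
move=> [a' pa ->] [b' pb ->]; rewrite (_ : _ `\` _ = (a' `\` b') `\` N0); first exact/BBp/Bp_D.
apply/seteqP; split=> y; first by move=> [[h1 h2] h3]; split => //; split => // h4; apply: h3.
by move=> [[h1 h2] h3]; split => // -[].
Qed.

Let B_hB b : B b -> measurable b /\ la b < +oo.
Proof.
move=> [b' pb ->]; have mb := Bp_m pb; split; first exact: measurableD.
by rewrite la_N0//; exact: Bp_fin.
Qed.

Let B_m b : B b -> measurable b. Proof. by move=> /B_hB[]. Qed.
Let B_fin b : B b -> la b \is a fin_num.
Proof. by move=> /B_hB[_ h]; rewrite ge0_fin_numE. Qed.

Let B_nr b n j : B b -> B (b `&` nr n (xs j)).
Proof.
move=> [b' pb ->]; rewrite (_ : _ `&` _ = (b' `&` nr n (xs j)) `\` N0); first exact/BBp/Bp_nr.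
by apply/seteqP; split=> y [[h1 h2] h3].
Qed.

Let B_point y : inf_atoms y -> B [set y].
Proof.
move=> iy; rewrite (_ : [set y] = [set y] `\` N0); first exact/BBp/Bp_sg.
apply/seteqP; split=> z; last by case.
by move=> ->; split => // /N0_atoms; case: iy.
Qed.

Let B_inf_fin b : B b -> finite_set (b `&` inf_atoms).
Proof. by move=> [b' /Bp_good[_ _ h _] ->]; apply: sub_finite_set h => y [[]]. Qed.

Let B_fin_atoms b y : B b -> b y -> ~ fin_atoms y.
Proof.
move=> [b' /Bp_good[_ _ _ h] ->] [b_y _] fy; have : (b' `&` fin_atoms) y by [].
by rewrite h.
Qed.

Let B_dff0 b y : B b -> dff inf_atoms b -> b y -> la [set y] = 0.
Proof.
move=> Bb db b_y; apply: diffuse0; first by move=> /(db _ b_y).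
exact: B_fin_atoms Bb b_y.
Qed.

Let B_SP a v : B a -> dff inf_atoms a -> V v -> (0 < v < mu a)%R ->
  exists b, [/\ B b, b `<=` a & mu b = v].
Proof.
move=> Ba da Vv /andP[v0 va]; have [a' pa Ea] := Ba.
have ma' := Bp_m pa.
have n0 y : a' y -> la [set y] = 0.
  move=> ay; have [n|n] := pselect (N0 y).
    apply/eqP; rewrite eq_le measure_ge0 andbT leNgt; apply/negP.
    exact: N0_atoms n.
  by apply: (B_dff0 Ba da); rewrite Ea.
have va' : v%:E < la a' by rewrite -la_N0// -Ea -(fineK (B_fin Ba)) lte_fin.
have hc := exact_subset pY ma' (Bp_fin pa) n0 v0 va'.
have [h1 h2 /(_ hc) h3] := spP a' v.
exists (sp a' v `\` N0); split; first exact/BBp/Bp_sp.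
  by rewrite Ea => y [/h2 h k].
by rewrite /mu la_N0// h3.
Qed.

Let B_PD b : B b -> exists s, [/\ uniq s, {in s, forall a, piece B inf_atoms a}, djs s & uns s = b].
Proof.
move=> Bb; have /finite_seqP[l0 El0] := B_inf_fin Bb.
pose l := undup l0; have lP y : y \in l <-> b y /\ inf_atoms y.
  rewrite mem_undup; split=> [yl|h].
    by have : [set` l0] y by []; rewrite -El0.
  by have : (b `&` inf_atoms) y by []; rewrite El0.
pose rest := b `\` uns [seq [set y] | y <- l].
have Bsing c : c \in [seq [set y] | y <- l] -> B c.
  by move=> /mapP[y /lP[_ iy] ->]; exact: B_point.
have Buns' s : {in s, forall c, B c} -> B (uns s).
  elim: s => [|c s IH] h; first by rewrite uns_nil -(setDv b); exact: B_D.
  rewrite uns_cons; apply: B_U; first by apply: h; rewrite mem_head.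
  by apply: IH => e es; apply: h; rewrite inE es orbT.
have Brest : B rest by apply: B_D => //; exact: Buns'.
have drest : dff inf_atoms rest.
  move=> y [b_y nu] iy; apply: nu; exists [set y] => //.
  by apply/mapP; exists y => //; exact/lP.
pose s0 := [seq [set y] | y <- l].
have us0 : uniq s0.
  rewrite map_inj_uniq ?undup_uniq// => y z E.
  by have : [set y] y by []; rewrite E.
have ps0 : {in s0, forall a, piece B inf_atoms a}.
  move=> _ /mapP[y /lP[b_y iy] ->]; split; [exact: B_point| |by left; exists y].
  by move=> E; have : [set y] y by []; rewrite E.
have ds0 : djs s0.
  move=> _ _ /mapP[y _ ->] /mapP[z _ ->] n w -> E; apply: n; by rewrite E.
have Eb : uns s0 `|` rest = b.
  apply/seteqP; split=> y.
    by move=> [[_ /mapP[z /lP[bz _] ->] ->]|[]].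
  by move=> b_y; have [|] := pselect (uns s0 y); [left|right].
have [r0|r0] := pselect (rest = set0).
  by exists s0; split => //; rewrite -[RHS]Eb r0 setU0.
have dr a : a \in s0 -> dj rest a by move=> as_ y [_ nu] ay; apply: nu; exists a.
exists (rest :: s0); split.
- rewrite /= us0 andbT; apply/negP => /dr /dj_self; exact: r0.
- by move=> a; rewrite inE => /orP[/eqP->|/ps0//]; split => //; right.
- move=> a c; rewrite !inE => /orP[/eqP->|as_] /orP[/eqP->|cs] // n; [exact: dr|exact/djC/dr|exact: ds0].
- by rewrite uns_cons setUC.
Qed.

Let Xf := Fd `\` N0.

Let Fd_diffuse y : Fd y -> diffuse y.
Proof. by rewrite /Fd; case: ifP. Qed.

Let dff_diffuse a y : B a -> dff inf_atoms a -> a y -> diffuse y.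
Proof.
move=> Ba da ay; rewrite /diffuse /atoms /= => h; move: h.
by rewrite (B_dff0 Ba da ay) ltxx.
Qed.

(** An atom has infinitely many siblings and b contains finitely many of them. A diffuse piece
    disjoint from [Xf] forces the diffuse part to have infinite measure, so some set of the
    exhaustion has enough of it outside b. *)
Let B_INF a b : piece B inf_atoms a -> dj a Xf -> B b ->
  exists c, [/\ piece B inf_atoms c, sim mu inf_atoms a c & dj c b].
Proof.
move=> [Ba a0 [[p ip Ep]|da]] dX Bb.
  have [z [sz nbz]] : exists z, siblings p z /\ ~ b z.
    apply: contrapT => n; have [_] := ip; apply.
    apply: sub_finite_set (B_inf_fin Bb) => z sz; split.
      by apply: contrapT => nb; apply: n; exists z.
    by split; rewrite /atoms /siblings /= sz; case: ip.
  have iz : inf_atoms z by split; rewrite /atoms /siblings /= sz; case: ip.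
  exists [set z]; split.
  - split; [exact: B_point| |by left; exists z].
    by move=> E; have : [set z] z by []; rewrite E.
  - by split; [rewrite /mu Ep sz|split => _; [exists z|exists p]].
  - by move=> y ->.
have [y0 ay0] : a !=set0 by exact/set0P/eqP.
have nXa : ~ (la diffuse < +oo).
  move=> fd; apply: (dX y0 ay0); have [a' _ Ea] := Ba; split.
    by rewrite /Fd fd; exact: dff_diffuse ay0.
  by move: ay0; rewrite Ea => -[].
have infd : la diffuse = +oo by apply/eqP; rewrite -leye_eq leNgt; exact/negP.
pose G n := F n `\` inf_atoms `\` fin_atoms `\` b.
have mG n : measurable (G n).
  apply: measurableD; last exact: B_m.
  by apply: measurableD; [exact: measurableD|exact: fin_atoms_measurable].
have Gmono : {homo G : n m / (n <= m)%N >-> (n <= m)%O}.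
  move=> n m /Fmono /subsetPset h; apply/subsetPset => y [[[Fy h1] h2] h3].
  by split => //; split => //; split => //; exact: h.
have Ginf : la (\bigcup_n G n) = +oo.
  have mU : measurable (\bigcup_n G n) by exact: bigcupT_measurable.
  apply/eqP; rewrite -leye_eq leNgt; apply/negP => fU.
  have : la diffuse <= la (\bigcup_n G n) + la b.
    apply: le_trans (measureU2 _ mU (B_m Bb)); apply: le_measure; rewrite ?inE//.
      by apply: measurableU => //; exact: B_m.
    move=> y dy; have [|nb] := pselect (b y); [by right|left].
    have : (\bigcup_n F n) y by rewrite FT.
    move=> [n _ Fy]; exists n => //; split => //; split; last by move=> [/dy].
    by split => // -[/dy].
  by rewrite infd leye_eq => /eqP E; have := lte_add_pinfty fU (B_hB Bb).2; rewrite E ltxx.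
have [n hn] : exists n, (mu a)%:E < la (G n).
  apply: contrapT => h.
  have cv : (la \o G) @ \oo --> la (\bigcup_n G n).
    by apply: nondecreasing_cvg_mu => //; exact: bigcupT_measurable.
  have : la (\bigcup_n G n) <= (mu a)%:E.
    rewrite -(cvg_lim _ cv)//; apply: lime_le; first by apply/cvg_ex; exists (la (\bigcup_n G n)).
    by apply: nearW => n; rewrite leNgt; apply/negP => k; apply: h; exists n.
  by rewrite Ginf leye_eq.
have BG : B (G n `\` N0).
  rewrite (_ : _ `\` N0 = (F n `\` inf_atoms `\` fin_atoms `\` N0) `\` b); first by apply: B_D => //; exact/BBp/Bp_F.
  by rewrite /G setDDl setUC -setDDl.
have dG : dff inf_atoms (G n `\` N0) by move=> y [[[[_ h] _] _] _].
have mua : (0 < mu a < mu (G n `\` N0))%R.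
  rewrite /mu la_N0//; apply/andP; split.
    rewrite fine_gt0//; have [_ ->] := B_hB Ba; rewrite andbT lt_neqAle measure_ge0 andbT.
    apply/eqP => z; have [a' pa Ea] := Ba; move: ay0; rewrite Ea => -[ay nN].
    by apply: nN; exists a'; split => //; rewrite -la_N0 -?Ea//; exact: Bp_m.
  rewrite -lte_fin (fineK (x := la (G n))) //.
  by have := B_fin BG; rewrite la_N0.
have Vmua : V (mu a).
  by have [a' pa ->] := Ba; rewrite /mu la_N0; [exact: V_mu|exact: Bp_m].
have [c [Bc cG mc]] := B_SP BG dG Vmua mua.
have dc : dff inf_atoms c := dffS dG cG.
have c0 : c <> set0.
  by move=> E; move: mua; rewrite -mc E /mu measure0 /= ltxx.
exists c; split; first by split => //; right.
  by split => //; split=> /atm_dff h; [case: (h da)|case: (h dc)].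
by move=> y /cG [[_ nb] _].
Qed.

Let ring_B : mring B mu inf_atoms Xf V.
Proof.
have mu_gt0 a : B a -> a <> set0 -> (0 < mu a)%R.
  move=> Ba /eqP/set0P[y ay]; rewrite fine_gt0//; have [_ ->] := B_hB Ba.
  rewrite andbT lt_neqAle measure_ge0 andbT.
  apply/eqP => z; have [a' pa Ea] := Ba; move: ay; rewrite Ea => -[ay nN].
  by apply: nN; exists a'; split => //; rewrite -la_N0 -?Ea//; exact: Bp_m.
split => //.
- by rewrite -(set0D N0); exact: BBp.
- move=> a b Ba Bb ab; rewrite /mu measureU ?fineD//; [exact: B_fin|exact: B_fin|exact: B_m|exact: B_m|].
  by rewrite -subset0 => y [ay]; exact: ab.
- by move=> a [a' pa ->]; rewrite /mu la_N0; [exact: V_mu|exact: Bp_m].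
- exact: BBp.
- by move=> y [/Fd_diffuse dy _] [/dy].
- move=> X0 a Ba da y ay; have [a' _ Ea] := Ba; split; last by move: ay; rewrite Ea => -[].
  have := dff_diffuse Ba da ay; move/eqP/set0P: X0 => [z [+ _]].
  by rewrite /Fd; case: ifP.
- exists (fun n => (ce n).1 `\` N0); split; first by move=> n; apply: BBp; exists n.
  by move=> _ [_ [n <-] ->]; exists n.
Qed.


(** Hence a bad map, which fixes the atoms of finite multiplicity, is the identity almost everywhere
    off the support, as [realizes] demands. *)
Let support_ae : {ae la, forall y, ~ support B y -> fin_atoms y}.
Proof.
apply: (null_ae mN0 laN0) => y nN ns; apply: contrapT => nf.
have [iy|ni] := pselect (inf_atoms y).
  by apply: ns; exists [set y]; split => //; exact: B_point.
have : (\bigcup_n F n) y by rewrite FT.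
move=> [n _ Fy]; apply: ns; exists (F n `\` inf_atoms `\` fin_atoms `\` N0).
by split; [exact/BBp/Bp_F|].
Qed.

Let bad_realizes P m : {in P, forall b, Bp b} -> exists phi : aut B mu,
  realizes (bad P m) phi /\ forall b, phi b = bad P m @` b.
Proof.
move=> hP; set T := bad P m.
have Tinj : injective T := bij_inj (mpfun_bij T).
(* Images and preimages of null members under T are null members, so T descends to the ring with
   [N0] removed. *)
have TN0 y : N0 y <-> N0 (T y).
  split=> [[b [pb zb b_y]]|[b [pb zb b_y]]].
    exists (T @` b); split; [by have [] := Bp_bad m hP pb| |by exists y].
    by rewrite mpfun_image_preserving//; exact: Bp_m.
  exists (T @^-1` b); split => //; first by have [] := Bp_bad m hP pb.
  by rewrite mpfun_preserving//; exact: Bp_m.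
have Bi b : B b -> B (T @` b).
  move=> [b' pb ->]; rewrite (_ : _ @` _ = (T @` b') `\` N0).
    by apply: BBp; have [] := Bp_bad m hP pb.
  apply/seteqP; split=> [_ [y [b_y nN] <-]|_ [[y b_y <-] nN]].
    by split; [exists y|move=> h; exact: (nN ((TN0 y).2 h))].
  by exists y => //; split => // h; exact: (nN ((TN0 y).1 h)).
have Bpre b : B b -> B (T @^-1` b).
  move=> [b' pb ->]; rewrite (_ : _ @^-1` _ = (T @^-1` b') `\` N0).
    by apply: BBp; have [] := Bp_bad m hP pb.
  apply/seteqP; split=> y [b_y nN]; split => // h.
    exact: (nN ((TN0 y).1 h)).
  exact: (nN ((TN0 y).2 h)).
have K1 b : B b -> T @^-1` (T @` b) = b.
  move=> _; apply/seteqP; split=> y; last by move=> b_y; exists y.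
  by move=> [z bz /Tinj <-].
have K2 b : B b -> T @` (T @^-1` b) = b.
  by move=> _; rewrite -preimage_mpfun_inv -comp_preimage; apply/seteqP; split=> y;
    rewrite /preimage /= mpfun_invK.
have KD a b : B a -> B b -> T @` (a `\` b) = T @` a `\` T @` b.
  by move=> _ _; rewrite -!preimage_mpfun_inv.
have Km b : B b -> mu (T @` b) = mu b.
  by move=> Bb; rewrite /mu mpfun_image_preserving//; exact: B_m.
exists (RingAut Bi Bpre K1 K2 KD Km); split => //.
apply: filterS support_ae => y hy; split; last by move=> /hy fy; exact: bad_fix.
by move=> b Bb /=; split=> [b_y|[z bz /Tinj <-]//]; exists y.
Qed.

(** [near_W14] names finitely many sets and a precision only after the ring is built. The ring is
    already invariant under the bad map for these data, which therefore realizes an automorphism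
    close to 1. *)
Lemma some_bad_is_short (A : nat -> set (Aut la)) : (forall g, exists n, A n g) ->
  (forall P m b, {in P, forall c, measurable c /\ la c < +oo} -> b \in P ->
     (fine (la (bad P m @` b `\` b)) < m.+1%:R^-1)%R) ->
  exists P m k, [/\ {in P, forall c, measurable c /\ la c < +oo}, (k <= 14)%N & Wn A k (cl (bad P m))].
Proof.
move=> covA near1.
have hM := ioM pY ring_B B_hB B_nr.
have hE := io_ext pY ring_B B_hB B_nr.
have hG := io_glue pY ring_B B_hB B_nr.
have [L [e [e0 hL hW]]] := near_W14 hM hE covA hG.
have [P [hP LP]] : exists P : seq (set Y), {in P, forall b, Bp b} /\ {in L, forall b, exists2 b', b' \in P & b = b' `\` N0}.
  elim: L hL {hW} => [|b L IH] h; first by exists [::].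
  have [|P [hP LP]] := IH; first by move=> c cL; apply: h; rewrite inE cL orbT.
  have [b' pb Eb] := h _ (mem_head _ _); exists (b' :: P); split.
    by move=> c; rewrite inE => /orP[/eqP->|/hP].
  move=> c; rewrite inE => /orP[/eqP->|/LP[c' cP ->]]; first by exists b'; rewrite ?mem_head.
  by exists c'; rewrite // inE cP orbT.
have [m _ /(_ m (leqnn _)) /= hm] := near_infty_natSinv_lt (PosNum e0).
have [phi [rphi phiE]] := bad_realizes m hP.
have mP : {in P, forall c, measurable c /\ la c < +oo}.
  by move=> c /hP pc; split; [exact: Bp_m|exact: Bp_fin].
have [|k k14 hk] := hW phi.
  move=> b /LP[b' bP Eb]; apply: lt_trans hm; apply: le_lt_trans (near1 P m b' mP bP).
  have mb := Bp_m (hP _ bP); have mTb := mpfun_image (bad P m) mb.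
  have mD : measurable (bad P m @` b' `\` b') by exact: measurableD.
  rewrite phiE /mu.
  have mb0 : measurable b by rewrite Eb; exact: measurableD.
  have mD0 : measurable (bad P m @` b `\` b) by apply: measurableD => //; exact: mpfun_image.
  have le : la (bad P m @` b `\` b) <= la (bad P m @` b' `\` b').
    rewrite -(la_N0 mD) -(la_N0 mD0); apply: le_measure; rewrite ?inE; [exact: measurableD|exact: measurableD|].
    move=> z [[[y b_y <-] nb] nN]; split => //; split.
      by exists y => //; move: b_y; rewrite Eb => -[].
    by move=> b'z; apply: nb; rewrite Eb.
  have f' : la (bad P m @` b' `\` b') < +oo.
    apply: le_lt_trans (mP _ bP).2.
    by rewrite -(mpfun_image_preserving (bad P m) mb); apply: le_measure; rewrite ?inE//.
  by apply: fine_le => //; rewrite ge0_fin_numE//; exact: le_lt_trans f'.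
exists P, m, k; split => //.
by rewrite (ioP pY ring_B B_hB B_nr rphi).
Qed.

End closing_off.

End atoms.

(** * Automatic continuity *)

Section topological_groups.
Variable G : topologicalGroupType.
Local Open Scope group_scope.

Lemma mulg_nbhs (x y : G) (U : set G) : nbhs (x * y) U ->
  exists P Q, [/\ nbhs x P, nbhs y Q & forall a b, P a -> Q b -> U (a * b)].
Proof.
move=> /(@mulg_continuous G (x, y)) [[P Q] /= [hP hQ] h]; exists P, Q; split => // a b Pa Qb.
exact: (h (a, b)).
Qed.

Lemma mulgl_nbhs (x y : G) (U : set G) : nbhs (x * y) U -> nbhs y [set b | U (x * b)].
Proof.
move=> /mulg_nbhs[P [Q [hP hQ h]]]; apply: filterS hQ => b Qb.
by apply: h => //; exact: nbhs_singleton.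
Qed.

Lemma invg_nbhs (x : G) (U : set G) : nbhs x^-1 U -> nbhs x [set a | U a^-1].
Proof. by move=> /(@invg_continuous G x). Qed.

Lemma small_products (V : set G) n : nbhs 1 V -> exists V1 : set G, nbhs 1 V1 /\
  forall l : seq G, (size l <= n)%N -> {in l, forall g, V1 g} -> V (gprod l).
Proof.
elim: n V => [|n IH] V hV.
  by exists V; split => // -[|//] _ _; exact: nbhs_singleton.
have : nbhs (1 * 1) V by rewrite mul1g.
move=> /mulg_nbhs[P [Q [hP hQ h]]]; have [V1 [hV1 k]] := IH Q hQ.
exists (P `&` V1); split; first exact: filterI.
move=> [|g l] /=; first by move=> _ _; exact: nbhs_singleton.
rewrite ltnS => sl hl; apply: h; first by have [] := hl _ (mem_head _ _).
by apply: k => // w wl; have [] := hl w; rewrite // inE wl orbT.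
Qed.

Lemma small_quotients (V : set G) : nbhs 1 V -> exists V0 : set G, nbhs 1 V0 /\
  forall a b, V0 a -> V0 b -> V (a^-1 * b).
Proof.
move=> hV; have : nbhs (1 * 1) V by rewrite mul1g.
move=> /mulg_nbhs[P [Q [hP hQ h]]]; exists ([set a | P a^-1] `&` Q); split.
  by apply: filterI => //; apply: invg_nbhs; rewrite invg1.
by move=> a b [Pa _] [_ Qb]; exact: h.
Qed.

Lemma separable_cover (V : set G) : separable G -> nbhs 1 V ->
  exists e : nat -> G, forall h, exists n, V ((e n)^-1 * h).
Proof.
move=> [D cD dD] hV; have /countable_injP[f fi] := cD.
have [x0 Dx0] : D !=set0 by have [||x [_ ?]] := dD setT; [by exists 1|exact: openT|by exists x].
have /choice[e he] : forall n, exists x, (exists2 x', D x' & f x' = n) -> D x /\ f x = n.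
  move=> n; have [[x' Dx' fx']|h] := pselect (exists2 x', D x' & f x' = n); first by exists x'.
  by exists x0 => /h.
exists e => h.
have hU : nbhs h [set x | V (x^-1 * h)].
  have : nbhs (h^-1 * h) V by rewrite mulVg.
  move=> /mulg_nbhs[P [Q [hP hQ k]]]; apply: filterS (invg_nbhs hP) => x Px.
  by apply: k => //; exact: nbhs_singleton.
have [||x [/interior_subset Vx Dx]] := dD [set x | V (x^-1 * h)]^°.
- by exists h.
- exact: open_interior.
exists (f x); have [|De fe] := he (f x); first by exists x.
by rewrite (fi (e (f x)) x)// inE.
Qed.

End topological_groups.

Lemma continuous_at_one (G H : topologicalGroupType) (pi : {multiplicative G -> H}) :
  (forall V, nbhs (1 : H)%g V -> nbhs (1 : G)%g (pi @^-1` V)) -> continuous pi.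
Proof.
move=> h x U hU.
have pi1 : pi 1%g = 1%g by apply: (@mulgI _ (pi 1%g)); rewrite -gmulfM !mulg1.
have : nbhs (1 : H)%g [set w | U (pi x * w)%g] by apply: mulgl_nbhs; rewrite mulg1.
move=> /h; rewrite -(mulVg x) => /mulgl_nbhs; apply: filterS => y /=.
by rewrite -gmulfM mulVKg.
Qed.

Lemma counting_ge2 (T : choiceType) (R : realType) (A : set T) : finite_set A ->
  (2%:E <= counting A :> \bar R)%E <-> exists x y, [/\ A x, A y & x <> y].
Proof.
move=> fA; rewrite /counting asboolT// lee_fin ler_nat; split=> [h|[x [y [Ax Ay /eqP n]]]].
  have /fset0Pn[x xA] : fset_set A != fset0 by rewrite -cardfs_gt0 (leq_trans _ h).
  have /fset0Pn[y] : (fset_set A `\ x)%fset != fset0.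
    by rewrite -cardfs_gt0; move: h; rewrite (cardfsD1 x) xA.
  rewrite !inE => /andP[/eqP n yA]; exists x, y.
  by move: xA yA; rewrite !in_fset_set// !inE => *; split => // /esym.
have <- : #|` [fset x; y]%fset| = 2%N by rewrite cardfs2 n.
by apply/fsubset_leq_card/fsubsetP => z; rewrite !inE in_fset_set// => /orP[] /eqP->; rewrite inE.
Qed.

Lemma counting_lty (T : choiceType) (R : realType) (A : set T) :
  (counting A < +oo :> \bar R)%E <-> finite_set A.
Proof. by rewrite /counting; case: asboolP => h; split => //; rewrite ltry. Qed.

Section steinhaus.
Context d (Y : measurableType d) (R : realType) (la : {sigma_finite_measure set Y -> \bar R}).
Variables (nr : nat -> Y -> Y -> Prop) (xs : nat -> Y).
Hypothesis pY : polish nr xs.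
Local Open Scope ereal_scope.

Lemma near_one_sets (P : seq (set Y)) (e : set Y -> R) : (forall b, 0 < e b)%R ->
  \forall T \near nbhs (1%g : Aut la), {in P, forall b, measurable b -> la b < +oo ->
    la (Aut_fun T @` b `+` b) < (e b)%:E}.
Proof.
move=> e0; elim: P => [|b P IH]; first exact: nearW.
have nb : \forall T \near nbhs (1%g : Aut la), measurable b -> la b < +oo ->
    la (Aut_fun T @` b `+` b) < (e b)%:E.
  have [[mb fb]|n] := pselect (measurable b /\ la b < +oo); last by apply: nearW => T mb fb; case: n.
  have /weak_cvg_near /(_ _ _ mb fb (e0 b)) : nbhs (1%g : Aut la) --> (1%g : Aut la) by [].
  apply: filterS => T hT _ _; apply: le_lt_trans hT.
  have m1 : measurable (Aut_fun (1%g : Aut la) @` b) by exact: mpfun_image.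
  have z : la ((Aut_fun (1%g : Aut la) @` b) `+` (mpbij1 la @` b)) = 0.
    exact: eqae_image mb (Aut_funE _).
  rewrite image_id in z.
  have le : la (Aut_fun T @` b `+` b) <= la (Aut_fun T @` b `+` Aut_fun (1%g : Aut la) @` b) +
    la ((Aut_fun (1%g : Aut la) @` b) `+` b) := le_mu_setY la (mpfun_image T mb) m1 mb.
  by move: le; rewrite z adde0.
apply: filterS2 nb IH => T h k c; rewrite inE => /orP[/eqP->//|cP]; exact: k.
Qed.

Lemma fixes_point (T : mpbij la) (y : Y) : la (T @` [set y] `+` [set y]) < la [set y] -> T y = y.
Proof.
move=> h; apply: contrapT => n; move: h; rewrite ltNge => /negP; apply.
have mp z : measurable [set z : Y] := measurable_point pY z.
rewrite -(la_image_point pY T) image_set1; apply: le_measure; rewrite ?inE//.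
  exact: measurable_setY.
by move=> _ ->; left; split.
Qed.

Hypothesis finite_mult :
  finite_set [set r : R | (0 < r)%R /\ 2%:E <= atomic_multiplicity la r < +oo].

(** This is where (ii) is used: only finitely many atoms have finite multiplicity at least 2, so
    fixing all of them is a weak neighbourhood condition. An atom of multiplicity one is fixed by
    every automorphism. *)
Lemma near_one_fin_atoms : \forall T \near nbhs (1%g : Aut la),
  forall y, fin_atoms la y -> Aut_fun T y = y.
Proof.
have mp z : measurable [set z : Y] := measurable_point pY z.
pose Ym := \bigcup_(r in [set r : R | (0 < r)%R /\ 2%:E <= atomic_multiplicity la r < +oo])
  [set y | la [set y] = r%:E].
have /finite_seqP[l El] : finite_set Ym.
  by apply: bigcup_finite => // r [_ /andP[_ /counting_lty]].
(* The tolerance at an atom is its own mass, as in [fixes_point]; the default 1 keeps tolerances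
   positive. *)
have : \forall T \near nbhs (1%g : Aut la), {in [seq [set y] | y <- l], forall b, measurable b -> la b < +oo ->
    la (Aut_fun T @` b `+` b) < (if `[< (0 < fine (la b))%R >] then fine (la b) else 1%R)%:E}.
  by apply: near_one_sets => b; case: asboolP.
apply: filterS => T hT y [y0 fy].
have ffy : la [set y] \is a fin_num by rewrite ge0_fin_numE// (la_point_fin la pY).
have [two|one] := pselect (exists x z, [/\ siblings la y x, siblings la y z & x <> z]).
  have yl : y \in l.
    have : Ym y.
      exists (fine (la [set y])); last by rewrite /= fineK.
      split; first by rewrite fine_gt0// (la_point_fin la pY) andbT.
      rewrite /atomic_multiplicity fineK//.
      by apply/andP; split; [apply/counting_ge2|apply/counting_lty].
    by rewrite El.
  apply: fixes_point; have := hT [set y] (map_f _ yl) (mp y) (la_point_fin la pY y).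
  by rewrite asboolT ?fineK// fine_gt0// (la_point_fin la pY) andbT.
apply: contrapT => n; apply: one; exists (Aut_fun T y), y; split => //.
exact: la_image_point pY _ _.
Qed.

Lemma auto_continuity (H : topologicalGroupType) (pi : {multiplicative Aut la -> H}) :
  separable H -> continuous pi.
Proof.
move=> sH; apply: continuous_at_one => V hV; apply: contrapT => nV.
have [V1 [hV1 k1]] := small_products 14 hV.
have [V0 [hV0 k0]] := small_quotients hV1.
have [e he] := separable_cover sH hV0.
pose A n : set (Aut la) := [set g | V0 ((e n)^-1 * pi g)%g].
have covA g : exists n, A n g by exact: he.
have pi1 : pi 1%g = 1%g by apply: (@mulgI _ (pi 1%g)); rewrite -gmulfM !mulg1.
have piV g : pi g^-1%g = (pi g)^-1%g by apply: (@mulgI _ (pi g)); rewrite -gmulfM !mulgV.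
have WV g : Wg A g -> V1 (pi g).
  move=> [n [a [b [Aa Ab ->]]]]; rewrite gmulfM piV.
  rewrite (_ : _ * _ = ((e n)^-1 * pi a)^-1 * ((e n)^-1 * pi b))%g; first exact: k0.
  by rewrite invgM invgK -mulgA mulVKg.
have WnV k g : (k <= 14)%N -> Wn A k g -> V (pi g).
  move=> k14 [l [sl hl <-]].
  have -> : pi (gprod l) = gprod (map pi l).
    by elim: (l) => //= x s IH; rewrite gmulfM IH.
  apply: k1; first by rewrite size_map sl.
  by move=> _ /mapP[x xl ->]; apply: WV; exact: hl.
have badT : forall Pm : seq (set Y) * nat, exists T : Aut la,
    [/\ {in Pm.1, forall b, measurable b -> la b < +oo -> la (Aut_fun T @` b `+` b) < (Pm.2.+1%:R^-1)%:E},
     forall y, fin_atoms la y -> Aut_fun T y = y & ~ V (pi T)].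
  move=> [P m] /=; apply: contrapT => h; apply: nV.
  have e0 (b : set Y) : (0 < (m.+1%:R^-1 : R))%R by rewrite invr_gt0 ltr0n.
  apply: filterS2 (near_one_sets P e0) near_one_fin_atoms => T h1 h2 /=.
  by apply: contrapT => h3; apply: h; exists T.
have [bT hbT] := choice badT.
pose bad P m : mpbij la := Aut_fun (bT (P, m)).
have bfix P m y : fin_atoms la y -> bad P m y = y by have [_ h _] := hbT (P, m); exact: h.
have [|P [m [k [hP k14 hk]]]] := some_bad_is_short pY bfix covA.
  move=> P m b hP bP; have [h _ _] := hbT (P, m); have [mb fb] := hP _ bP.
  have := h _ bP mb fb; rewrite -/(bad P m) => lt.
  have mD : measurable (bad P m @` b `\` b) by apply: measurableD => //; exact: mpfun_image.
  have le : la (bad P m @` b `\` b) <= la (bad P m @` b `+` b).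
    apply: le_measure; rewrite ?inE//; last by move=> z; left.
    by apply: measurable_setY => //; exact: mpfun_image.
  have {lt}le := le_lt_trans le lt; rewrite -lte_fin fineK//.
  by rewrite ge0_fin_numE// (lt_trans le)// ltry.
have [_ _] := hbT (P, m); apply; apply: (WnV k) => //.
by move: hk; rewrite /cl /bad Aut_funK.
Qed.

End steinhaus.

(** * The discontinuous sign morphism *)

(** The group {1, -1} with [true] for -1. The separate name keeps this group law away from
    [bool]. *)
Definition sign_group := bool.
HB.instance Definition _ := Topological.copy sign_group bool.
HB.instance Definition _ := isGroup.Build sign_group addbA addFb addbF addbb addbb.

Lemma sign_mul_continuous : continuous (fun x : sign_group * sign_group => (x.1 * x.2)%g).
Proof.
move=> [a b] U /nbhs_singleton hU; exists ([set a], [set b]).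
  by split; exact: (@discrete_set1 bool).
by move=> [x y] /= [-> ->].
Qed.

Lemma sign_inv_continuous : continuous (fun x : sign_group => (x^-1)%g).
Proof. by move=> a U; apply. Qed.

HB.instance Definition _ := isTopologicalGroup.Build sign_group sign_mul_continuous sign_inv_continuous.

Lemma separable_sign_group : separable sign_group.
Proof.
exists setT; first exact: countableP.
by move=> O [x Ox] _; exists x.
Qed.

Section parity.
Context d (Y : measurableType d) (R : realType) (la : {sigma_finite_measure set Y -> \bar R}).
Variables (nr : nat -> Y -> Y -> Prop) (xs : nat -> Y).
Hypothesis pY : polish nr xs.
Variables (r : nat -> R) (a : nat -> seq Y) (x y : nat -> Y).
Hypotheses (r_inj : injective r) (r_pos : forall n, 0 < r n)
  (aP : forall n z, (z \in a n) = (la [set z] == (r n)%:E))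
  (xa : forall n, x n \in a n) (ya : forall n, y n \in a n) (xy : forall n, x n != y n).
Local Open Scope ereal_scope.

Fact block_stable (T : mpbij la) n (z : seq_sub (a n)) : T (ssval z) \in a n.
Proof. by rewrite aP (la_image_point pY) -aP; exact: ssvalP. Qed.

Definition block_map (T : mpbij la) n (z : seq_sub (a n)) : seq_sub (a n) :=
  SeqSub (block_stable T z).

Fact block_map_inj (T : mpbij la) n : injective (@block_map T n).
Proof. by move=> z w /(congr1 val) /= /(bij_inj (mpfun_bij T)) /val_inj. Qed.

Definition sgn (T : mpbij la) n : bool := odd_perm (perm (@block_map_inj T n)).

(** Atoms are not null, so maps that agree almost everywhere agree on every block. *)
Lemma sgn_ae (S T : mpbij la) n : {ae la, S =1 T} -> sgn S n = sgn T n.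
Proof.
move=> h; rewrite /sgn; congr odd_perm; apply/perm.permP => z; rewrite !permE; apply: val_inj => /=.
have mp (w : Y) : measurable [set w] := measurable_point pY w.
case: h => N [mN N0 hN]; apply: contrapT => n0.
have : la [set ssval z] = 0.
  by apply: (subset_measure0 (B := N)) => // _ ->; apply: hN.
have := ssvalP z; rewrite aP => /eqP -> [] /eqP.
by rewrite gt_eqF.
Qed.

Lemma sgnM (S T : mpbij la) n : sgn (mpbijM S T) n = sgn S n (+) sgn T n.
Proof.
rewrite addbC -odd_permM /sgn; congr odd_perm; apply/perm.permP => z.
by rewrite permM !permE; exact: val_inj.
Qed.

Lemma parity_morphism (G : set_system nat) : UltraFilter G ->
  exists pi : {multiplicative Aut la -> sign_group}, forall T, pi T = `[< G (sgn (Aut_fun T)) >].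
Proof.
move=> UG; pose chi (T : Aut la) : sign_group := `[< G (sgn (Aut_fun T)) >].
have chiM : {morph chi : S T / (S * T)%g}.
  move=> S T; rewrite /chi.
  have -> : G (sgn (Aut_fun (S * T)%g)) = G [set n | sgn (Aut_fun S) n (+) sgn (Aut_fun T) n].
    congr (G _); apply/funext => n; congr is_true; rewrite -sgnM.
    have -> : (S * T)%g = cl (mpbijM (Aut_fun S) (Aut_fun T)) by rewrite clM /cl !Aut_funK.
    exact: sgn_ae (Aut_funE _).
  (* Limits along G commute with negation; here maximality of the ultrafilter is used. *)
  have e (p : nat -> bool) : `[< G [set n | ~~ p n] >] = ~~ `[< G p >].
    apply/asboolP/idP => [h|/asboolPn h].
      apply/asboolPn => k; have [n [/= pn /negP]] := filter_ex (filterI k h); exact.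
    have [//|] := in_ultra_setVsetC p UG.
    by apply: filterS => n /= /negP.
  case: (asboolP (G (sgn (Aut_fun S)))) => hS.
    rewrite -[RHS]/(~~ _) -e; congr asbool; apply/propext; split.
      by apply: filterS2 hS => n /= ->.
    by apply: filterS2 hS => n /= ->.
  have {}hS : G [set n | ~~ sgn (Aut_fun S) n] by apply/asboolP; rewrite e; apply/asboolPn.
  rewrite -[RHS]/(`[< _ >]); congr asbool; apply/propext; split.
    by apply: filterS2 hS => n /= /negbTE ->.
  by apply: filterS2 hS => n /= /negbTE ->.
pose mx := isMultiplicative.Build (Aut la) sign_group chi chiM.
by exists (HB.pack_for {multiplicative Aut la -> sign_group} chi mx).
Qed.

Let pair n : set Y := [set x n; y n].
Let tail N k := if (N <= k)%N then pair k else set0.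
Let swap n z := if z == x n then y n else if z == y n then x n else z.

Let mp (z : Y) : measurable [set z] := measurable_point pY z.

Let pair_block n z : pair n z -> z \in a n.
Proof. by move=> [->|->]. Qed.

Let block_inj n m z : z \in a n -> z \in a m -> n = m.
Proof. by rewrite !aP => /eqP -> /eqP[] /r_inj. Qed.

Let m_pair n : measurable (pair n).
Proof. exact: measurableU. Qed.

Let swap_x n : swap n (x n) = y n.
Proof. by rewrite /swap eqxx. Qed.

Let swap_y n : swap n (y n) = x n.
Proof. by rewrite /swap eqxx eq_sym (negbTE (xy n)). Qed.

Let swap_off n z : ~ pair n z -> swap n z = z.
Proof.
by move=> h; rewrite /swap; case: eqP => [e|_]; [case: h; left|case: eqP => [e|//]; case: h; right].
Qed.

Let swap_mmap n : mmap (swap n).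
Proof.
move=> A mA.
rewrite (_ : _ @^-1` _ = (A `\` pair n) `|` (pair n `&` swap n @^-1` A)).
  apply: measurableU; first exact: measurableD.
  apply: (countable_measurable pY); apply: finite_set_countable; apply: finite_setIl.
  by rewrite /pair finite_setU; split; exact: finite_set1.
apply/seteqP; split=> z.
  have [h|h] := pselect (pair n z); first by right.
  by rewrite /preimage /= => hz; left; split => //; rewrite -(swap_off h).
by move=> [[Az h]|[]//]; rewrite /preimage /=; rewrite -[X in A X](swap_off h) in Az.
Qed.

Let la_pair n A : measurable A ->
  la (pair n `&` A) = (if `[< A (x n) >] then (r n)%:E else 0) + (if `[< A (y n) >] then (r n)%:E else 0).
Proof.
move=> mA.
have -> : la (pair n `&` A) = la ([set x n] `&` A) + la ([set y n] `&` A).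
  rewrite /pair setIUl; apply: measureU; try exact: measurableI.
  by rewrite -subset0 => z [[-> _] [e _]]; have := xy n; rewrite e eqxx.
have h (z : Y) : z \in a n -> la ([set z] `&` A) = if `[< A z >] then (r n)%:E else 0.
  rewrite aP => /eqP <-; case: asboolP => Az.
    by congr (la _); apply/seteqP; split=> w; [case|move=> ->].
  by rewrite (_ : _ `&` _ = set0) ?measure0// -subset0 => w [->].
by rewrite !h.
Qed.

Lemma tail_swap N : exists T : mpbij la, [/\ involutive T,
  forall n z, (N <= n)%N -> z \in a n -> T z = swap n z &
  forall z, ~ (\bigcup_k tail N k) z -> T z = z].
Proof.
have tailP k z : tail N k z -> (N <= k)%N /\ pair k z by rewrite /tail; case: ifP.
have [k|||k A mA|T [T1 T2 mT pT]] := @glue_map _ _ _ la (tail N) swap.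
- by rewrite /tail; case: ifP.
- move=> i j _ _ [z [/tailP[_ hi] /tailP[_ hj]]].
  exact: block_inj (pair_block hi) (pair_block hj).
- exact: swap_mmap.
- rewrite /tail; case: ifP => _; last by rewrite !set0I.
  refine (etrans (la_pair k (@swap_mmap k _ mA)) (etrans _ (esym (la_pair k mA)))).
  have -> : (swap k @^-1` A) (x k) = A (y k) by rewrite -(swap_x k).
  have -> : (swap k @^-1` A) (y k) = A (x k) by rewrite -(swap_y k).
  by rewrite addeC.
have Tn n z : (N <= n)%N -> z \in a n -> T z = swap n z.
  move=> Nn zn; have [h|h] := pselect (pair n z); first by apply: T1; rewrite /tail Nn.
  rewrite swap_off//; apply: T2 => -[k _ /tailP[_ hk]]; apply: h.
  by rewrite (block_inj zn (pair_block hk)).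
have TK : involutive T.
  move=> z; have [[k _ hk]|h] := pselect ((\bigcup_k tail N k) z); last by rewrite !T2// T2.
  have [Nk [->|->]] := tailP _ _ hk.
    by rewrite (Tn k (x k))// swap_x (Tn k)// swap_y.
  by rewrite (Tn k (y k))// swap_y (Tn k)// swap_x.
have bT : bijective T by exists T.
have iT A : T @` A = T @^-1` A.
  by apply/seteqP; split=> [_ [z Az <-]|z Az]; [rewrite /= TK|exists (T z)].
have imT A : measurable A -> measurable (T @` A) by rewrite iT; exact: mT.
have mfT : measurable_fun setT T by move=> _ A mA; rewrite setTI; exact: mT.
by exists (MPBij bT mfT imT pT).
Qed.

Lemma sgn_tail_swap N n (T : mpbij la) : (N <= n)%N ->
  (forall n z, (N <= n)%N -> z \in a n -> T z = swap n z) -> sgn T n.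
Proof.
move=> Nn h; rewrite /sgn (_ : perm _ = tperm (SeqSub (xa n)) (SeqSub (ya n))).
  rewrite odd_tperm; apply/eqP => /(congr1 val) /= e.
  by have := xy n; rewrite e eqxx.
apply/perm.permP => z; rewrite permE; apply: val_inj; rewrite /= (h n)//; last exact: ssvalP.
case: tpermP => [->|->|]; first exact: swap_x.
  exact: swap_y.
move=> nx ny; apply: swap_off => -[e|e]; [apply: nx|apply: ny]; exact: val_inj.
Qed.

(** The masses r n need not tend to 0. But the tails decrease to the empty set, and inside A, which
    has finite measure, continuity from above applies. *)
Lemma tail_swap_small (A : set Y) (e : R) : measurable A -> la A < +oo -> (0 < e)%R ->
  \forall N \near \oo, la (A `&` \bigcup_k tail N k) < e%:E.
Proof.
move=> mA fA e0; pose F N := A `&` \bigcup_k tail N k.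
have mF N : measurable (F N).
  apply: measurableI => //; apply: bigcupT_measurable => k; rewrite /tail; case: ifP => //.
have F0 : \bigcap_N F N = set0.
  rewrite -subset0 => z Fz; have [_ [k _ hk]] := Fz 0%N I.
  have [_ [j _ ]] := Fz k.+1 I; rewrite /tail; case: ifP => // kj hj.
  have kk : pair k z by move: hk; rewrite /tail.
  by have := block_inj (pair_block kk) (pair_block hj) => E; rewrite E ltnn in kj.
have dF : nonincreasing_seq F.
  move=> N M NM; apply/subsetPset => z [Az [k _ hk]]; split => //; exists k => //.
  by move: hk; rewrite /tail; case: ifP => // Mk; rewrite (leq_trans NM Mk).
have F0fin : la (F 0%N) < +oo.
  by apply: le_lt_trans fA; apply: le_measure; rewrite ?inE// => z [].
have := nonincreasing_cvg_mu F0fin mF; rewrite F0 measure0 => /(_ measurable0 dF).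
move=> /fine_cvgP[fF /cvgrPdist_lt /(_ _ e0)]; apply: filterS2 fF => N /= fN.
by rewrite sub0r normrN ger0_norm ?fine_ge0// -lte_fin fineK.
Qed.

Lemma parity_discontinuous : ~ automatic_continuity (Aut la).
Proof.
move=> ac; have [G [UG GN]] := ultraFilterLemma (_ : ProperFilter (\oo : set_system nat)).
have [pi hpi] := parity_morphism UG.
have [T hT] := choice tail_swap.
have cT : (fun N => cl (T N)) @ \oo --> (1%g : Aut la).
  apply/weak_cvg_near => A e mA fA e0.
  have e20 : (0 < e / 2)%R by rewrite divr_gt0.
  have := tail_swap_small mA fA e20; apply: filterS => N hN /=.
  have [TK _ off] := hT N; pose U := A `&` \bigcup_k tail N k.
  have mU : measurable U.
    apply: measurableI => //; apply: bigcupT_measurable => k; rewrite /tail; case: ifP => //.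
  have mi (S : mpbij la) (B : set Y) : measurable B -> measurable (S @` B) by exact: mpfun_image.
  have h1 : la ((Aut_fun (cl (T N)) @` A) `+` (T N @` A)) = 0 := eqae_image mA (Aut_funE (T N)).
  have h2 : la (A `+` (Aut_fun (1%g : Aut la) @` A)) = 0.
    rewrite setYC -[X in _ `+` X]image_id; exact: eqae_image mA (Aut_funE (mpbij1 la)).
  have h3 : la ((T N @` A) `+` A) <= la (T N @` U) + la U.
    apply: le_trans (measureU2 la (mi _ _ mU) mU); apply: le_measure; rewrite ?inE.
    - exact: measurable_setY (mi _ _ mA) mA.
    - by apply: measurableU => //; exact: mi.
    move=> z [[[w Aw <-] nA]|[Az nT]].
      left; exists w => //; split => //; apply: contrapT => /off E; by rewrite E in nA.
    by right; split => //; apply: contrapT => /off E; apply: nT; exists z.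
  have h4 : la (Aut_fun (cl (T N)) @` A `+` Aut_fun (1%g : Aut la) @` A) <=
    la ((Aut_fun (cl (T N)) @` A) `+` (T N @` A)) +
    la ((T N @` A) `+` (Aut_fun (1%g : Aut la) @` A)) := le_mu_setY la (mi _ _ mA) (mi _ _ mA) (mi _ _ mA).
  have h5 : la ((T N @` A) `+` (Aut_fun (1%g : Aut la) @` A)) <=
    la ((T N @` A) `+` A) + la (A `+` (Aut_fun (1%g : Aut la) @` A)) := le_mu_setY la (mi _ _ mA) mA (mi _ _ mA).
  apply: le_lt_trans h4 _; rewrite h1 add0e; apply: le_lt_trans h5 _; rewrite h2 adde0.
  apply: le_lt_trans h3 _.
  have -> : la (T N @` U) = la U := mpfun_image_preserving (T N) mU.
  by rewrite [e]splitr EFinD lteD.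
have pi1 : pi 1%g = 1%g by apply: (@mulgI _ (pi 1%g)); rewrite -gmulfM !mulg1.
have := ac _ separable_sign_group pi 1%g [set 1%g]; rewrite pi1.
move=> /(_ (@discrete_set1 bool _)) /cT h; have {}h : \oo [set N | pi (cl (T N)) = 1%g] := h.
have [N /= hN] := filter_ex h.
suff : pi (cl (T N)) = true by rewrite hN.
(* The map T N is odd on every block of index at least N, and G contains all final segments, so its
   limit sign is -1 although T N tends to 1. *)
rewrite hpi; apply/asboolP; apply: GN; exists N => // n /= Nn.
have [_ h2 _] := hT N; rewrite (sgn_ae n (Aut_funE (T N))); exact: sgn_tail_swap h2.
Qed.

End parity.

(** * The equivalence *)

Section equivalence.
Context d (Y : measurableType d) (R : realType) (la : {sigma_finite_measure set Y -> \bar R}).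
Local Open Scope ereal_scope.

Let multiple_radii := [set r : R | (0 < r)%R /\ 2%:E <= atomic_multiplicity la r < +oo].

Lemma automatic_continuity_finite (nr : nat -> Y -> Y -> Prop) (xs : nat -> Y) :
  polish nr xs -> automatic_continuity (Aut la) -> finite_set multiple_radii.
Proof.
move=> pY ac; apply: contrapT => /infiniteP/pcard_leP[f].
have r_inj i j : f i = f j -> i = j by move/(@inj _ _ _ f); apply; rewrite inE.
have fP n : multiple_radii (f n) by exact: (@funS _ _ _ _ f n I).
have blocks n : exists axy : seq Y * (Y * Y), [/\ (forall z, (z \in axy.1) = (la [set z] == (f n)%:E)),
    axy.2.1 \in axy.1, axy.2.2 \in axy.1 & axy.2.1 != axy.2.2].
  have [_ /andP[two /counting_lty fin]] := fP n.
  have [x [y [hx hy /eqP n_xy]]] := (counting_ge2 R fin).1 two.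
  have /finite_seqP[l El] := fin; exists (l, (x, y)) => /=.
  have lP z : (z \in l) = (la [set z] == (f n)%:E).
    have E : (la [set z] = (f n)%:E) = (z \in l) by exact: (congr1 (fun A : set Y => A z) El).
    by apply/idP/eqP; rewrite E.
  by split => //; rewrite lP; apply/eqP.
have [b hb] := choice blocks.
apply: (@parity_discontinuous _ _ _ la _ _ pY f (fun n => (b n).1) (fun n => (b n).2.1) (fun n => (b n).2.2)) ac => //.
- by move=> n; have [] := fP n.
- by move=> n z; have [h _ _ _] := hb n; exact: h.
- by move=> n; have [] := hb n.
- by move=> n; have [] := hb n.
- by move=> n; have [] := hb n.
Qed.

Lemma empty_automatic_continuity : (Y -> False) -> automatic_continuity (Aut la).
Proof.
move=> noY H _ pi; apply: continuous_at_one => V hV.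
have E (T : Aut la) : T = 1%g.
  by rewrite -(Aut_funK T); apply/eqP/Aut_eqP/aeW => y; case: (noY y).
have pi1 : pi 1%g = 1%g by apply: (@mulgI _ (pi 1%g)); rewrite -gmulfM !mulg1.
rewrite (_ : _ @^-1` _ = setT); first exact: filterT.
by apply/seteqP; split=> T // _; rewrite /preimage /= (E T) pi1; exact: nbhs_singleton.
Qed.

End equivalence.

Theorem theorem1p3 (R : realType) (d : measure_display) (Y : measurableType d)
    (hY : standard_borel R Y)
    (lambda : {sigma_finite_measure set Y -> \bar R}) :
  automatic_continuity (Aut lambda) <->
  finite_set [set r : R | 0 < r /\
                          (2%:E <= atomic_multiplicity lambda r < +oo)%E].
Proof.
(* [standard_polish] asks for a point, so the empty space is treated apart; both sides hold
   there. *)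
have [[y]|noY] := pselect (inhabited Y).
  have [nr [xs pY]] := standard_polish hY y; split.
    exact: automatic_continuity_finite pY.
  by move=> fm H sH pi; exact: auto_continuity pY fm H pi sH.
have {}noY (y : Y) : False by apply: noY.
split=> _; last exact: empty_automatic_continuity.
rewrite (_ : [set r | _] = set0)//; rewrite -subset0 => r [r0 /andP[two /counting_lty fin]].
by have [x _] := (counting_ge2 R fin).1 two; case: (noY x).
Qed.
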